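(* Let $U(L)$ be the universal enveloping (Hopf) algebra of the Lie algebra $(L,[\cdot,\cdot])$, and let $(U(L_0),\star,\Delta)$ be the universal enveloping algebra of $L_0=(L,[\cdot,\cdot]_0)$ with its usual coproduct $\Delta$ and the product $\star$ built from the post-Lie product $\widehat{\blacktriangleright}$. Then $U(L)$ is isomorphic as a Hopf algebra to $(U(L_0),\star,\Delta)$. Furthermore, this isomorphism gives a partially symmetric basis of $U(L)$: since elements of $\tilde L$ commute with each other in $U(L_0)$, the Poincaré–Birkhoff–Witt monomials of $U(L_0)$ in $\partial_0,\dots,\partial_d$ and the basis elements $z^\gamma D^{(n)}$ of $\tilde L$ do not depend on the order of the factors belonging to $\tilde L$, and these monomials are carried by the isomorphism to a basis of $U(L)$.
   Context: Here $\mathbb{N}=\{0,1,2,\dots\}$, $d\ge0$ is fixed, and $e_0,\dots,e_d$ is the canonical basis of $\mathbb{N}^{d+1}$. Multi-indices. Let $(z_k)_{k\in\mathbb{N}}$ and $(z_n)_{n\in\mathbb{N}^{d+1}\setminus\{0\}}$ be two disjoint families of commuting variables. A multi-index $\gamma$ is a finitely supported function with values in $\mathbb{N}$ on the disjoint union $\mathbb{N}\sqcup(\mathbb{N}^{d+1}\setminus\{0\})$, and $z^\gamma=\prod_kz_k^{\gamma(k)}\prod_nz_n^{\gamma(n)}$. Set $[\gamma]=\sum_{k\ge0}k\,\gamma(k)-\sum_{n\ne0}\gamma(n)$. Derivations on polynomials in these variables: $D^{(0)}=\sum_{k\in\mathbb{N}}(k+1)z_{k+1}\partial_{z_k}$;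 $D^{(n)}=\partial_{z_n}$ for $n\in\mathbb{N}^{d+1}\setminus\{0\}$; $\partial_i=\sum_{n\in\mathbb{N}^{d+1}}(n_i+1)z_{n+e_i}D^{(n)}$ for $i\in\{0,\dots,d\}$. For such a derivation $D$, the coefficients $(D)^{\gamma}_{\beta}$ are defined by $D z^\gamma=\sum_\beta (D)^\gamma_\beta z^\beta$. Spaces. $\tilde L$ is the real vector space with basis $\{z^\gamma D^{(n)}:[\gamma]\ge0,\ n\in\mathbb{N}^{d+1}\}$ and $L$ is the real vector space with basis $\{z^\gamma D^{(n)}:[\gamma]\ge0,\ n\in\mathbb{N}^{d+1}\}\cup\{\partial_0,\dots,\partial_d\}$. On $\tilde L$ one has the pre-Lie product $z^\gamma D^{(n)}\blacktriangleright z^{\gamma'}D^{(n')}=\sum_{\beta'}(z^\gamma D^{(n)})^{\gamma'}_{\beta'}z^{\beta'}D^{(n')}$. The Lie bracket $[\cdot,\cdot]$ on $L$ is $[z^{\gamma}D^{(n)},z^{\gamma'}D^{(n')}]=\sum_{\beta'}(z^{\gamma}D^{(n)})^{\gamma'}_{\beta'}z^{\beta'}D^{(n')}-\sum_{\beta}(z^{\gamma'}D^{(n')})^{\gamma}_{\beta}z^{\beta}D^{(n)}$, $[\partial_i,\partial_j]=0$, $[z^{\gamma}D^{(n)},\partial_i]=n_iz^{\gamma}D^{(n-e_i)}-\sum_{\beta}(\partial_i)^{\gamma}_{\beta}z^{\beta}D^{(n)}$ (terms $n_iz^\gamma D^{(n-e_i)}$ are $0$ when $n_i=0$). $L_0$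 is the Lie algebra with underlying space $L$ and the bracket $[\cdot,\cdot]_0$, the antisymmetric bilinear map vanishing on $\tilde L\times\tilde L$ and on pairs from the span of the $\partial_i$, with $[z^\gamma D^{(n)},\partial_i]_0=n_iz^\gamma D^{(n-e_i)}$. The bilinear product $\widehat{\blacktriangleright}$ on $L$ is $x\,\widehat{\blacktriangleright}\,y=x\blacktriangleright y$ for $x,y\in\tilde L$, $\partial_i\,\widehat{\blacktriangleright}\,z^\gamma D^{(n)}=\sum_\beta(\partial_i)^\gamma_\beta z^\beta D^{(n)}$, $z^\gamma D^{(n)}\,\widehat{\blacktriangleright}\,\partial_i=0$, $\partial_i\,\widehat{\blacktriangleright}\,\partial_j=0$. The triple $(L,[\cdot,\cdot]_0,\widehat{\blacktriangleright})$ is a post-Lie algebra, i.e. $x\,\widehat{\blacktriangleright}\,[y,z]_0=[x\,\widehat{\blacktriangleright}\,y,z]_0+[y,x\,\widehat{\blacktriangleright}\,z]_0$ and $[x,y]_0\,\widehat{\blacktriangleright}\,z=a(x,y,z)-a(y,x,z)$ with $a(x,y,z)=x\,\widehat{\blacktriangleright}\,(y\,\widehat{\blacktriangleright}\,z)-(x\,\widehat{\blacktriangleright}\,y)\,\widehat{\blacktriangleright}\,z$. The product $\star$. Write $\triangleright$ for $\widehat{\blacktriangleright}$. Let $\Delta$ be the coproduct of $U(L_0)$ with $\Delta x=x\otimes\mathbf 1+\mathbf 1\otimes x$ for $x\in L$, extended multiplicatively, with Sweedler notation $\Delta A=\sum_{(A)}A^{(1)}\otimes A^{(2)}$. Extend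 $\triangleright$ to $U(L_0)\otimes U(L_0)$ by: for $x,y,y_j\in L$, $A,B,C\in U(L_0)$, $x\triangleright\mathbf 1=0$, $x\triangleright y_1\cdots y_n=\sum_{j}y_1\cdots(x\triangleright y_j)\cdots y_n$, $\mathbf 1\triangleright A=A$, $xA\triangleright y=x\triangleright(A\triangleright y)-(x\triangleright A)\triangleright y$, $A\triangleright BC=\sum_{(A)}(A^{(1)}\triangleright B)(A^{(2)}\triangleright C)$. Then $A\star B=\sum_{(A)}A^{(1)}(A^{(2)}\triangleright B)$ is an associative product. *)

(* Defs.v *)
From HB Require Import structures.
From mathcomp Require Import all_boot all_order all_algebra.
From mathcomp Require Import finmap generic_quotient ring_quotient.
From mathcomp Require Import boolp classical_sets fsbigop reals.
From mathcomp Require Import monalg.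

Set Implicit Arguments.
Unset Strict Implicit.
Unset Printing Implicit Defensive.

Import Order.TTheory GRing.Theory Num.Theory.
Local Open Scope ring_scope.
Local Open Scope quotient_scope.

(* [{malg R[K]}] is the free R-module on K, and [<< k >>] its basis vector k. *)

Definition linext (R : comNzRingType) (K : choiceType) (X : lmodType R)
    (f : K -> X) (p : {malg R[K]}) : X :=
  \sum_(k <- msupp p) p@_k *: f k.

Definition bilinext (R : comNzRingType) (K K' : choiceType) (X : lmodType R)
    (f : K -> K' -> X) (p : {malg R[K]}) (q : {malg R[K']}) : X :=
  linext (fun k => linext (f k) q) p.

Definition is_bilinear (R : comNzRingType) (U V W : lmodType R)
    (f : U -> V -> W) : Prop :=
  (forall u, linear (f u)) /\ (forall v, linear (f^~ v)).

Definition is_basis (R : comNzRingType) (V : lmodType R) (K : choiceType)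
    (f : K -> V) : Prop :=
  forall v : V, exists! c : {malg R[K]}, v = linext f c.

Section QuotientModule.
Variables (R : comNzRingType) (V : lmodType R) (S : V -> Prop).

Inductive submod_gen : V -> Prop :=
| SubmodGen v of S v : submod_gen v
| Submod0 : submod_gen 0
| SubmodLin a u v of submod_gen u & submod_gen v : submod_gen (a *: u + v).

Definition submod_pred : {pred V} := [pred v | `[< submod_gen v >]].

Lemma submod_pred_zmod : zmod_closed submod_pred.
Proof.
split=> [|u v /asboolP hu /asboolP hv]; apply/asboolP; first exact: Submod0.
by rewrite addrC -scaleN1r; apply: SubmodLin.
Qed.

HB.instance Definition _ := GRing.isZmodClosed.Build V submod_pred
  submod_pred_zmod.

Definition quomod : Type := Quotient.quot submod_pred.

HB.instance Definition _ := Choice.on quomod.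
HB.instance Definition _ := GRing.Zmodule.on quomod.
HB.instance Definition _ := @EqQuotient.on quomod.
HB.instance Definition _ := @ZmodQuotient.on quomod.

Lemma quomodP (u v : V) : \pi_quomod u = \pi_quomod v <-> submod_gen (u - v).
Proof.
split=> [/eqP|h]; first by rewrite -Quotient.idealrBE => /asboolP.
by apply/eqP; rewrite -Quotient.idealrBE; apply/asboolP.
Qed.

Lemma quomod_piD : {morph \pi_quomod : u v / u + v}.
Proof. exact: (raddfD (\pi_quomod)). Qed.

Definition quomod_scale (a : R) (x : quomod) : quomod :=
  \pi_quomod (a *: repr x).

Lemma quomod_piZ a v : quomod_scale a (\pi_quomod v) = \pi_quomod (a *: v).
Proof.
apply/quomodP; rewrite -scalerBr -[_ *: _]addr0; apply: SubmodLin.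
  by apply/quomodP; rewrite reprK.
exact: Submod0.
Qed.

Lemma quomod_reprK (x : quomod) : \pi_quomod (repr x) = x.
Proof. exact: reprK. Qed.

Lemma quomod_scaleA a b x :
  quomod_scale a (quomod_scale b x) = quomod_scale (a * b) x.
Proof. by rewrite -[x]quomod_reprK !quomod_piZ scalerA. Qed.

Lemma quomod_scale1 : left_id 1 quomod_scale.
Proof. by move=> x; rewrite -[x]quomod_reprK quomod_piZ scale1r. Qed.

Lemma quomod_scaleDr : right_distributive quomod_scale +%R.
Proof.
move=> a x y; rewrite -[x]quomod_reprK -[y]quomod_reprK.
by rewrite -quomod_piD !quomod_piZ -quomod_piD scalerDr.
Qed.

Lemma quomod_scaleDl x : {morph quomod_scale^~ x : a b / a + b}.
Proof. by move=> a b /=; rewrite -[x]quomod_reprK !quomod_piZ -quomod_piD scalerDl. Qed.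

HB.instance Definition _ := GRing.Zmodule_isLmodule.Build R quomod
  quomod_scaleA quomod_scale1 quomod_scaleDr quomod_scaleDl.

End QuotientModule.

Section QuotientAlgebra.
Variables (R : comNzRingType) (A : algType R) (S : A -> Prop).

Inductive ideal_gen : A -> Prop :=
| IdealGen p r q of S r : ideal_gen (p * r * q).

(* the two-sided ideal generated by S *)
Local Notation ideal := (submod_gen ideal_gen).

Lemma idealMl p q : ideal q -> ideal (p * q).
Proof.
elim=> [_ [p' r q' h]||a u v _ hu _ hv].
- by apply: SubmodGen; rewrite !mulrA; constructor.
- by rewrite mulr0; apply: Submod0.
- by rewrite mulrDr -scalerAr; apply: SubmodLin.
Qed.

Lemma idealMr p q : ideal p -> ideal (p * q).
Proof.
elim=> [_ [p' r q' h]||a u v _ hu _ hv].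
- by apply: SubmodGen; rewrite -(mulrA (p' * r)); constructor.
- by rewrite mul0r; apply: Submod0.
- by rewrite mulrDl -scalerAl; apply: SubmodLin.
Qed.

Hypothesis proper : ~ ideal 1.

Definition quoalg of ~ ideal 1 : Type := quomod ideal_gen.
Local Notation Q := (quoalg proper).
HB.instance Definition _ := GRing.Lmodule.on Q.

Definition quoalg_pi (p : A) : Q := \pi_(quomod ideal_gen) p.
Definition quoalg_repr (u : Q) : A := repr (u : quomod ideal_gen).

Lemma quoalg_reprK : cancel quoalg_repr quoalg_pi.
Proof. by move=> u; apply: reprK. Qed.

Lemma quoalg_piP p q : quoalg_pi p = quoalg_pi q <-> ideal (p - q).
Proof. exact: quomodP. Qed.

Lemma quoalg_piD : {morph quoalg_pi : p q / p + q}.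
Proof. exact: quomod_piD. Qed.

Lemma quoalg_piZ a : {morph quoalg_pi : p / a *: p}.
Proof. by move=> p; symmetry; apply: quomod_piZ. Qed.

Definition quoalg_one : Q := quoalg_pi 1.
Definition quoalg_mul (u v : Q) : Q :=
  quoalg_pi (quoalg_repr u * quoalg_repr v).

Lemma quoalg_mul_pi p q :
  quoalg_pi (p * q) = quoalg_mul (quoalg_pi p) (quoalg_pi q).
Proof.
apply/quoalg_piP; set p' := quoalg_repr _; set q' := quoalg_repr _.
have -> : p * q - p' * q' = 1 *: (p * (q - q')) + (p - p') * q'.
  by rewrite scale1r mulrBr mulrBl addrA subrK.
apply: SubmodLin.
  by apply: idealMl; apply/quoalg_piP; rewrite quoalg_reprK.
by apply: idealMr; apply/quoalg_piP; rewrite quoalg_reprK.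
Qed.

Lemma quoalg_mulA : associative quoalg_mul.
Proof.
move=> u v w; rewrite -[u]quoalg_reprK -[v]quoalg_reprK -[w]quoalg_reprK.
by rewrite -!quoalg_mul_pi mulrA.
Qed.

Lemma quoalg_1mul : left_id quoalg_one quoalg_mul.
Proof. by move=> u; rewrite -[u]quoalg_reprK -quoalg_mul_pi mul1r. Qed.

Lemma quoalg_mul1 : right_id quoalg_one quoalg_mul.
Proof. by move=> u; rewrite -[u]quoalg_reprK -quoalg_mul_pi mulr1. Qed.

Lemma quoalg_mulDl : left_distributive quoalg_mul +%R.
Proof.
move=> u v w; rewrite -[u]quoalg_reprK -[v]quoalg_reprK -[w]quoalg_reprK.
by rewrite -!(quoalg_mul_pi, quoalg_piD) mulrDl.
Qed.

Lemma quoalg_mulDr : right_distributive quoalg_mul +%R.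
Proof.
move=> u v w; rewrite -[u]quoalg_reprK -[v]quoalg_reprK -[w]quoalg_reprK.
by rewrite -!(quoalg_mul_pi, quoalg_piD) mulrDr.
Qed.

Lemma quoalg_1neq0 : quoalg_one != 0.
Proof.
apply/eqP; have -> : (0 : Q) = quoalg_pi 0.
  by have := quoalg_piZ 0 0; rewrite !scale0r => ->.
by move=> /quoalg_piP; rewrite subr0.
Qed.

HB.instance Definition _ := GRing.Zmodule_isNzRing.Build Q
  quoalg_mulA quoalg_1mul quoalg_mul1 quoalg_mulDl quoalg_mulDr quoalg_1neq0.

Lemma quoalg_piM : {morph quoalg_pi : p q / p * q}.
Proof. exact: quoalg_mul_pi. Qed.

Lemma quoalg_scaleAl a (u v : Q) : a *: (u * v) = (a *: u) * v.
Proof.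
rewrite -[u]quoalg_reprK -[v]quoalg_reprK -quoalg_piZ.
by rewrite -!quoalg_piM -quoalg_piZ scalerAl.
Qed.

Lemma quoalg_scaleAr a (u v : Q) : a *: (u * v) = u * (a *: v).
Proof.
rewrite -[u]quoalg_reprK -[v]quoalg_reprK -quoalg_piZ.
by rewrite -!quoalg_piM -quoalg_piZ scalerAr.
Qed.

HB.instance Definition _ := GRing.Lmodule_isLalgebra.Build R Q quoalg_scaleAl.
HB.instance Definition _ := GRing.Lalgebra_isAlgebra.Build R Q quoalg_scaleAr.

End QuotientAlgebra.

Section FreeAlgebra.
Variable R : comNzRingType.

Lemma malg_scaleAr (K : monomType) a (p q : {malg R[K]}) :
  a *: (p * q) = p * (a *: q).
Proof.
rewrite (malgME p q) (malgMEw (fsubset_refl _) (msuppZ_le a q)).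
rewrite scaler_sumr; apply: eq_bigr => k _; rewrite scaler_sumr.
apply: eq_bigr => l _; apply/malgP => m.
by rewrite mcoeffZ !mcoeffU mcoeffZ mulrCA mulrnAr.
Qed.

Variable K : choiceType.

Definition free_alg : Type := {malg R[{fmonom K}]}.
HB.instance Definition _ := GRing.Lalgebra.on free_alg.
HB.instance Definition _ := GRing.Lalgebra_isAlgebra.Build R free_alg
  (@malg_scaleAr {fmonom K}).

Definition fgen (x : K) : free_alg := << fmu x >>.

Definition faug (p : free_alg) : R := mcoeff (@mone {fmonom K}) p.

Lemma faugD : {morph faug : p q / p + q}. Proof. exact: mcoeffD. Qed.
Lemma faugZ a : {morph faug : p / a *: p >-> a * p}.
Proof. by move=> p; apply: mcoeffZ. Qed.
Lemma faugM : {morph faug : p q / p * q}. Proof. exact: rmorphM. Qed.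
Lemma faug1 : faug 1 = 1. Proof. exact: rmorph1. Qed.

Lemma faug_gen x : faug (fgen x) = 0.
Proof.
rewrite /faug mcoeffU; case: eqP => // /(congr1 (@fmonom_val K)).
by rewrite fm1 fmU.
Qed.

Lemma faugB : {morph faug : p q / p - q}. Proof. exact: mcoeffB. Qed.

Lemma faug_lin a x y z : faug (fgen z - a *: fgen x - fgen y) = 0.
Proof. by rewrite 2!faugB faugZ 3!faug_gen mulr0 2!subr0. Qed.

Lemma faug_br x y z : faug (fgen x * fgen y - fgen y * fgen x - fgen z) = 0.
Proof.
have h u v : faug (fgen u * fgen v) = 0 by rewrite faugM faug_gen mul0r.
by rewrite 2!faugB faug_gen subr0 -[RHS](subrr 0); congr (_ - _); apply: h.
Qed.

Lemma faug_proper (S : free_alg -> Prop) :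
  (forall p, S p -> faug p = 0) -> ~ submod_gen (ideal_gen S) 1.
Proof.
move=> S0 h; have: faug 1 = 0; last by rewrite faug1; apply/eqP/oner_neq0.
elim: h => [_ [p r q /S0 r0]||a u v _ hu _ hv].
- by rewrite !faugM r0 mulr0 mul0r.
- exact: mcoeff0.
- by rewrite faugD faugZ hu hv mulr0 addr0.
Qed.

End FreeAlgebra.

Section Tensor.
Variables (R : comNzRingType) (V W : lmodType R).

Inductive tens_rel : {malg R[(V * W)%type]} -> Prop :=
| TensRelL a v v' w :
    tens_rel (<< (a *: v + v', w) >> - a *: << (v, w) >> - << (v', w) >>)
| TensRelR a v w w' :
    tens_rel (<< (v, a *: w + w') >> - a *: << (v, w) >> - << (v, w') >>).

Definition tensor : Type := quomod tens_rel.
HB.instance Definition _ := GRing.Lmodule.on tensor.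

Definition tens (v : V) (w : W) : tensor := \pi_(quomod tens_rel) << (v, w) >>.

(* The map V (x) W -> X induced by f: if t is the sum of the v_i (x) w_i, then
   [tens_ext f t] is the sum of the f v_i w_i.  It is used for bilinear f only,
   for which the choice of a decomposition of t is immaterial. *)
Definition tens_ext (X : lmodType R) (f : V -> W -> X) (t : tensor) : X :=
  linext (fun p : V * W => f p.1 p.2) (repr (t : quomod tens_rel)).

End Tensor.

Arguments tens {R V W}.
Notation "v '\otimes' w" := (tens v w)
  (at level 40, left associativity) : ring_scope.

Record hopf_ops (R : comNzRingType) (H : lmodType R) := HopfOps {
  hmul : H -> H -> H;
  hone : H;
  hcomul : H -> tensor H H;
  hcounit : H -> R;
  hantipode : H -> H
}.

(* The product of H (x) H induced by a product of H. *)
Definition tens_mul (R : comNzRingType) (H : lmodType R) (mul : H -> H -> H)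
    (s t : tensor H H) : tensor H H :=
  tens_ext (fun a b => tens_ext (fun c d => mul a c \otimes mul b d) t) s.

Section Hopf.
Variables (R : comNzRingType) (H : lmodType R) (h : hopf_ops H).
Local Notation mul := (hmul h).
Local Notation one := (hone h).
Local Notation Delta := (hcomul h).
Local Notation eps := (hcounit h).
Local Notation S := (hantipode h).

Record is_hopf : Prop := IsHopf {
  hopf_mul_bilinear : is_bilinear mul;
  hopf_mulA : associative mul;
  hopf_1mul : left_id one mul;
  hopf_mul1 : right_id one mul;
  hopf_comul_linear : linear Delta;
  hopf_coassoc : forall x,
    tens_ext (fun a b => tens_ext (fun a1 a2 => a1 \otimes (a2 \otimes b))
                                  (Delta a)) (Delta x) =
    tens_ext (fun a b => a \otimes Delta b) (Delta x);
  hopf_counit_linear : scalar eps;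
  hopf_counitl : forall x, tens_ext (fun a b => eps a *: b) (Delta x) = x;
  hopf_counitr : forall x, tens_ext (fun a b => eps b *: a) (Delta x) = x;
  hopf_comulM : {morph Delta : x y / mul x y >-> tens_mul mul x y};
  hopf_comul1 : Delta one = one \otimes one;
  hopf_counitM : {morph eps : x y / mul x y >-> x * y};
  hopf_counit1 : eps one = 1;
  hopf_antipode_linear : linear S;
  hopf_antipodel : forall x,
    tens_ext (fun a b => mul (S a) b) (Delta x) = eps x *: one;
  hopf_antipoder : forall x,
    tens_ext (fun a b => mul a (S b)) (Delta x) = eps x *: one
}.

End Hopf.

Record is_hopf_iso (R : comNzRingType) (H H' : lmodType R)
    (h : hopf_ops H) (h' : hopf_ops H') (Phi : H -> H') : Prop := IsHopfIso {
  hopf_iso_linear : linear Phi;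
  hopf_iso_bij : bijective Phi;
  hopf_iso_mul : {morph Phi : x y / hmul h x y >-> hmul h' x y};
  hopf_iso_one : Phi (hone h) = hone h';
  hopf_iso_comul : forall x,
    hcomul h' (Phi x) = tens_ext (fun a b => Phi a \otimes Phi b) (hcomul h x);
  hopf_iso_counit : forall x, hcounit h' (Phi x) = hcounit h x;
  hopf_iso_antipode : {morph Phi : x / hantipode h x >-> hantipode h' x}
}.

(* U(V) is the quotient of the free algebra on the set V by the two-sided ideal
   generated by the linear relations between the elements of V, which gives the
   tensor algebra of V, and by the x y - y x - [x, y].  The definition makes
   sense for any operation [br]. *)
Section Enveloping.
Variables (R : comNzRingType) (V : lmodType R) (br : V -> V -> V).

Local Notation gen := (@fgen R V).

Inductive uenv_rel : free_alg R V -> Prop :=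
| UenvLin a x y : uenv_rel (gen (a *: x + y) - a *: gen x - gen y)
| UenvBr x y : uenv_rel (gen x * gen y - gen y * gen x - gen (br x y)).

Lemma uenv_proper : ~ submod_gen (ideal_gen uenv_rel) 1.
Proof.
apply: faug_proper => _ [a x y|x y]; [exact: faug_lin|exact: faug_br].
Qed.

Definition uenv : Type := quoalg uenv_proper.
HB.instance Definition _ := GRing.Algebra.on uenv.

Definition uenv_in (x : V) : uenv := quoalg_pi uenv_proper (gen x).

(* The linear map U(V) -> X sending x1 ... xn to f [:: x1; ...; xn], computed on
   a representative of u in the free algebra.  It is used only for families f
   compatible with the defining relations of U(V). *)
Definition uenv_ext (X : lmodType R) (f : seq V -> X) (u : uenv) : X :=
  linext (fun w : {fmonom V} => f w) (@quoalg_repr _ _ _ uenv_proper u).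

Definition uenv_comul : uenv -> tensor uenv uenv :=
  uenv_ext (foldr
    (fun x => tens_mul *%R (uenv_in x \otimes 1 + 1 \otimes uenv_in x))
    (1 \otimes 1)).

Definition uenv_counit : uenv -> R :=
  uenv_ext (fun w => (nilp w)%:R : R^o).

Definition uenv_antipode : uenv -> uenv :=
  uenv_ext (fun w => (- 1) ^+ size w *: \prod_(x <- rev w) uenv_in x).

Definition uenv_hopf : hopf_ops uenv :=
  HopfOps *%R 1 uenv_comul uenv_counit uenv_antipode.

End Enveloping.

Section PostLie.
Variables (R : comNzRingType) (V : lmodType R).
Variables (br tri : V -> V -> V).
Local Notation U := (uenv br).
Local Notation i := (uenv_in br).

(* [T] extends the post-Lie product [tri] of V to U(V).  These equations
   characterize [T]; its existence uses the post-Lie identities. *)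
Record extends_postlie (T : U -> U -> U) : Prop := ExtendsPostlie {
  ext_bilinear : is_bilinear T;
  ext_tri : forall x y, T (i x) (i y) = i (tri x y);
  ext_prim1 : forall x, T (i x) 1 = 0;
  ext_prim_prod : forall x (n : nat) (y : 'I_n -> V),
    T (i x) (\prod_j i (y j)) =
    \sum_(j < n) \prod_(k < n) i (if k == j then tri x (y k) else y k);
  ext_1 : forall A, T 1 A = A;
  ext_prim_mul : forall x A y,
    T (i x * A) (i y) = T (i x) (T A (i y)) - T (T (i x) A) (i y);
  ext_mulr : forall A B C,
    T A (B * C) = tens_ext (fun A1 A2 => T A1 B * T A2 C) (uenv_comul A)
}.

Definition star (T : U -> U -> U) (A B : U) : U :=
  tens_ext (fun A1 A2 => A1 * T A2 B) (uenv_comul A).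

(* (U(V), star, Delta), with a given antipode. *)
Definition star_hopf (T : U -> U -> U) (S : U -> U) : hopf_ops U :=
  HopfOps (star T) 1 (uenv_comul (br := br)) (uenv_counit (br := br)) S.

End PostLie.

Section MultiIndex.
Variables (R : realType) (d : nat).

(* N^{d+1} *)
Definition vec := {ffun 'I_d.+1 -> nat}.

Definition vunit (i : 'I_d.+1) : vec := [ffun j => (j == i) : nat].
Definition vsub (n m : vec) : vec := [ffun j => (n j - m j)%N].

(* [inl k] is the variable z_k and [inr n] the variable z_n, n <> 0. *)
Definition zvar := (nat + {n : vec | n != 0%R})%type.

Definition mindex := {cmonom zvar}.

Definition hdeg (g : mindex) : int :=
  \sum_(v <- finsupp g)
    (if v is inl k then k%:Z else - 1) * (g v)%:Z.

Definition mpol := {malg R[mindex]}.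

Definition zvarP (v : zvar) : mpol := << ucm v >>.

Definition zpartial (v : zvar) : mpol -> mpol :=
  linext (fun g : mindex => (g v)%:R *: (<< divcm g (ucm v) >> : mpol)).

(* D^{(n)}; the sum over k has finitely many nonzero terms. *)
Definition derD (n : vec) (p : mpol) : mpol :=
  if insub n is Some n' then zpartial (inr n') p
  else \sum_(k \in [set: nat])
         k.+1%:R *: (zvarP (inl k.+1) * zpartial (inl k) p).

Lemma vaddunit_neq0 (n : vec) (i : 'I_d.+1) : n + vunit i != 0.
Proof.
by apply/eqP => /ffunP /(_ i); rewrite !ffunE eqxx /GRing.add /= addn1.
Qed.

(* partial_i; the sum over n has finitely many nonzero terms. *)
Definition derpart (i : 'I_d.+1) (p : mpol) : mpol :=
  \sum_(n \in [set: vec])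
    (n i).+1%:R *: (zvarP (inr (Sub (n + vunit i) (vaddunit_neq0 n i)))
                    * derD n p).

(* The coefficients (D)^g_b. *)
Definition dcoef (D : mpol -> mpol) (g b : mindex) : R := (D << g >>)@_b.

(* [(g, n)] stands for z^g D^{(n)}, with [g] >= 0. *)
Definition tbasis := ({g : mindex | 0 <= hdeg g} * vec)%type.

(* [inl (g, n)] stands for z^g D^{(n)} and [inr i] for partial_i. *)
Definition lbasis := (tbasis + 'I_d.+1)%type.

Definition L := {malg R[lbasis]}.

Definition zD (g : {g : mindex | 0 <= hdeg g}) (n : vec) : L := << inl (g, n) >>.

(* z^g D^{(n)} as an operator on polynomials *)
Definition zDop (x : tbasis) (p : mpol) : mpol :=
  (<< val x.1 >> : mpol) * derD x.2 p.

(* The sum over b of (D)^g_b z^b D^{(n)}.  It is enough to sum over the b with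
   [b] >= 0, as D is z^g' D^{(n')} with [g'] >= 0 or a partial_i: its other
   coefficients vanish. *)
Definition dsum (D : mpol -> mpol) (x : tbasis) : L :=
  \sum_(b \in [set: {g : mindex | 0 <= hdeg g}])
    dcoef D (val x.1) (val b) *: zD b x.2.

(* n_i z^g D^{(n - e_i)} *)
Definition lower (x : tbasis) (i : 'I_d.+1) : L :=
  (x.2 i)%:R *: zD x.1 (vsub x.2 (vunit i)).

Definition lie_basis (a b : lbasis) : L :=
  match a, b with
  | inl x, inl y => dsum (zDop x) y - dsum (zDop y) x
  | inl x, inr i => lower x i - dsum (derpart i) x
  | inr i, inl x => - (lower x i - dsum (derpart i) x)
  | inr _, inr _ => 0
  end.

Definition lie0_basis (a b : lbasis) : L :=
  match a, b with
  | inl x, inr i => lower x i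
  | inr i, inl x => - lower x i
  | _, _ => 0
  end.

Definition tri_basis (a b : lbasis) : L :=
  match a, b with
  | inl x, inl y => dsum (zDop x) y
  | inr i, inl x => dsum (derpart i) x
  | _, inr _ => 0
  end.

Definition lie : L -> L -> L := bilinext lie_basis.
Definition lie0 : L -> L -> L := bilinext lie0_basis.
Definition tri : L -> L -> L := bilinext tri_basis.

Definition in_tildeL (x : L) : Prop := forall i, x@_(inr i) = 0.

Definition pbw (w : seq lbasis) : uenv lie0 :=
  \prod_(b <- w) uenv_in lie0 << b >>.

Definition total_order (le : rel lbasis) : Prop :=
  [/\ reflexive le, antisymmetric le, transitive le & total le].

(* No partial_i lies between two elements of tilde L. *)
Definition tildeL_block (le : rel lbasis) : Prop :=
  forall (i : 'I_d.+1) (x y : tbasis), le (inl x) (inr i) = le (inl y) (inr i).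

(* w' is obtained from w by permuting its factors in tilde L, the factors
   partial_i staying in place. *)
Definition tildeL_reordering (w w' : seq lbasis) : Prop :=
  perm_eq w w' /\
  [seq (if b is inr i then Some i else None) | b <- w] =
  [seq (if b is inr i then Some i else None) | b <- w'].

End MultiIndex.

(* Main.v *)
From HB Require Import structures.
Require Import Defs.
From mathcomp Require Import all_boot all_order all_algebra reals monalg.
From mathcomp Require Import finmap generic_quotient boolp classical_sets fsbigop.

Set Implicit Arguments.
Unset Strict Implicit.
Unset Printing Implicit Defensive.

Import Order.TTheory GRing.Theory Num.Theory.
Local Open Scope ring_scope.

(** Write x |> y for the post-Lie product of L. For every post-Lie algebra the
    bracket [x, y] = [x, y]_0 + x |> y - y |> x is a Lie bracket, and L with this
    bracket acts on U(L_0) by x . A = x A + x |> A, where x |> is extended to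
    U(L_0) as a derivation: the two post-Lie identities say exactly that x |> is
    a derivation and that this is a representation ([rho_rep]). The orbit map
    of 1 is a map Psi : U(L) -> U(L_0) with Psi (x u) = x . Psi u. It is
    compatible with the coproducts, and it sends a product of n elements of L to
    the same product in U(L_0) up to products of fewer than n elements
    ([Psi_leading]); so it is onto.

    An extension T of |> to U(L_0) satisfies the recursion
    T (x A) B = x |> T A B - T (x |> A) B for all B ([ext_TM]), and with it
    Psi u * B = u . B for the star product ([star_Psi]). Hence Psi turns the
    product of U(L) into the star product. Conversely, if Psi has an inverse
    Theta, then T A B = Theta A |> B defines an extension, where U(L) acts by the
    derivations x |> ([guin_oudom_mulr]). The Hopf algebra U(L) is then carried
    over to U(L_0) by Psi ([hopf_transport]), and the isomorphism of the theorem
    is Theta.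

    Injectivity of Psi and the bases come from the same construction, used once
    more: the bracket of L_0 is the commutator of a pre-Lie product ([tri0]),
    that is, of a post-Lie product for the zero bracket, so U(L_0) also maps to
    the symmetric algebra of L with the expected leading terms. This map makes
    sorted products in U(L_0) linearly independent, and straightening shows that
    they span ([kword_basis]); composed with Psi it gives the injectivity of Psi
    ([leading_inj]).

    It remains to check the post-Lie identities for L. They reduce to
    commutators of the derivations D^(n) and partial_i, which only have to be
    computed on the variables ([derD_comm], [derD_derpart], [derpart_comm]). *)

(** * Linear maps *)

Section Linear.
Variable R : comNzRingType.
Implicit Types U V W X Y : lmodType R.

Lemma lin0 V W (f : V -> W) : linear f -> f 0 = 0.
Proof.
by move=> hf; have := hf (-1) 0 0; rewrite scaler0 addr0 scaleN1r addNr.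
Qed.

Lemma linD V W (f : V -> W) : linear f -> {morph f : u v / u + v}.
Proof. by move=> hf u v; have := hf 1 u v; rewrite !scale1r. Qed.

Lemma linZ V W (f : V -> W) a : linear f -> {morph f : u / a *: u}.
Proof. by move=> hf u; rewrite -[a *: u]addr0 hf lin0 // addr0. Qed.

Lemma linN V W (f : V -> W) : linear f -> {morph f : u / - u}.
Proof. by move=> hf u; rewrite -scaleN1r linZ // scaleN1r. Qed.

Lemma linB V W (f : V -> W) : linear f -> {morph f : u v / u - v}.
Proof. by move=> hf u v; rewrite linD // linN. Qed.

Lemma lin_sum V W (f : V -> W) (I : Type) (r : seq I) (P : pred I) (F : I -> V) :
  linear f -> f (\sum_(i <- r | P i) F i) = \sum_(i <- r | P i) f (F i).
Proof. by move=> hf; apply: (big_morph f (linD hf) (lin0 hf)). Qed.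

Lemma lin_id V : linear (@idfun V).
Proof. by []. Qed.

Lemma lin_comp U V W (g : V -> W) (f : U -> V) :
  linear g -> linear f -> linear (fun x => g (f x)).
Proof. by move=> hg hf a u v; rewrite hf hg. Qed.

Lemma lin_add V W (f g : V -> W) :
  linear f -> linear g -> linear (fun x => f x + g x).
Proof. by move=> hf hg a u v; rewrite hf hg scalerDr addrACA. Qed.

Lemma lin_opp V W (f : V -> W) : linear f -> linear (fun x => - f x).
Proof. by move=> hf a u v; rewrite hf opprD scalerN. Qed.

Lemma lin_sub V W (f g : V -> W) :
  linear f -> linear g -> linear (fun x => f x - g x).
Proof. by move=> hf hg; apply: lin_add => //; apply: lin_opp. Qed.

Lemma lin_scale V W (f : V -> W) c : linear f -> linear (fun x => c *: f x).
Proof. by move=> hf a u v; rewrite hf scalerDr !scalerA mulrC. Qed.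

Lemma lin_scalel V W (f : V -> R^o) w : linear f -> linear (fun x => f x *: w : W).
Proof. by move=> hf a u v; rewrite hf scalerDl scalerA. Qed.

Lemma lin_mulr (A : algType R) V (f : V -> A) c :
  linear f -> linear (fun x => f x * c).
Proof. by move=> hf a u v; rewrite hf mulrDl scalerAl. Qed.

Lemma lin_mull (A : algType R) V (f : V -> A) c :
  linear f -> linear (fun x => c * f x).
Proof. by move=> hf a u v; rewrite hf mulrDr -scalerAr. Qed.

Lemma bilinl U V W (f : U -> V -> W) v : is_bilinear f -> linear (f^~ v).
Proof. by case. Qed.

Lemma bilinr U V W (f : U -> V -> W) u : is_bilinear f -> linear (f u).
Proof. by case. Qed.

Lemma bilin_mul (A : algType R) : is_bilinear (@GRing.mul A).
Proof. by split=> u; [apply: lin_mull|apply: lin_mulr]. Qed.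

Lemma bilin_comp U V W X Y (f : V -> W -> X) (g : U -> V) (h : Y -> W) :
  is_bilinear f -> linear g -> linear h -> is_bilinear (fun x y => f (g x) (h y)).
Proof.
move=> hf hg hh; split=> u a x y /=.
  by rewrite hh (bilinr _ hf).
by rewrite hg (bilinl _ hf).
Qed.

Lemma bilin_lin U V W X (f : U -> V -> W) (g : W -> X) :
  is_bilinear f -> linear g -> is_bilinear (fun x y => g (f x y)).
Proof.
move=> hf hg; split=> u a x y /=.
  by rewrite (bilinr _ hf) hg.
by rewrite (bilinl _ hf) hg.
Qed.

Lemma bilin_add U V W (f g : U -> V -> W) :
  is_bilinear f -> is_bilinear g -> is_bilinear (fun x y => f x y + g x y).
Proof.
move=> hf hg; split=> u; apply: lin_add;
  by [apply: bilinr hf|apply: bilinr hg|apply: bilinl hf|apply: bilinl hg].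
Qed.

Lemma bilin_opp U V W (f : U -> V -> W) :
  is_bilinear f -> is_bilinear (fun x y => - f x y).
Proof. by move=> hf; split=> u; apply: lin_opp; [apply: bilinr hf|apply: bilinl hf]. Qed.

Lemma bilin_flip U V W (f : U -> V -> W) :
  is_bilinear f -> is_bilinear (fun x y => f y x).
Proof. by case. Qed.

Lemma malgUZ (K : choiceType) a (k : K) : << a *g k >> = a *: << k >> :> {malg R[K]}.
Proof. by apply/malgP => m; rewrite mcoeffZ !mcoeffU mulrnAr mulr1. Qed.

Lemma malg_ind (K : choiceType) (P : {malg R[K]} -> Prop) :
  P 0 -> (forall a k p, P p -> P (a *: << k >> + p)) -> forall p, P p.
Proof.
move=> P0 Pi p; rewrite [p]monalgE.
elim: (enum_fset _) => [|k r ih]; rewrite ?big_nil ?big_cons //.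
by rewrite malgUZ; apply: Pi.
Qed.

Lemma linextEw (K : choiceType) W (f : K -> W) (d : {fset K}) p :
  (msupp p `<=` d)%fset -> linext f p = \sum_(k <- d) p@_k *: f k.
Proof.
move=> hd; apply: (big_fset_incl _ hd) => k _ /mcoeff_outdom ->.
by rewrite scale0r.
Qed.

Lemma linext_linear (K : choiceType) W (f : K -> W) : linear (linext f).
Proof.
move=> a p q; pose d := (msupp p `|` msupp q)%fset.
have hp : (msupp p `<=` d)%fset by apply: fsubsetUl.
have hq : (msupp q `<=` d)%fset by apply: fsubsetUr.
rewrite (linextEw f hp) (linextEw f hq) (@linextEw _ _ f d).
  rewrite scaler_sumr -big_split /=; apply: eq_bigr => k _.
  by rewrite mcoeffD mcoeffZ scalerDl scalerA.
apply: (fsubset_trans (msuppD_le _ _)); apply: fsetSU; exact: msuppZ_le.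
Qed.

Lemma linextU (K : choiceType) W (f : K -> W) k : linext f << k >> = f k.
Proof.
rewrite (@linextEw _ _ f [fset k]%fset) ?msuppU_le //.
by rewrite big_seq_fset1 mcoeffU eqxx scale1r.
Qed.

Lemma malg_lin_ext (K : choiceType) W (f g : {malg R[K]} -> W) :
  linear f -> linear g -> (forall k, f << k >> = g << k >>) -> f =1 g.
Proof.
move=> hf hg e; elim/malg_ind => [|a k p ih]; first by rewrite !lin0.
by rewrite hf hg e ih.
Qed.

Lemma bilinext_bilinear (K K' : choiceType) W (f : K -> K' -> W) :
  is_bilinear (bilinext f).
Proof.
split=> [p a q q'|q a p p'] /=; rewrite /bilinext; last exact: linext_linear.
rewrite /linext scaler_sumr -big_split; apply: eq_bigr => k _ /=.
by rewrite -/(linext _ _) linext_linear scalerDr !scalerA mulrC.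
Qed.

Lemma bilinextU (K K' : choiceType) W (f : K -> K' -> W) k k' :
  bilinext f << k >> << k' >> = f k k'.
Proof. by rewrite /bilinext !linextU. Qed.

Lemma malg_bilin_ext (K K' : choiceType) W (f g : {malg R[K]} -> {malg R[K']} -> W) :
  is_bilinear f -> is_bilinear g ->
  (forall k k', f << k >> << k' >> = g << k >> << k' >>) -> f =2 g.
Proof.
move=> hf hg e p q.
apply: (malg_lin_ext (bilinl q hf) (bilinl q hg)) => k.
by apply: (malg_lin_ext (bilinr _ hf) (bilinr _ hg)).
Qed.

Lemma submod_gen_mono V (S S' : V -> Prop) v :
  (forall u, S u -> S' u) -> submod_gen S v -> submod_gen S' v.
Proof.
move=> h; elim=> [u /h|| a u w _ hu _ hw]; first exact: SubmodGen.
  exact: Submod0.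
exact: SubmodLin.
Qed.

Lemma submod_genD V (S : V -> Prop) u v :
  submod_gen S u -> submod_gen S v -> submod_gen S (u + v).
Proof. by move=> hu hv; rewrite -[u]scale1r; apply: SubmodLin. Qed.

Lemma submod_genZ V (S : V -> Prop) a u : submod_gen S u -> submod_gen S (a *: u).
Proof. by move=> hu; rewrite -[_ *: u]addr0; apply: SubmodLin hu (Submod0 _). Qed.

Lemma submod_genN V (S : V -> Prop) u : submod_gen S u -> submod_gen S (- u).
Proof. by rewrite -scaleN1r; apply: submod_genZ. Qed.

Lemma submod_gen_lin V W (S : V -> Prop) (S' : W -> Prop) (f : V -> W) v :
  linear f -> (forall u, S u -> submod_gen S' (f u)) ->
  submod_gen S v -> submod_gen S' (f v).
Proof.
move=> hf h; elim=> [u /h||a u w _ hu _ hw] //; first by rewrite lin0 //; apply: Submod0.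
by rewrite hf; apply: SubmodLin.
Qed.

Lemma submod_gen_ker V W (S : V -> Prop) (f : V -> W) v :
  linear f -> (forall u, S u -> f u = 0) -> submod_gen S v -> f v = 0.
Proof.
move=> hf h; elim=> [u /h||a u w _ hu _ hw] //; first by rewrite lin0.
by rewrite hf hu hw scaler0 addr0.
Qed.

End Linear.

(** * Tensor products *)

Section TensorTheory.
Variable R : comNzRingType.
Implicit Types U V W X Y : lmodType R.

Lemma quomod_pi_linear V (S : V -> Prop) : linear (\pi_(quomod S)%qT : V -> quomod S).
Proof.
by move=> a u v; rewrite quomod_piD; congr (_ + _); symmetry; apply: quomod_piZ.
Qed.

Lemma bilin_tens V W : is_bilinear (@tens R V W).
Proof.
pose pi (p : {malg R[(V * W)%type]}) : tensor V W :=
  \pi_(quomod (@tens_rel R V W))%qT p.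
have pi_lin : linear pi by exact: quomod_pi_linear.
have key u v w a : tens_rel (u - a *: v - w) -> pi u = a *: pi v + pi w.
  move=> r; rewrite -pi_lin; apply/quomodP; rewrite opprD addrA.
  exact: SubmodGen.
by split=> [v|w] a x y; [exact: key (TensRelR _ _ _ _)|exact: key (TensRelL _ _ _ _)].
Qed.

(** A bilinear map kills the relations of the tensor product, so [tens_ext] does
    not depend on the chosen representative. *)
Lemma tens_rel_ker V W X (f : V -> W -> X) p :
  is_bilinear f -> submod_gen (@tens_rel R V W) p ->
  linext (fun q : V * W => f q.1 q.2) p = 0.
Proof.
move=> hf; have hF := linext_linear (fun q : V * W => f q.1 q.2).
apply: submod_gen_ker => // _ [a v v' w|a v w w'];
rewrite (linB hF) (linB hF) (linZ _ hF) !linextU /=.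
- by rewrite (bilinl _ hf) addrAC addrK subrr.
- by rewrite (bilinr _ hf) addrAC addrK subrr.
Qed.

Lemma tens_ext_linear V W X (f : V -> W -> X) :
  is_bilinear f -> linear (tens_ext f).
Proof.
move=> hf; have hF := linext_linear (fun q : V * W => f q.1 q.2).
move=> a s t; rewrite /tens_ext -hF; apply/eqP; rewrite -subr_eq0 -(linB hF).
apply/eqP/tens_rel_ker => //; apply/quomodP.
by rewrite quomod_pi_linear !quomod_reprK.
Qed.

Lemma tens_extE V W X (f : V -> W -> X) v w :
  is_bilinear f -> tens_ext f (v \otimes w) = f v w.
Proof.
move=> hf; pose F := linext (fun q : V * W => f q.1 q.2).
have hF : linear F by apply: linext_linear.
have -> : f v w = F << (v, w) >> by rewrite /F linextU.
apply/eqP; rewrite /tens_ext -/F -subr_eq0 -(linB hF).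
apply/eqP/tens_rel_ker => //; apply/quomodP.
by rewrite quomod_reprK.
Qed.

Lemma tens_ind V W (P : tensor V W -> Prop) :
  P 0 -> (forall v w t, P t -> P (v \otimes w + t)) -> forall t, P t.
Proof.
move=> P0 Pi t; rewrite -[t]quomod_reprK.
elim/malg_ind: (repr _) => [|a [v w] p ih].
  by rewrite (lin0 (@quomod_pi_linear _ _)).
rewrite quomod_pi_linear -[_ *: _](linZ _ (bilinl w (bilin_tens V W))).
exact: Pi.
Qed.

(** Identities between linear maps on a tensor product are proved on pure
    tensors; most of the equations on coproducts below go through this lemma. *)
Lemma tens_lin_ext V W X (f g : tensor V W -> X) :
  linear f -> linear g -> (forall v w, f (v \otimes w) = g (v \otimes w)) ->
  f =1 g.
Proof.
move=> hf hg e; elim/tens_ind => [|v w t ih]; first by rewrite !lin0.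
by rewrite !linD // e ih.
Qed.

Lemma tens_ext_comp V W X Y (f : V -> W -> X) (g : X -> Y) t :
  is_bilinear f -> linear g ->
  g (tens_ext f t) = tens_ext (fun v w => g (f v w)) t.
Proof.
move=> hf hg; have hgf := bilin_lin hf hg; move: t.
apply: tens_lin_ext => [||v w]; last by rewrite !tens_extE.
  exact: lin_comp (tens_ext_linear hf).
exact: tens_ext_linear.
Qed.

Definition tens_map V W V' W' (f : V -> V') (g : W -> W') : tensor V W -> tensor V' W' :=
  tens_ext (fun a b => f a \otimes g b).

Section TensMap.
Variables (V W V' W' : lmodType R) (f : V -> V') (g : W -> W').
Hypotheses (hf : linear f) (hg : linear g).

Let hfg : is_bilinear (fun a b => f a \otimes g b).
Proof. exact: bilin_comp (bilin_tens _ _) hf hg. Qed.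

Lemma tens_map_linear : linear (tens_map f g).
Proof. exact: tens_ext_linear. Qed.

Lemma tens_mapE v w : tens_map f g (v \otimes w) = f v \otimes g w.
Proof. exact: tens_extE. Qed.

Lemma tens_ext_map X (h : V' -> W' -> X) t : is_bilinear h ->
  tens_ext h (tens_map f g t) = tens_ext (fun a b => h (f a) (g b)) t.
Proof.
move=> hh; rewrite tens_ext_comp //; last exact: tens_ext_linear.
by congr (tens_ext _ t); apply/funext => a; apply/funext => b; rewrite tens_extE.
Qed.
End TensMap.

Section TensMul.
Variables (H : lmodType R) (mul : H -> H -> H).
Hypothesis hmul : is_bilinear mul.

Let lmul a b : tensor H H -> tensor H H :=
  tens_ext (fun c d => mul a c \otimes mul b d).

Let inner a b : is_bilinear (fun c d => mul a c \otimes mul b d).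
Proof. exact: bilin_comp (bilin_tens _ _) (bilinr _ hmul) (bilinr _ hmul). Qed.

Let lmul_lin a b : linear (lmul a b).
Proof. exact: tens_ext_linear (inner a b). Qed.

Let lmulE a b c d : lmul a b (c \otimes d) = mul a c \otimes mul b d.
Proof. exact: tens_extE (inner a b). Qed.

Let outer t : is_bilinear (fun a b => lmul a b t).
Proof.
split=> [a|b] k x y; move: t.
  apply: (tens_lin_ext (lmul_lin _ _)
    (lin_add (lin_scale k (lmul_lin a x)) (lmul_lin a y))).
  by move=> c d; rewrite !lmulE (bilinl _ hmul) (bilinr _ (bilin_tens _ _)).
apply: (tens_lin_ext (lmul_lin _ _)
  (lin_add (lin_scale k (lmul_lin x b)) (lmul_lin y b))).
by move=> c d; rewrite !lmulE (bilinl _ hmul) (bilinl _ (bilin_tens _ _)).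
Qed.

Lemma tens_mulE a b c d :
  tens_mul mul (a \otimes b) (c \otimes d) = mul a c \otimes mul b d.
Proof. by rewrite -lmulE; exact: (tens_extE _ _ (outer _)). Qed.

Lemma bilin_tens_mul : is_bilinear (tens_mul mul).
Proof.
have tl t : linear (fun s => tens_mul mul s t) by exact: tens_ext_linear (outer t).
split; last exact: tl.
move=> s k x y; move: s.
apply: (tens_lin_ext (tl _) (lin_add (lin_scale k (tl x)) (tl y))) => a b.
have e t : tens_mul mul (a \otimes b) t = lmul a b t.
  exact: (tens_extE _ _ (outer _)).
by rewrite !e lmul_lin.
Qed.

Lemma tens_mulA : associative mul -> associative (tens_mul mul).
Proof.
move=> mulA r s t; have h := bilin_tens_mul; move: r.
apply: tens_lin_ext => [||a b].
- exact: (bilinl _ h).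
- by apply: (@lin_comp _ _ _ _ (fun x => tens_mul mul x t)) => //; apply: bilinl h.
move: s; apply: tens_lin_ext => [||c d].
- by apply: (lin_comp (bilinr _ h)); apply: bilinl h.
- apply: (@lin_comp _ _ _ _ (fun x => tens_mul mul x t)).
    exact: bilinl h.
  exact: bilinr h.
move: t; apply: tens_lin_ext => [||e f].
- by apply: (lin_comp (bilinr _ h)); apply: bilinr h.
- exact: bilinr h.
by rewrite !tens_mulE !mulA.
Qed.

Lemma tens_mul1 (one : H) : left_id one mul -> left_id (one \otimes one) (tens_mul mul).
Proof.
move=> m1; apply: tens_lin_ext => [||a b]; first exact: (bilinr _ bilin_tens_mul).
  exact: lin_id.
by rewrite tens_mulE !m1.
Qed.

End TensMul.
End TensorTheory.

(** * Identities in abelian groups *)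

Inductive zexp := ZVar of nat | ZZero | ZOpp of zexp | ZAdd of zexp & zexp.

Fixpoint zeval (M : zmodType) (env : seq M) (e : zexp) : M :=
  match e with
  | ZVar n => env`_n
  | ZZero => 0
  | ZOpp e => - zeval env e
  | ZAdd e e' => zeval env e + zeval env e'
  end.

Fixpoint zcoef (e : zexp) (n : nat) : int :=
  match e with
  | ZVar m => (m == n)%:R
  | ZZero => 0
  | ZOpp e => - zcoef e n
  | ZAdd e e' => zcoef e n + zcoef e' n
  end.

(** Reification of a sum of atoms: an expression is determined by the integer
    coefficients of its atoms, which [zeval_eq] compares by computation. *)
Lemma zevalE (M : zmodType) (env : seq M) e :
  zeval env e = \sum_(n < size env) env`_n *~ zcoef e n.
Proof.
elim: e => [m||e ih|e ih e' ih'] /=.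
- have [hm|hm] := ltnP m (size env); last first.
    rewrite nth_default // big1 // => n _; case: eqP => [mn|_]; last exact: mulr0z.
    by move: (ltn_ord n); rewrite -mn ltnNge hm.
  rewrite (bigD1 (Ordinal hm)) //= eqxx mulr1z big1 ?addr0 // => n.
  by rewrite eq_sym -val_eqE /= => /negPf ->; rewrite mulr0z.
- by rewrite big1 // => n _; rewrite mulr0z.
- by rewrite ih -sumrN; apply: eq_bigr => n _; rewrite mulrNz.
- by rewrite ih ih' -big_split; apply: eq_bigr => n _; rewrite mulrzDr.
Qed.

Lemma zeval_eq (M : zmodType) (env : seq M) e e' :
  all (fun n => zcoef e n == zcoef e' n) (iota 0 (size env)) ->
  zeval env e = zeval env e'.
Proof.
move=> /allP h; rewrite !zevalE; apply: eq_bigr => n _; congr (_ *~ _).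
by apply/eqP/h; rewrite mem_iota /=.
Qed.

(* Atoms are compared up to conversion, as one operation may be reached through
   several inheritance paths. *)
Ltac zindex x l :=
  match l with
  | ?y :: _ => let _ := match goal with _ => unify x y end in constr:(O)
  | _ :: ?l' => let n := zindex x l' in constr:(S n)
  end.

Ltac zatoms x l :=
  lazymatch x with
  | ?a + ?b => let l := zatoms a l in zatoms b l
  | - ?a => zatoms a l
  | 0 => l
  | _ => match l with
         | _ => let n := zindex x l in l
         | _ => constr:(x :: l)
         end
  end.

Ltac zreify x l :=
  lazymatch x with
  | ?a + ?b => let a := zreify a l in let b := zreify b l in constr:(ZAdd a b)
  | - ?a => let a := zreify a l in constr:(ZOpp a)
  | 0 => constr:(ZZero)
  | _ => let n := zindex x l in constr:(ZVar n)
  end.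

(** Proves an equation that holds in every abelian group. *)
Ltac abel :=
  lazymatch goal with
  | |- @eq ?T ?x ?y =>
    let l := zatoms x (@nil T) in let l := zatoms y l in
    let e := zreify x l in let e' := zreify y l in
    exact: (@zeval_eq _ l e e' isT)
  end.

(** * Enveloping algebras *)

Lemma ideal_gen_in (R : comNzRingType) (A : algType R) (S : A -> Prop) r :
  S r -> ideal_gen S r.
Proof. by move=> Sr; have := IdealGen 1 1 Sr; rewrite mul1r mulr1. Qed.

Section EnvelopingTheory.
Variables (R : comNzRingType) (V : lmodType R) (br : V -> V -> V).
Local Notation U := (uenv br).
Local Notation i := (uenv_in br).
Local Notation pi := (quoalg_pi (@uenv_proper R V br)).
Implicit Types (x y : V) (u v : U).

Lemma uenv_pi_linear : linear pi.
Proof. by move=> a p q; rewrite quoalg_piD quoalg_piZ. Qed.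

Lemma uenv_in_linear : linear i.
Proof.
move=> a x y; rewrite -uenv_pi_linear; apply/quoalg_piP.
rewrite opprD addrA; apply: SubmodGen.
exact: ideal_gen_in (UenvLin _ _ _ _).
Qed.

Lemma uenv_in_br x y : i x * i y - i y * i x = i (br x y).
Proof.
rewrite -!quoalg_piM -(linB uenv_pi_linear); apply/quoalg_piP.
apply: SubmodGen.
exact: ideal_gen_in (UenvBr _ _ _).
Qed.

Definition word (w : seq V) : U := \prod_(x <- w) i x.

Lemma word_nil : word [::] = 1. Proof. exact: big_nil. Qed.

Lemma word_cons x w : word (x :: w) = i x * word w.
Proof. exact: big_cons. Qed.

Lemma uenv_pi_monom (w : {fmonom V}) : pi << w >> = word w.
Proof.
have h s : pi << FMonom s >> = word s.
  elim: s => [|x s ih]; first by rewrite word_nil -fmoneE.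
  rewrite word_cons -ih -quoalg_piM; congr (pi _).
  rewrite /fgen malgM_def fgmulUU mulr1; congr (<< _ >>).
  by rewrite -[RHS]/(fmmul _ _) fmmulE fmuE.
by rewrite -{1}[w]fmK h.
Qed.

Lemma uenv_word_ind (P : U -> Prop) :
  P 0 -> (forall a w u, P u -> P (a *: word w + u)) -> forall u, P u.
Proof.
move=> P0 Pl u; rewrite -[u]quoalg_reprK.
elim/malg_ind: (quoalg_repr u) => [|a w p ih].
  by rewrite (lin0 uenv_pi_linear).
by rewrite uenv_pi_linear uenv_pi_monom; apply: Pl.
Qed.

Lemma uenv_ind (P : U -> Prop) :
  P 1 -> (forall a u v, P u -> P v -> P (a *: u + v)) ->
  (forall x u, P u -> P (i x * u)) -> forall u, P u.
Proof.
move=> P1 Pl Pm; have P0 : P 0 by rewrite -(addNr 1) -scaleN1r; apply: Pl.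
apply: uenv_word_ind => // a w u Pu; apply: Pl => //.
by elim: w => [|x w ih]; rewrite ?word_nil // word_cons; apply: Pm.
Qed.

(** The universal property, for representations: an action of the generators on
    [X] that respects the bracket extends to the free algebra by composition,
    and the extension vanishes on the ideal of relations. *)
Section Rep.
Variables (X : lmodType R) (rho : V -> X -> X).
Hypothesis rho_bilin : is_bilinear rho.
Hypothesis rho_rep : forall x y m, rho x (rho y m) - rho y (rho x m) = rho (br x y) m.

Local Notation F m := (linext (fun w : {fmonom V} => foldr rho m w)).

Let F_lin m : linear (F m).
Proof. exact: linext_linear. Qed.

Let foldr_lin w : linear (fun m => foldr rho m w).
Proof.
elim: w => [|x w ih] //= a m n; by rewrite ih (bilinr _ rho_bilin).
Qed.

Let FlinM p : linear (fun m => F m p).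
Proof.
move=> a m n; rewrite /linext scaler_sumr -big_split; apply: eq_bigr => w _ /=.
by rewrite foldr_lin scalerDr !scalerA mulrC.
Qed.

(* composition of actions; with this the relations can be checked one by one *)
Let FM m (p q : free_alg R V) : F m (p * q) = F (F m q) p.
Proof.
move: p; apply: malg_lin_ext => [||w].
- exact: (@lin_comp R (free_alg R V) (free_alg R V) X (F m) (fun p => p * q) (F_lin m)
    (lin_mulr _ (@lin_id _ _))).
- exact: F_lin.
move: q; apply: malg_lin_ext => [||w'].
- exact: (@lin_comp R (free_alg R V) (free_alg R V) X (F m) (fun p => << w >> * p)
    (F_lin m)
    (lin_mull _ (@lin_id _ _))).
- by apply: (@lin_comp _ _ _ _ (fun n => F n << w >>)) => //; apply: FlinM.
by rewrite malgM_def fgmulUU mulr1 !linextU fmM foldr_cat.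
Qed.

Let F_gen m x : F m (fgen R x) = rho x m.
Proof. by rewrite linextU fmU. Qed.

Let F_ideal m p : submod_gen (ideal_gen (uenv_rel br)) p -> F m p = 0.
Proof.
apply: submod_gen_ker => // _ [p' r q rel]; rewrite !FM.
suff -> : F (F m q) r = 0 by apply: (lin0 (FlinM _)).
move: (F m q) => n; have hn := F_lin n.
case: r / rel => [a x y|x y].
  rewrite (linB hn (fgen R _ - a *: fgen R x)) (linB hn (fgen R _)) (linZ a hn).
  transitivity (rho (a *: x + y) n - a *: rho x n - rho y n).
    by congr (_ - _ *: _ - _); exact: F_gen.
  by rewrite (bilinl _ rho_bilin) addrAC addrK subrr.
rewrite (linB hn (fgen R x * fgen R y - fgen R y * fgen R x)) (linB hn (fgen R x * _)).
have e x' y' : F n (fgen R x' * fgen R y') = rho x' (rho y' n).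
  by rewrite (FM n (fgen R x') (fgen R y')) (F_gen n y') (F_gen _ x').
transitivity (rho x (rho y n) - rho y (rho x n) - rho (br x y) n).
  by congr (_ - _ - _); [exact: e|exact: e|exact: F_gen].
by rewrite rho_rep subrr.
Qed.

Definition uact (u : U) (m : X) : X := uenv_ext (foldr rho m) u.

Let uact_pi m p : uact (pi p) m = F m p.
Proof.
apply/eqP; rewrite /uact /uenv_ext -subr_eq0 -(linB (F_lin m)); apply/eqP/F_ideal.
exact/(quoalg_piP (@uenv_proper R V br))/quoalg_reprK.
Qed.

Lemma bilin_uact : is_bilinear uact.
Proof.
split=> [u a m n|m a u v]; rewrite /=.
  by rewrite -[u]quoalg_reprK !uact_pi FlinM.
rewrite -[u]quoalg_reprK -[v]quoalg_reprK -uenv_pi_linear !uact_pi.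
exact: F_lin.
Qed.

Lemma uactM u v m : uact (u * v) m = uact u (uact v m).
Proof. by rewrite -[u]quoalg_reprK -[v]quoalg_reprK -quoalg_piM !uact_pi FM. Qed.

Lemma uact1 m : uact 1 m = m.
Proof.
rewrite -word_nil -(uenv_pi_monom (FMonom [::])) uact_pi linextU //.
Qed.

Lemma uact_in x m : uact (i x) m = rho x m.
Proof. by rewrite uact_pi F_gen. Qed.

Lemma uact_inM x u m : uact (i x * u) m = rho x (uact u m).
Proof. by rewrite uactM uact_in. Qed.

(* [uact] is the shape in which the coproduct, counit and antipode are defined:
   each of them is the orbit of one vector [m] under an action of V. *)
Lemma uenv_foldr_linear m : linear (uenv_ext (foldr rho m) : U -> X).
Proof. exact: bilinl bilin_uact. Qed.

Lemma uenv_foldr1 m : uenv_ext (foldr rho m) (1 : U) = m.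
Proof. exact: uact1. Qed.

Lemma uenv_foldrM m x u :
  uenv_ext (foldr rho m) (i x * u) = rho x (uenv_ext (foldr rho m) u).
Proof. exact: uact_inM. Qed.

End Rep.
End EnvelopingTheory.


(** * Hopf operations of an enveloping algebra *)

Section Leibniz.
Variables (R : comNzRingType) (H : lmodType R).
Implicit Types (f g : H -> H) (s t : tensor H H).

(** Left multiplication by a primitive element, and a derivation extending a map
    of V, act on the coproduct through this operator; so equations on
    coproducts reduce to equations between the [f]'s. *)
Definition leib f t : tensor H H := tens_ext (fun a b => f a \otimes b + a \otimes f b) t.

Lemma bilin_leib f : linear f ->
  is_bilinear (fun a b : H => f a \otimes b + a \otimes f b).
Proof.
move=> hf; apply: bilin_add.
  exact: bilin_comp (bilin_tens H H) hf (@lin_id _ _).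
exact: bilin_comp (bilin_tens H H) (@lin_id _ _) hf.
Qed.

Lemma leib_linear f : linear f -> linear (leib f).
Proof. by move=> hf; apply: tens_ext_linear; apply: bilin_leib. Qed.

Lemma leibE f a b : linear f -> leib f (a \otimes b) = f a \otimes b + a \otimes f b.
Proof. by move=> hf; apply: tens_extE; apply: bilin_leib. Qed.

Lemma bilin_leib_fam (V : lmodType R) (rho : V -> H -> H) :
  is_bilinear rho -> is_bilinear (fun x t => leib (rho x) t).
Proof.
move=> hr; have hl x := bilinr x hr; split=> [x|t]; first exact: leib_linear.
move=> k x y; move: t; apply: tens_lin_ext.
- exact: leib_linear.
- by apply: lin_add; [apply: lin_scale|]; apply: leib_linear.
move=> a b; rewrite !leibE // !(bilinl _ hr).
rewrite (bilinl _ (bilin_tens H H)) (bilinr _ (bilin_tens H H)).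
by rewrite scalerDr addrACA.
Qed.

Lemma leib_add f g t : linear f -> linear g ->
  leib (fun a => f a + g a) t = leib f t + leib g t.
Proof.
move=> hf hg; have hfg := lin_add hf hg; move: t; apply: tens_lin_ext.
- exact: leib_linear.
- by apply: lin_add; apply: leib_linear.
move=> a b; rewrite !leibE // (linD (bilinl _ (bilin_tens H H))).
by rewrite (linD (bilinr _ (bilin_tens H H))) addrACA.
Qed.

Lemma leib_comm f g h t : linear f -> linear g -> linear h ->
  (forall a, f (g a) - g (f a) = h a) ->
  leib f (leib g t) - leib g (leib f t) = leib h t.
Proof.
move=> hf hg hh e; have lf := leib_linear hf; have lg := leib_linear hg.
move: t; apply: tens_lin_ext => [||a b].
- by apply: lin_sub; [exact: lin_comp lf lg|exact: lin_comp lg lf].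
- exact: leib_linear.
rewrite !leibE // (linD lf) (linD lg) !leibE // -!e.
rewrite (linB (bilinl _ (bilin_tens H H))) (linB (bilinr _ (bilin_tens H H))).
move: (f (g a) \otimes b) (g (f a) \otimes b) (a \otimes f (g b)) (a \otimes g (f b)).
by move: (g a \otimes f b) (f a \otimes g b) => *; abel.
Qed.

End Leibniz.

Section Associator.
Variables (R : comNzRingType) (H : lmodType R).

Definition tens_assoc (t : tensor H H) (b : H) : tensor H (tensor H H) :=
  tens_ext (fun a1 a2 => a1 \otimes (a2 \otimes b)) t.

Let assoc_in b : @is_bilinear R H H (tensor H (tensor H H))
  (fun a1 a2 => a1 \otimes (a2 \otimes b)).
Proof.
exact: (bilin_comp (bilin_tens H (tensor H H)) (@lin_id _ H) (bilinl b (bilin_tens H H))).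
Qed.

Lemma tens_assocE a1 a2 b : tens_assoc (a1 \otimes a2) b = a1 \otimes (a2 \otimes b).
Proof. exact: tens_extE (assoc_in b). Qed.

Lemma bilin_tens_assoc : is_bilinear tens_assoc.
Proof.
have al c : linear (tens_assoc^~ c) := tens_ext_linear (assoc_in c).
split; last exact: al.
move=> t k b c; move: t.
apply: (tens_lin_ext (al _) (lin_add (lin_scale k (al b)) (al c))).
move=> a1 a2; rewrite /= !tens_assocE.
by rewrite (bilinr a2 (bilin_tens _ _)) (bilinr a1 (bilin_tens _ _)).
Qed.
End Associator.

Lemma tens_mul_prim (R : comNzRingType) (A : algType R) (a : A) (t : tensor A A) :
  tens_mul *%R (a \otimes 1 + 1 \otimes a) t = leib ( *%R a) t.
Proof.
have hm := bilin_tens_mul (bilin_mul A).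
have ha : linear ( *%R a) := bilinr a (bilin_mul A).
move: t; apply: (tens_lin_ext (bilinr _ hm) (leib_linear ha)) => b c.
have e (d f : A) : tens_mul *%R (d \otimes f) (b \otimes c) = (d * b) \otimes (f * c).
  exact: (tens_mulE (bilin_mul A)).
by rewrite (linD (bilinl (b \otimes c) hm)) /= !e leibE // !mul1r.
Qed.

(** An enveloping algebra of [(V, br)] with its Hopf operations, known through
    its universal property ([env_act]) and the recursive equations of the
    operations along the generators. With an abstract algebra [U] the quotient
    construction never unfolds in the proofs. *)
Record envelope (R : comNzRingType) (V : lmodType R) (br : V -> V -> V)
    (U : algType R) (i : V -> U) (Delta : U -> tensor U U) (eps : U -> R)
    (S : U -> U) : Prop := Envelope {
  env_linear : linear i;
  env_br : forall x y, i x * i y - i y * i x = i (br x y);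
  env_ind : forall P : U -> Prop, P 1 ->
    (forall a u v, P u -> P v -> P (a *: u + v)) ->
    (forall x u, P u -> P (i x * u)) -> forall u, P u;
  env_act : forall (X : lmodType R) (rho : V -> X -> X), is_bilinear rho ->
    (forall x y m, rho x (rho y m) - rho y (rho x m) = rho (br x y) m) ->
    exists act : U -> X -> X,
      [/\ is_bilinear act, forall m, act 1 m = m &
          forall x u m, act (i x * u) m = rho x (act u m)];
  env_comul_linear : linear Delta;
  env_comul1 : Delta 1 = 1 \otimes 1;
  env_comulM : forall x u, Delta (i x * u) = leib ( *%R (i x)) (Delta u);
  env_counit_linear : scalar eps;
  env_counit1 : eps 1 = 1;
  env_counitM : forall x u, eps (i x * u) = 0;
  env_antipode_linear : linear S;
  env_antipode1 : S 1 = 1;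
  env_antipodeM : forall x u, S (i x * u) = - (S u * i x)
}.


Section Envelope.
Variables (R : comNzRingType) (V : lmodType R) (br : V -> V -> V).

Section Target.
Variables (A : algType R) (j : V -> A).
Hypothesis j_lin : linear j.
Hypothesis j_br : forall x y, j x * j y - j y * j x = j (br x y).

Lemma lin_mulj (a : A) : linear ( *%R a).
Proof. exact: bilinr (bilin_mul A). Qed.

Lemma bilin_mulj : is_bilinear (fun x u => j x * u).
Proof. exact: (bilin_comp (bilin_mul A) j_lin (@lin_id _ _)). Qed.

Lemma mulj_rep x y u : j x * (j y * u) - j y * (j x * u) = j (br x y) * u.
Proof. by rewrite !mulrA -mulrBl j_br. Qed.

(* [A] is kept abstract here for the same reason; it becomes U(V) in
   [uenv_envelope]. *)
Lemma comul_rec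
    (D := uenv_ext (foldr (fun x => tens_mul *%R (j x \otimes 1 + 1 \otimes j x))
                          (1 \otimes 1)) : uenv br -> tensor A A) :
  [/\ linear D, D 1 = 1 \otimes 1 &
      forall x u, D (uenv_in br x * u) = leib ( *%R (j x)) (D u)].
Proof.
have e : (fun x => tens_mul *%R (j x \otimes 1 + 1 \otimes j x)) =
         (fun x => leib ( *%R (j x))).
  by apply: funext => x; apply: funext => t; apply: tens_mul_prim.
rewrite /D e.
have hb : is_bilinear (fun x (t : tensor A A) => leib ( *%R (j x)) t).
  exact: bilin_leib_fam bilin_mulj.
have hr x y (t : tensor A A) :
  leib ( *%R (j x)) (leib ( *%R (j y)) t) - leib ( *%R (j y)) (leib ( *%R (j x)) t) =
  leib ( *%R (j (br x y))) t.
  exact: (leib_comm t (lin_mulj _) (lin_mulj _) (lin_mulj _) (mulj_rep x y)).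
split.
- exact: uenv_foldr_linear hb hr _.
- exact: uenv_foldr1 hb hr _.
- by move=> x u; exact: (uenv_foldrM hb hr (1 \otimes 1) x u).
Qed.

Lemma antipode_rec
    (S := uenv_ext (fun w => (- 1) ^+ size w *: \prod_(x <- rev w) j x)
       : uenv br -> A) :
  [/\ linear S, S 1 = 1 & forall x u, S (uenv_in br x * u) = - (S u * j x)].
Proof.
pose anti x u : A := - (u * j x).
have e : (fun w => (- 1) ^+ size w *: \prod_(x <- rev w) j x) = foldr anti 1.
  apply: funext; elim=> [|x w ih] /=; first by rewrite expr0 scale1r big_nil.
  by rewrite -ih /anti rev_cons big_rcons exprS mulN1r scaleNr -scalerAl.
rewrite /S e.
have hb : is_bilinear anti.
  apply/bilin_opp/(bilin_flip (f := fun u x => u * j x)).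
  exact: (bilin_comp (bilin_mul A) (@lin_id _ _) j_lin).
have hr x y u : anti x (anti y u) - anti y (anti x u) = anti (br x y) u.
  by rewrite /anti !mulNr !opprK -j_br mulrBr opprB !mulrA.
split.
- exact: uenv_foldr_linear hb hr _.
- exact: uenv_foldr1 hb hr _.
- by move=> x u; exact: (uenv_foldrM hb hr 1 x u).
Qed.
End Target.

Lemma counit_rec
    (e := uenv_ext (fun w => (nilp w)%:R : R^o) : uenv br -> R^o) :
  [/\ linear e, e 1 = 1 & forall x u, e (uenv_in br x * u) = 0].
Proof.
have E : (fun w : seq V => (nilp w)%:R : R^o) = foldr (fun _ _ => 0) (1 : R^o).
  by apply: funext => -[|x w].
rewrite /e E.
have hb : is_bilinear (fun (_ : V) (_ : R^o) => 0 : R^o).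
  by split=> x a y z; rewrite scaler0 addr0.
have hr (x y : V) (m : R^o) : (0 : R^o) - 0 = 0 by exact: subrr.
split.
- exact: uenv_foldr_linear hb hr _.
- exact: uenv_foldr1 hb hr _.
- by move=> x u; exact: (uenv_foldrM hb hr 1 x u).
Qed.

Lemma uenv_envelope :
  @envelope R V br (uenv br) (uenv_in br) (uenv_comul (br := br))
    (uenv_counit (br := br)) (uenv_antipode (br := br)).
Proof.
have [Dl D1 DM] := comul_rec (@uenv_in_linear R V br) (@uenv_in_br R V br).
have [Sl S1 SM] := antipode_rec (@uenv_in_linear R V br) (@uenv_in_br R V br).
have [el e1 eM] := counit_rec.
split.
- exact: uenv_in_linear.
- exact: uenv_in_br.
- exact: uenv_ind.
- move=> X rho hb hr; exists (uact rho); split.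
  + exact: bilin_uact hb hr.
  + exact: uact1 hb hr.
  + exact: uact_inM hb hr.
- exact: Dl.
- exact: D1.
- exact: DM.
- exact: el.
- exact: e1.
- exact: eM.
- exact: Sl.
- exact: S1.
- exact: SM.
Qed.
End Envelope.

(** * The Hopf algebra axioms *)


Section EnvelopeHopf.
Variables (R : comNzRingType) (V : lmodType R) (br : V -> V -> V).
Variables (U : algType R) (i : V -> U) (Delta : U -> tensor U U) (eps : U -> R).
Variable (S : U -> U).
Hypothesis E : envelope br i Delta eps S.
Implicit Types (x y : V) (u v : U) (t : tensor U U).

Lemma env_lin_ext (X : lmodType R) (f g : U -> X) :
  linear f -> linear g -> f 1 = g 1 ->
  (forall x u, f u = g u -> f (i x * u) = g (i x * u)) -> f =1 g.
Proof.
move=> hf hg e1 em; apply: (env_ind E) => // a u v eu ev.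
by rewrite hf hg eu ev.
Qed.

Local Notation leibi x := (leib ( *%R (i x))).

Let mulE : is_bilinear (@GRing.mul U) := bilin_mul U.
Let tmE : is_bilinear (tens_mul (@GRing.mul U)) := bilin_tens_mul mulE.
Let Dlin : linear Delta := env_comul_linear E.
Let llin x : linear (leibi x) := leib_linear (lin_mulj (i x)).

Lemma env_leib_tens_mul x s t :
  tens_mul *%R (leibi x s) t = leibi x (tens_mul *%R s t).
Proof. by rewrite -!tens_mul_prim (tens_mulA mulE) //; exact: mulrA. Qed.

Lemma env_comul_morph u v : Delta (u * v) = tens_mul *%R (Delta u) (Delta v).
Proof.
move: u; apply: env_lin_ext.
- exact: (lin_comp Dlin (bilinl v mulE)).
- exact: (lin_comp (bilinl (Delta v) tmE) Dlin).
- by rewrite mul1r (env_comul1 E) (tens_mul1 mulE) //; exact: mul1r.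
- move=> x u ih.
  rewrite -mulrA !(env_comulM E) ih.
  exact: esym (env_leib_tens_mul x (Delta u) (Delta v)).
Qed.

Lemma env_counit_morph u v : eps (u * v) = eps u * eps v.
Proof.
have el : linear (eps : U -> R^o) := env_counit_linear E.
move: u; apply: (@env_lin_ext R^o).
- exact: (lin_comp el (bilinl v mulE)).
- move=> a x y; rewrite (el a x y) mulrDl; congr (_ + _).
  exact: esym (mulrA _ _ _).
- by rewrite mul1r (env_counit1 E) mul1r.
- by move=> x u _; rewrite -mulrA !(env_counitM E) mul0r.
Qed.

(* the action of x on the third tensor power, which both sides of the
   coassociativity identity intertwine with left multiplication by x *)
Let leib3 x : tensor U (tensor U U) -> tensor U (tensor U U) :=
  tens_ext (fun a t => (i x * a) \otimes t + a \otimes leibi x t).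

Let leib3_in x : @is_bilinear R U (tensor U U) (tensor U (tensor U U))
  (fun a t => (i x * a) \otimes t + a \otimes leibi x t).
Proof.
apply: bilin_add.
  exact: (bilin_comp (bilin_tens _ _) (lin_mulj (i x)) (@lin_id _ _)).
exact: (bilin_comp (bilin_tens _ _) (@lin_id _ _) (llin x)).
Qed.

Let leib3_linear x : linear (leib3 x).
Proof. exact: tens_ext_linear (leib3_in x). Qed.

Let leib3E x a t : leib3 x (a \otimes t) = (i x * a) \otimes t + a \otimes leibi x t.
Proof. exact: tens_extE (leib3_in x). Qed.

Let assoc_leib x t b :
  tens_assoc (leibi x t) b + tens_assoc t (i x * b) = leib3 x (tens_assoc t b).
Proof.
have al c : linear (fun t : tensor U U => tens_assoc t c).
  exact: bilinl c (@bilin_tens_assoc _ U).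
move: t; apply: (tens_lin_ext (lin_add (lin_comp (al b) (llin x)) (al (i x * b)))
                              (lin_comp (leib3_linear x) (al b))) => a1 a2.
rewrite leibE ?(linD (al _)) ?tens_assocE ?leib3E; last exact: lin_mulj.
rewrite leibE; last exact: lin_mulj.
by rewrite (linD (bilinr a1 (bilin_tens _ _))) addrA.
Qed.

Let coL t := tens_ext (fun a b => tens_assoc (Delta a) b) t.
Let coR t := tens_ext (fun a b => a \otimes Delta b) t.

Let coL_in :
  @is_bilinear R U U (tensor U (tensor U U)) (fun a b => tens_assoc (Delta a) b).
Proof. exact: (bilin_comp (@bilin_tens_assoc _ U) Dlin (@lin_id _ _)). Qed.

Let coR_in : @is_bilinear R U U (tensor U (tensor U U)) (fun a b => a \otimes Delta b).
Proof. exact: (bilin_comp (bilin_tens _ _) (@lin_id _ _) Dlin). Qed.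

Let coLE a b : coL (a \otimes b) = tens_assoc (Delta a) b.
Proof. exact: tens_extE coL_in. Qed.

Let coRE a b : coR (a \otimes b) = a \otimes Delta b.
Proof. exact: tens_extE coR_in. Qed.

Let coLlin : linear coL. Proof. exact: tens_ext_linear coL_in. Qed.
Let coRlin : linear coR. Proof. exact: tens_ext_linear coR_in. Qed.

Let coL_leib x t : coL (leibi x t) = leib3 x (coL t).
Proof.
move: t; apply: (tens_lin_ext (lin_comp coLlin (llin x))
                              (lin_comp (leib3_linear x) coLlin)).
move=> a b; rewrite leibE; last exact: lin_mulj.
by rewrite (linD coLlin) !coLE (env_comulM E) assoc_leib.
Qed.

Let coR_leib x t : coR (leibi x t) = leib3 x (coR t).
Proof.
move: t; apply: (tens_lin_ext (lin_comp coRlin (llin x))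
                              (lin_comp (leib3_linear x) coRlin)).
move=> a b; rewrite leibE; last exact: lin_mulj.
by rewrite (linD coRlin) !coRE (env_comulM E) leib3E.
Qed.

Lemma env_coassoc u : coL (Delta u) = coR (Delta u).
Proof.
move: u; apply: (env_lin_ext (lin_comp coLlin Dlin) (lin_comp coRlin Dlin)).
- by rewrite (env_comul1 E) coLE coRE (env_comul1 E) tens_assocE.
- by move=> x u ih; rewrite (env_comulM E) coL_leib coR_leib ih.
Qed.

(* Counit and antipode axioms have the form F (Delta u) = g u, where F
   intertwines the action of x on tensors with an explicit map [op x]. *)
Let conv (X : lmodType R) (F : U -> U -> X) (op : V -> X -> X) (g : U -> X) :
  is_bilinear F -> (forall x, linear (op x)) -> linear g -> F 1 1 = g 1 ->
  (forall x a b, F (i x * a) b + F a (i x * b) = op x (F a b)) ->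
  (forall x u, op x (g u) = g (i x * u)) ->
  forall u, tens_ext F (Delta u) = g u.
Proof.
move=> hF hop hg e1 eop eg; have Fl := tens_ext_linear hF.
apply: (env_lin_ext (lin_comp Fl Dlin) hg).
  by rewrite (env_comul1 E) (tens_extE _ _ hF).
move=> x u ih; rewrite (env_comulM E) -eg -ih; move: (Delta u).
apply: (tens_lin_ext (lin_comp Fl (llin x)) (lin_comp (hop x) Fl)) => a b.
rewrite leibE; last exact: lin_mulj.
by rewrite (linD Fl) !(tens_extE _ _ hF) eop.
Qed.

Let el : linear (eps : U -> R^o) := env_counit_linear E.
Let Sl : linear S := env_antipode_linear E.

Lemma env_counitl u : tens_ext (fun a b => eps a *: b) (Delta u) = u.
Proof.
have hF : is_bilinear (fun (a b : U) => (eps a : R^o) *: b).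
  by split=> [a|b]; [exact: lin_scale (@lin_id _ _)|exact: lin_scalel el].
apply: (conv (op := fun x => *%R (i x)) (g := idfun) hF) => //.
- by move=> x; exact: lin_mulj.
- by rewrite (env_counit1 E) scale1r.
- by move=> x a b; rewrite (env_counitM E) scale0r add0r scalerAr.
Qed.

Lemma env_counitr u : tens_ext (fun a b => eps b *: a) (Delta u) = u.
Proof.
have hF : is_bilinear (fun (a b : U) => (eps b : R^o) *: a).
  by split=> [a|b]; [exact: lin_scalel el|exact: lin_scale (@lin_id _ _)].
apply: (conv (op := fun x => *%R (i x)) (g := idfun) hF) => //.
- by move=> x; exact: lin_mulj.
- by rewrite (env_counit1 E) scale1r.
- by move=> x a b; rewrite (env_counitM E) scale0r addr0 scalerAr.
Qed.

Let eps1_lin : linear (fun u => (eps u : R^o) *: (1 : U)).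
Proof. exact: lin_scalel el. Qed.

Lemma env_antipodel u : tens_ext (fun a b => S a * b) (Delta u) = eps u *: 1.
Proof.
apply: (conv (op := fun x _ => 0) (g := fun u => eps u *: 1)).
- exact: (bilin_comp mulE Sl (@lin_id _ _)).
- by move=> x a b c; rewrite scaler0 addr0.
- exact: eps1_lin.
- by rewrite (env_antipode1 E) (env_counit1 E) mulr1 scale1r.
- by move=> x a b; rewrite (env_antipodeM E) mulNr mulrA addNr.
- by move=> x v; rewrite (env_counitM E) scale0r.
Qed.

Lemma env_antipoder u : tens_ext (fun a b => a * S b) (Delta u) = eps u *: 1.
Proof.
apply: (conv (op := fun x v => i x * v - v * i x) (g := fun u => eps u *: 1)).
- exact: (bilin_comp mulE (@lin_id _ _) Sl).
- by move=> x; apply: lin_sub; [exact: lin_mulj|exact: (bilinl _ mulE)].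
- exact: eps1_lin.
- by rewrite (env_antipode1 E) (env_counit1 E) mulr1 scale1r.
- by move=> x a b; rewrite (env_antipodeM E) mulrN !mulrA.
- by move=> x v; rewrite (env_counitM E) scale0r -scalerAr -scalerAl mulr1 mul1r subrr.
Qed.

Lemma env_hopf : is_hopf (HopfOps *%R 1 Delta eps S).
Proof.
split=> /=.
- exact: mulE.
- exact: mulrA.
- exact: mul1r.
- exact: mulr1.
- exact: Dlin.
- exact: env_coassoc.
- exact: (env_counit_linear E).
- exact: env_counitl.
- exact: env_counitr.
- exact: env_comul_morph.
- exact: (env_comul1 E).
- exact: env_counit_morph.
- exact: (env_counit1 E).
- exact: Sl.
- exact: env_antipodel.
- exact: env_antipoder.
Qed.

End EnvelopeHopf.

Lemma uenv_is_hopf (R : comNzRingType) (V : lmodType R) (br : V -> V -> V) :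
  is_hopf (uenv_hopf br).
Proof. exact: env_hopf (uenv_envelope br). Qed.

(** * Word filtration and Poincare-Birkhoff-Witt bases *)

Section Filtration.
Variables (R : comNzRingType) (V : lmodType R) (A : algType R) (j : V -> A).

Definition jword (w : seq V) : A := \prod_(x <- w) j x.

Lemma jword_nil : jword [::] = 1. Proof. exact: big_nil. Qed.

Lemma jword_cons x w : jword (x :: w) = j x * jword w.
Proof. exact: big_cons. Qed.

Lemma jword_cat w w' : jword (w ++ w') = jword w * jword w'.
Proof. exact: big_cat. Qed.

(** The bound on the length is strict, so that [filt (size w)] is the place for
    the terms of order lower than that of [jword w]. *)
Definition filt n : A -> Prop :=
  submod_gen (fun v => exists2 w, (size w < n)%N & v = jword w).

Lemma filt_jword w n : (size w < n)%N -> filt n (jword w).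
Proof. by move=> hw; apply: SubmodGen; exists w. Qed.

Lemma filt_mono m n u : (m <= n)%N -> filt m u -> filt n u.
Proof.
move=> hmn; apply: submod_gen_mono => v [w hw ->]; exists w => //.
exact: leq_trans hmn.
Qed.

Lemma filtMl n w u : filt n u -> filt (size w + n) (jword w * u).
Proof.
apply: (submod_gen_lin (f := *%R (jword w)) (lin_mulj (jword w))).
move=> _ [w' hw' ->]; rewrite -jword_cat; apply: filt_jword.
by rewrite size_cat ltn_add2l.
Qed.

Lemma filt_lmul n x u : filt n u -> filt n.+1 (j x * u).
Proof. by move=> /(filtMl [:: x]); rewrite jword_cons jword_nil mulr1. Qed.

Variable br : V -> V -> V.
Hypothesis j_br : forall x y, j x * j y - j y * j x = j (br x y).

Lemma filt_swap w1 x y w2 :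
  filt (size (w1 ++ x :: y :: w2))
    (jword (w1 ++ x :: y :: w2) - jword (w1 ++ y :: x :: w2)).
Proof.
rewrite !jword_cat -mulrBr !jword_cons !mulrA -mulrBl j_br -jword_cons -jword_cat.
by apply: filt_jword; rewrite !size_cat /= !addnS.
Qed.

Lemma filt_move w1 x w2 :
  filt (size (w1 ++ x :: w2)) (jword (w1 ++ x :: w2) - jword (x :: w1 ++ w2)).
Proof.
elim: w1 => [|y w1 ih] /=; first by rewrite subrr; apply: Submod0.
have := filt_swap [::] y x (w1 ++ w2); rewrite /= => hs.
have hz : size (w1 ++ x :: w2) = (size (w1 ++ w2)).+1 by rewrite !size_cat addnS.
rewrite -(subrKA (jword (y :: x :: w1 ++ w2))).
apply: submod_genD; last by rewrite hz.
rewrite [jword (y :: _)]jword_cons [jword (y :: _)]jword_cons -mulrBr.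
exact: filt_lmul.
Qed.
End Filtration.

Section Leading.
Variables (R : comNzRingType) (V : lmodType R).

(** [f] maps every product of generators to the same product, up to terms of
    lower order; such maps compose and respect the filtrations. *)
Definition leading (A A' : algType R) (j : V -> A) (j' : V -> A') (f : A -> A') : Prop :=
  forall w, filt j' (size w) (f (jword j w) - jword j' w).

Lemma leading_filt (A A' : algType R) (j : V -> A) (j' : V -> A') f n u :
  linear f -> leading j j' f -> filt j n u -> filt j' n (f u).
Proof.
move=> fl fj; apply: submod_gen_lin => // _ [w hw ->].
rewrite -[f _](subrK (jword j' w)); apply: submod_genD; last exact: filt_jword.
by apply: filt_mono (fj w); exact: ltnW.
Qed.

Lemma leading_comp (A A' A'' : algType R)
    (j : V -> A) (j' : V -> A') (j'' : V -> A'') f g :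
  linear g -> leading j j' f -> leading j' j'' g -> leading j j'' (fun u => g (f u)).
Proof.
move=> gl fj gj w; rewrite -[f _](subrK (jword j' w)) (linD gl) -addrA.
by apply: submod_genD; [exact: leading_filt gj (fj w)|exact: gj].
Qed.
End Leading.

Section BasisWords.
Variables (R : comNzRingType) (K : choiceType) (A : algType R) (j : {malg R[K]} -> A).
Hypothesis j_lin : linear j.

Definition kword w : A := \prod_(k <- w) j << k >>.

Lemma kword_cons k w : kword (k :: w) = j << k >> * kword w.
Proof. exact: big_cons. Qed.

Lemma kwordE w : kword w = jword j [seq << k >> | k <- w].
Proof. by rewrite /jword big_map. Qed.

Lemma jword_kwords w :
  submod_gen (fun v => exists2 w', size w' = size w & v = kword w') (jword j w).
Proof.
elim: w => [|x w ih].
  by apply: SubmodGen; exists [::] => //; rewrite jword_nil /kword big_nil.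
rewrite jword_cons; have jl : linear (fun x => j x * jword j w).
  exact: lin_comp (bilinl _ (bilin_mul A)) j_lin.
elim/malg_ind: x => [|a k x hx]; first by rewrite (lin0 jl); exact: Submod0.
rewrite jl; apply: SubmodLin hx; move: ih.
apply: (submod_gen_lin (f := *%R (j << k >>)) (lin_mulj _)).
move=> _ [w' hw' ->]; apply: SubmodGen; exists (k :: w') => /=; first by rewrite hw'.
by rewrite kword_cons.
Qed.

End BasisWords.

Section Basis.
Variables (R : comNzRingType) (K : choiceType).
Local Notation V := {malg R[K]}.
Local Notation P := {malg R[{cmonom K}]}.
Variables (A : algType R) (j : V -> A) (br : V -> V -> V).
Hypothesis j_lin : linear j.
Hypothesis j_br : forall x y, j x * j y - j y * j x = j (br x y).
Hypothesis j_span : forall u, exists n, filt j n u.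

(** Straightening: exchanging neighbours costs a commutator, which is a word
    with one letter less. *)
Lemma kword_perm w w' : perm_eq w w' -> filt j (size w) (kword j w - kword j w').
Proof.
elim: w w' => [|k w ih] w' pw.
  by move: (perm_size pw) => /= /esym/size0nil ->; rewrite subrr; exact: Submod0.
have kw' : k \in w' by rewrite -(perm_mem pw) mem_head.
case/splitPr: kw' pw => w1 w2 pw.
have pw' : perm_eq w (w1 ++ w2).
  by move: pw; rewrite -[k :: w2]cat1s perm_sym perm_catCA /= perm_cons perm_sym.
rewrite -(subrKA (kword j (k :: w1 ++ w2))); apply: submod_genD.
  by rewrite !kword_cons -mulrBr; apply: filt_lmul; apply: ih.
rewrite -opprB; apply: submod_genN; rewrite !kwordE !map_cat /=.
have := filt_move j_br [seq << k >> | k <- w1] << k >> [seq << k >> | k <- w2].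
have -> : (size w).+1 = size (w1 ++ k :: w2) := perm_size pw.
by rewrite map_cat !size_cat /= !size_map.

Qed.

Definition kmon (w : seq K) : {cmonom K} := \big[mmul/mone]_(k <- w) ucm k.

Lemma kmon_cons k w : kmon (k :: w) = mmul (ucm k) (kmon w).
Proof. exact: big_cons. Qed.

Lemma kmon_count w k : kmon w k = count_mem k w.
Proof.
elim: w => [|l w ih]; first by rewrite /kmon big_nil cm1.
by rewrite kmon_cons cmM cmU ih.
Qed.

Lemma kmon_perm w w' : kmon w = kmon w' -> perm_eq w w'.
Proof.
move=> e; apply/allP => k _ /=; apply/eqP.
by rewrite -!kmon_count e.
Qed.

Lemma mdeg_kmon w : mdeg (kmon w) = size w.
Proof.
elim: w => [|k w ih]; first by rewrite /kmon big_nil mdeg1.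
by rewrite kmon_cons mdegM mdegU ih.
Qed.

Definition pol_in : V -> P := linext (fun k => << ucm k >>).

Lemma pol_in_linear : linear pol_in.
Proof. exact: linext_linear. Qed.

Lemma jword_pol w : jword pol_in [seq << k >> | k <- w] = << kmon w >>.
Proof.
elim: w => [|k w ih]; first by rewrite jword_nil /kmon big_nil.
rewrite kmon_cons /= jword_cons ih /pol_in linextU malgM_def fgmulUU mulr1.
reflexivity.
Qed.

Lemma filt_pol n (p : P) m : filt pol_in n p -> (n <= mdeg m)%N -> p@_m = 0.
Proof.
move=> hp hm.
have ml : linear (fun p : P => p@_m : R^o).
  by move=> a u v; rewrite mcoeffD mcoeffZ.
apply: (submod_gen_ker (W := R^o) ml _ hp) => _ [w hw ->].
apply: (submod_gen_ker (W := R^o) ml _ (jword_kwords pol_in_linear w)).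
move=> _ [w' hw' ->]; rewrite kwordE jword_pol mcoeffU.
case: eqP => // e; move: hw hm; rewrite -e mdeg_kmon hw' ltnNge.
by move=> /negP.
Qed.

(* The words are compared with monomials by a map [f] to polynomials with the
   right leading terms; this is what makes them independent. *)
Variable f : A -> P.
Hypothesis f_lin : linear f.
Hypothesis f_lead : leading j pol_in f.

Lemma coef_kword w m : (size w <= mdeg m)%N -> (f (kword j w))@_m = (kmon w == m)%:R.
Proof.
move=> hw; have := f_lead [seq << k >> | k <- w].
rewrite size_map jword_pol -kwordE => h.
rewrite -[f _](subrK << kmon w >>) mcoeffD (filt_pol h hw) add0r.
by rewrite mcoeffU.
Qed.

(* one word for each multiset of letters *)
Variables (I : choiceType) (s : I -> seq K).
Hypothesis s_surj : forall w, exists a, perm_eq w (s a).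
Hypothesis s_inj : forall a b, perm_eq (s a) (s b) -> a = b.
Local Notation F := (fun a => kword j (s a)).

Lemma kword_span n u : filt j n u -> exists c, u = linext F c.
Proof.
have ll := linext_linear F.
have sub (S : A -> Prop) v : submod_gen S v ->
    (forall u, S u -> exists c, u = linext F c) -> exists c, v = linext F c.
  move=> hv hS; elim: hv => [x /hS //||a x y _ [c ->] _ [c' ->]].
    by exists 0; rewrite (lin0 ll).
  by exists (a *: c + c'); rewrite ll.
elim: n u => [|n ih] u hu; apply: (sub _ _ hu) => _ [w hw ->] //.
apply: (sub _ _ (jword_kwords j_lin w)) => _ [w' hw' ->].
have [a pa] := s_surj w'.
have [c hc] : exists c, kword j w' - F a = linext F c.
  by apply: ih; apply: filt_mono (kword_perm pa); rewrite hw'.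
exists (c + << a >>); rewrite (linD ll) -hc linextU.
by rewrite subrK.
Qed.

(** If all coefficients at words longer than [s a] vanish, then the coefficient
    at [s a] can be read off at the monomial of [s a]: the longest words go
    first. *)
Lemma kword_free c : f (linext F c) = 0 -> c = 0.
Proof.
move=> c0; pose N := (\max_(a <- msupp c) size (s a))%N.
have hN k : forall a, (N < size (s a) + k)%N -> c@_a = 0.
  elim: k => [|k ih] a ha.
    apply: mcoeff_outdom; apply: contraL ha => ha.
    by rewrite addn0 -leqNgt; apply: (leq_bigmax_seq a).
  have ml : linear (fun u : A => (f u)@_(kmon (s a)) : R^o).
    by move=> x u v; rewrite f_lin mcoeffD mcoeffZ.
  have : (f (linext F c))@_(kmon (s a)) = 0 by rewrite c0 mcoeff0.
  rewrite /linext (lin_sum _ _ _ ml).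
  rewrite (eq_bigr (fun b => c@_b * (b == a)%:R)) => [|b _].
    have [ha'|/mcoeff_outdom //] := boolP (a \in msupp c).
    rewrite (big_fsetD1 a ha') /= eqxx mulr1 big1_fset ?addr0 // => b.
    by rewrite in_fsetD1 => /andP [/negPf -> _] _; rewrite mulr0.
  rewrite (linZ _ ml) /=; have [hb|hb] := ltnP (size (s a)) (size (s b)).
    by rewrite ih ?mul0r ?scale0r // (leq_trans ha) // addnS -addSn leq_add2r.
  rewrite coef_kword ?mdeg_kmon //; congr (_ * (nat_of_bool _)%:R).
  by apply/eqP/eqP => [/kmon_perm/s_inj|->].
apply/malgP => a; rewrite mcoeff0; apply: (hN N.+1).
by rewrite addnS ltnS leq_addl.
Qed.

Lemma kword_basis : is_basis F.
Proof.
move=> v; have [n hn] := j_span v; have [c hc] := kword_span hn.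
exists c; split=> // c' hc'; apply/eqP; rewrite -subr_eq0; apply/eqP.
by apply: kword_free; rewrite (linB (linext_linear F)) -hc -hc' subrr (lin0 f_lin).
Qed.

Lemma leading_inj u : f u = 0 -> u = 0.
Proof.
move=> fu; have [n hn] := j_span u; have [c hc] := kword_span hn.
move: fu; rewrite hc => /kword_free ->; exact: lin0 (linext_linear F).
Qed.

End Basis.


(** * The map U(L) -> U(L_0) of a post-Lie algebra *)

Section Derivation.
Variables (R : comNzRingType) (V : lmodType R) (br : V -> V -> V).
Variables (U : algType R) (i : V -> U) (Delta : U -> tensor U U) (eps : U -> R).
Variable (S : U -> U).
Hypothesis E : envelope br i Delta eps S.

(** A derivation [D] of the Lie algebra extends to U(V): y acts on pairs (a, b)
    by the matrix with diagonal entries y and lower left entry [D y], and the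
    extension is the second component of the action on (1, 0). *)
Lemma env_derivation (D : V -> V) : linear D ->
  (forall y z, D (br y z) = br (D y) z + br y (D z)) ->
  exists delta : U -> U,
    [/\ linear delta, delta 1 = 0 &
        forall y u, delta (i y * u) = i (D y) * u + i y * delta u].
Proof.
move=> Dl Dbr; have il := env_linear E.
pose rho y (p : U * U) : (U * U)%type := (i y * p.1, i (D y) * p.1 + i y * p.2).
have rb : is_bilinear rho.
  split=> [y|p] a s t; rewrite /rho; congr (_, _) => /=.
  - by rewrite mulrDr -scalerAr.
  - by rewrite !mulrDr -!scalerAr scalerDr addrACA.
  - by rewrite il mulrDl -scalerAl.
  - by rewrite Dl !il !mulrDl -!scalerAl scalerDr addrACA.
have rr y z p : rho y (rho z p) - rho z (rho y p) = rho (br y z) p.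
  rewrite /rho; congr (_, _) => /=; first by rewrite !mulrA -mulrBl (env_br E).
  rewrite Dbr (linD il) -!(env_br E) !mulrDl !mulrDr !mulNr !mulrA. abel.
have [act [ab a1 aM]] := env_act E rb rr.
have afst u : (act u (1, 0)).1 = u.
  move: u; apply: (env_lin_ext E).
  - by move=> a u v; rewrite (bilinl _ ab).
  - exact: lin_id.
  - by rewrite a1.
  - by move=> x u ih; rewrite aM /= ih.
exists (fun u => (act u (1, 0)).2); split.
- by move=> a u v; rewrite (bilinl _ ab).
- by rewrite a1.
- by move=> y u; rewrite aM /= afst.
Qed.

Lemma env_derivation_morph (D : V -> V) (delta : U -> U) :
  linear delta -> delta 1 = 0 ->
  (forall y u, delta (i y * u) = i (D y) * u + i y * delta u) ->
  forall u v, delta (u * v) = delta u * v + u * delta v.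
Proof.
move=> dl d1 dM u v; have mb := bilin_mul U; move: u; apply: (env_lin_ext E).
- exact: lin_comp dl (bilinl v mb).
- by apply: lin_add; [exact: lin_comp (bilinl v mb) dl|exact: (bilinl _ mb)].
- by rewrite mul1r d1 mul0r add0r mul1r.
- by move=> x u ih; rewrite -mulrA !dM ih mulrDl mulrDr !mulrA addrA.
Qed.

End Derivation.

Section PostLieEnvelope.
Variables (R : comNzRingType) (V : lmodType R) (br0 tri br : V -> V -> V).
Variables (U0 : algType R) (i0 : V -> U0) (Delta0 : U0 -> tensor U0 U0).
Variables (eps0 : U0 -> R) (S0 : U0 -> U0).
Variables (U : algType R) (i : V -> U) (Delta : U -> tensor U U) (eps : U -> R).
Variable (S : U -> U).
Hypothesis E0 : envelope br0 i0 Delta0 eps0 S0.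
Hypothesis E : envelope br i Delta eps S.
Hypothesis tri_bilin : is_bilinear tri.
Hypothesis br_def : forall x y, br x y = br0 x y + tri x y - tri y x.
Hypothesis tri_br0 : forall x y z,
  tri x (br0 y z) = br0 (tri x y) z + br0 y (tri x z).
Hypothesis br0_tri : forall x y z, tri (br0 x y) z =
  tri x (tri y z) - tri (tri x y) z - (tri y (tri x z) - tri (tri y x) z).

Let il0 := env_linear E0.

(* [tri] is a representation of (L, br) *)
Lemma tri_br x y z : tri (br x y) z = tri x (tri y z) - tri y (tri x z).
Proof.
have tl := bilinl z tri_bilin.
by rewrite br_def (linB tl) (linD tl) br0_tri; abel.
Qed.

(* [delta x] is the derivation of U(L_0) extending [tri x]; it is given by its
   characteristic equations, as it will come from different sources. *)
Variable delta : V -> U0 -> U0.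
Hypothesis delta_linear : forall x, linear (delta x).
Hypothesis delta1 : forall x, delta x 1 = 0.
Hypothesis deltaM : forall x y u,
  delta x (i0 y * u) = i0 (tri x y) * u + i0 y * delta x u.

Let mb0 := bilin_mul U0.

Lemma bilin_delta : is_bilinear delta.
Proof.
split=> // u a x y; move: u; apply: (env_lin_ext E0).
- exact: delta_linear.
- exact: lin_add (lin_scale a (delta_linear x)) (delta_linear y).
- by rewrite !delta1 scaler0 addr0.
move=> z u ih; rewrite !deltaM ih (bilinl z tri_bilin) il0.
by rewrite !mulrDl !mulrDr scalerDr -scalerAl -scalerAr; abel.
Qed.

Lemma delta_comm x y u : delta x (delta y u) - delta y (delta x u) = delta (br x y) u.
Proof.
move: u; apply: (env_lin_ext E0).
- apply: lin_sub; exact: lin_comp (delta_linear _) (delta_linear _).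
- exact: delta_linear.
- by rewrite !delta1 !(lin0 (delta_linear _)) subrr.
move=> z u ih; rewrite !deltaM !(linD (delta_linear _)) !deltaM -ih tri_br.
by rewrite (linB il0) mulrBl mulrBr; abel.
Qed.

Lemma delta_in x y : delta x (i0 y) = i0 (tri x y).
Proof. by rewrite -[i0 y]mulr1 deltaM delta1 mulr0 addr0 mulr1. Qed.

Lemma deltaD x u v : delta x (u * v) = delta x u * v + u * delta x v.
Proof.
by apply: (env_derivation_morph E0 (D := tri x)) => // y w; apply: deltaM.
Qed.

Lemma delta_comul x u : Delta0 (delta x u) = leib (delta x) (Delta0 u).
Proof.
have Dl := env_comul_linear E0; have dl := delta_linear x.
move: u; apply: (env_lin_ext E0 (lin_comp Dl dl) (lin_comp (leib_linear dl) Dl)).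
  rewrite delta1 (lin0 Dl) (env_comul1 E0) leibE // delta1.
  rewrite (lin0 (bilinl 1 (bilin_tens U0 U0))).
  by rewrite (lin0 (bilinr 1 (bilin_tens U0 U0))) addr0.
move=> y u ih; rewrite deltaM (linD Dl) !(env_comulM E0) ih.
apply/esym/eqP; rewrite -subr_eq; apply/eqP.
apply: (leib_comm (Delta0 u) dl (lin_mulj (i0 y)) (lin_mulj (i0 (tri x y)))) => a.
by rewrite deltaM addrK.
Qed.

Lemma delta_counit x u : eps0 (delta x u) = 0.
Proof.
have el : linear (eps0 : U0 -> R^o) := env_counit_linear E0.
move: u; apply: (@env_lin_ext _ _ _ _ _ _ _ _ E0 R^o).
- exact: lin_comp el (delta_linear x).
- by move=> a u v; rewrite scaler0 addr0.
- by rewrite delta1; exact: lin0 el.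
- by move=> y u _; rewrite deltaM (linD el) !(env_counitM E0) addr0.
Qed.

(** The action x A + x |> A of L on U(L_0): by the post-Lie identities it is a
    representation for the bracket [br] ([rho_rep]). *)
Definition rho x u := i0 x * u + delta x u.

Lemma bilin_rho : is_bilinear rho.
Proof. exact: bilin_add (bilin_mulj il0) bilin_delta. Qed.

Lemma rho_rep x y u : rho x (rho y u) - rho y (rho x u) = rho (br x y) u.
Proof.
rewrite /rho !mulrDr !(linD (delta_linear _)) !deltaM -delta_comm.
rewrite br_def (linB il0) (linD il0) -(env_br E0) !mulrDl !mulNr !mulrA; abel.
Qed.

Variables (act : U -> U0 -> U0).
Hypothesis act_bilin : is_bilinear act.
Hypothesis act1 : forall m, act 1 m = m.
Hypothesis actM : forall x u m, act (i x * u) m = rho x (act u m).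

(** The orbit map of 1. It satisfies [Psi (x u) = rho x (Psi u)], hence it keeps
    leading terms, and it is compatible with the coproducts because every
    [rho x] acts on them by the Leibniz rule. *)
Definition Psi u := act u 1.

Lemma Psi_linear : linear Psi.
Proof. exact: bilinl act_bilin. Qed.

Lemma Psi1 : Psi 1 = 1.
Proof. exact: act1. Qed.

Lemma PsiM x u : Psi (i x * u) = i0 x * Psi u + delta x (Psi u).
Proof. exact: actM. Qed.

Lemma act_mul u v m : act (u * v) m = act u (act v m).
Proof.
move: u; apply: (env_lin_ext E).
- exact: lin_comp (bilinl m act_bilin) (bilinl v (bilin_mul U)).
- exact: bilinl act_bilin.
- by rewrite mul1r act1.
- by move=> x u ih; rewrite -mulrA !actM ih.
Qed.

Lemma rho_comul x u : Delta0 (rho x u) = leib (rho x) (Delta0 u).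
Proof.
rewrite (linD (env_comul_linear E0)) (env_comulM E0) delta_comul.
by rewrite -(leib_add _ (lin_mulj _) (delta_linear x)).
Qed.

Lemma Psi_comul u : Delta0 (Psi u) = tens_map Psi Psi (Delta u).
Proof.
have D0l := env_comul_linear E0; have Dl := env_comul_linear E.
have Pl := Psi_linear; have Tl := tens_map_linear Pl Pl.
move: u; apply: (env_lin_ext E (lin_comp D0l Pl) (lin_comp Tl Dl)).
  by rewrite Psi1 (env_comul1 E0) (env_comul1 E) (tens_mapE Pl Pl) Psi1.
move=> x u ih; rewrite (env_comulM E) PsiM -[i0 x * _ + _]/(rho x _) rho_comul ih.
move: (Delta u); have rl : linear (rho x) := bilinr x bilin_rho.
apply: (tens_lin_ext (lin_comp (leib_linear rl) Tl)
                     (lin_comp Tl (leib_linear (lin_mulj (i x))))) => a b.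
rewrite (tens_mapE Pl Pl) (leibE _ _ rl) (leibE _ _ (lin_mulj (i x))).
by rewrite (linD Tl) !(tens_mapE Pl Pl) !PsiM.
Qed.

Lemma Psi_counit u : eps0 (Psi u) = eps u.
Proof.
have el0 : linear (eps0 : U0 -> R^o) := env_counit_linear E0.
have el : linear (eps : U -> R^o) := env_counit_linear E.
move: u; apply: (@env_lin_ext _ _ _ _ _ _ _ _ E R^o).
- exact: lin_comp el0 Psi_linear.
- exact: el.
- by rewrite Psi1 (env_counit1 E0) (env_counit1 E).
- move=> x u _; rewrite PsiM (linD el0) (env_counitM E0) delta_counit.
  by rewrite (env_counitM E) addr0.
Qed.

Lemma delta_filt n x u : filt i0 n u -> filt i0 n (delta x u).
Proof.
apply: submod_gen_lin => // _ [w hw ->]; apply: filt_mono hw _.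
elim: w => [|y w ih]; first by rewrite jword_nil delta1; exact: Submod0.
rewrite jword_cons deltaM; apply: submod_genD; last exact: filt_lmul.
by rewrite -jword_cons; apply: filt_jword.
Qed.

Lemma Psi_leading : leading i i0 Psi.
Proof.
elim=> [|x w ih]; first by rewrite !jword_nil Psi1 subrr; exact: Submod0.
rewrite !jword_cons PsiM addrAC -mulrBr; apply: submod_genD.
  exact: filt_lmul.
apply: delta_filt; rewrite -[Psi _](subrK (jword i0 w)).
apply: submod_genD; last exact: filt_jword.
exact: filt_mono ih.
Qed.

Lemma Psi_surj n u0 : filt i0 n u0 -> exists u, Psi u = u0.
Proof.
have Pl := Psi_linear.
elim: n u0 => [|n ih] u0; elim=> [_ [w hw ->]||a x y _ [u <-] _ [v <-]] //.
1,4: by exists 0; rewrite (lin0 Pl).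
1,3: by exists (a *: u + v); rewrite Pl.
have [v hv] : exists v, Psi v = Psi (jword i w) - jword i0 w.
  by apply: ih; apply: filt_mono (Psi_leading w).
by exists (jword i w - v); rewrite (linB Pl) hv opprB addrC subrK.
Qed.

Section Star.
Variable T : U0 -> U0 -> U0.
Hypothesis T_bilin : is_bilinear T.
Hypothesis T1 : forall B, T 1 B = B.
Hypothesis TM : forall x A B, T (i0 x * A) B = delta x (T A B) - T (delta x A) B.

(** Both sides send left multiplication by x to [rho x], by the recursion [TM].
    Taking [B] in the image of [Psi] turns the star product into the product
    of U(L). *)
Lemma star_Psi u B :
  tens_ext (fun A1 A2 => A1 * T A2 B) (Delta0 (Psi u)) = act u B.
Proof.
have hM : is_bilinear (fun A1 A2 => A1 * T A2 B).
  exact: bilin_comp mb0 (@lin_id _ _) (bilinl B T_bilin).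
pose M t := tens_ext (fun A1 A2 => A1 * T A2 B) t.
have Ml : linear M := tens_ext_linear hM.
have ME a b : M (a \otimes b) = a * T b B := tens_extE a b hM.
rewrite -/(M _); have D0l := env_comul_linear E0.
move: u; apply: (env_lin_ext E (lin_comp Ml (lin_comp D0l Psi_linear))
                               (bilinl B act_bilin)).
  by rewrite Psi1 (env_comul1 E0) ME T1 mul1r act1.
move=> x u ih; rewrite actM -ih PsiM -[i0 x * _ + _]/(rho x _) rho_comul.
have rl : linear (rho x) := bilinr x bilin_rho.
move: (Delta0 _); apply: (tens_lin_ext (lin_comp Ml (leib_linear rl)) (lin_comp rl Ml)).
move=> a b; rewrite (leibE a b rl) (linD Ml) !ME /rho mulrDl.
by rewrite (linD (bilinl B T_bilin)) TM subrK deltaD mulrA addrA.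
Qed.
End Star.

Section Extension.
(* the action of U(L) by the derivations [delta x], a representation by
   [delta_comm] *)
Variable alpha : U -> U0 -> U0.
Hypothesis alpha_bilin : is_bilinear alpha.
Hypothesis alpha1 : forall m, alpha 1 m = m.
Hypothesis alphaM : forall x u m, alpha (i x * u) m = delta x (alpha u m).
Variable Theta : U0 -> U.
Hypothesis PsiK : cancel Psi Theta.
Hypothesis ThetaK : cancel Theta Psi.

Lemma Theta_linear : linear Theta.
Proof. by move=> a x y; apply: (can_inj PsiK); rewrite Psi_linear !ThetaK. Qed.

Lemma Theta1 : Theta 1 = 1.
Proof. by rewrite -Psi1 PsiK. Qed.

Lemma ThetaM x A : Theta (i0 x * A) = i x * Theta A - Theta (delta x A).
Proof.
apply: (can_inj PsiK); rewrite (linB Psi_linear) PsiM !ThetaK.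
by rewrite addrK.
Qed.

(** The extension of the post-Lie product: U(L) acts on U(L_0) by the
    derivations [delta x], and [Theta] moves the first argument into U(L). *)
Definition guin_oudom A B := alpha (Theta A) B.
Local Notation T := guin_oudom.

Lemma bilin_guin_oudom : is_bilinear T.
Proof. exact: bilin_comp alpha_bilin Theta_linear (@lin_id _ _). Qed.

Lemma guin_oudom1 B : T 1 B = B.
Proof. by rewrite /T Theta1 alpha1. Qed.

Lemma guin_oudomM x A B : T (i0 x * A) B = delta x (T A B) - T (delta x A) B.
Proof. by rewrite /T ThetaM (linB (bilinl B alpha_bilin)) alphaM. Qed.

Lemma guin_oudom_in x B : T (i0 x) B = delta x B.
Proof.
rewrite -[i0 x]mulr1 guin_oudomM delta1 guin_oudom1.
by rewrite (lin0 (bilinl B bilin_guin_oudom)) subr0.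
Qed.

Lemma guin_oudom_mulr A B C :
  T A (B * C) = tens_ext (fun A1 A2 => T A1 B * T A2 C) (Delta0 A).
Proof.
have Tb := bilin_guin_oudom.
have hM : is_bilinear (fun A1 A2 => T A1 B * T A2 C).
  exact: bilin_comp mb0 (bilinl B Tb) (bilinl C Tb).
pose M t := tens_ext (fun A1 A2 => T A1 B * T A2 C) t.
have Ml : linear M := tens_ext_linear hM.
have ME a b : M (a \otimes b) = T a B * T b C := tens_extE a b hM.
have D0l := env_comul_linear E0.
rewrite -[A]ThetaK -/(M _) /T PsiK; move: (Theta A).
apply: (env_lin_ext E (bilinl _ alpha_bilin) (lin_comp Ml (lin_comp D0l Psi_linear))).
  by rewrite Psi1 (env_comul1 E0) ME !guin_oudom1 alpha1.
move=> x u ih; rewrite alphaM ih PsiM -[i0 x * _ + _]/(rho x _) rho_comul.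
have rl : linear (rho x) := bilinr x bilin_rho.
move: (Delta0 _); apply: (tens_lin_ext (lin_comp (delta_linear x) Ml)
                                       (lin_comp Ml (leib_linear rl))) => a b.
rewrite (leibE a b rl) (linD Ml) !ME deltaD /rho.
by rewrite (linD (bilinl B Tb)) (linD (bilinl C Tb)) !guin_oudomM !subrK.
Qed.

Lemma guin_oudom_prod x n (y : 'I_n -> V) :
  T (i0 x) (\prod_j i0 (y j)) =
  \sum_(j < n) \prod_(k < n) i0 (if k == j then tri x (y k) else y k).
Proof.
rewrite guin_oudom_in; elim: n y => [|n ih] y.
  by rewrite !big_ord0 delta1.
rewrite big_ord_recl deltaM ih big_ord_recl; congr (_ + _).
  by rewrite big_ord_recl eqxx; congr (_ * _); apply: eq_bigr => k _.
rewrite mulr_sumr; apply: eq_bigr => j _; rewrite [RHS]big_ord_recl; congr (_ * _).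
Qed.
End Extension.

End PostLieEnvelope.


(** * Transport of Hopf algebra structures *)

Section HopfTransport.
Variables (R : comNzRingType) (H H' : lmodType R).
Variables (h : hopf_ops H) (h' : hopf_ops H') (Psi : H -> H') (Theta : H' -> H).
Hypothesis h_hopf : is_hopf h.
Hypothesis Psi_lin : linear Psi.
Hypothesis PsiK : cancel Psi Theta.
Hypothesis ThetaK : cancel Theta Psi.
Hypothesis Psi_mul : {morph Psi : u v / hmul h u v >-> hmul h' u v}.
Hypothesis Psi_one : Psi (hone h) = hone h'.
Hypothesis Psi_comul : forall u, hcomul h' (Psi u) = tens_map Psi Psi (hcomul h u).
Hypothesis Psi_counit : forall u, hcounit h' (Psi u) = hcounit h u.
Hypothesis Psi_antipode : {morph Psi : u / hantipode h u >-> hantipode h' u}.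

Lemma can_linear : linear Theta.
Proof. by move=> a x y; apply: (can_inj PsiK); rewrite Psi_lin !ThetaK. Qed.

Let onto (P : H' -> Prop) : (forall u, P (Psi u)) -> forall u, P u.
Proof. by move=> hP u; rewrite -[u]ThetaK. Qed.

Let Pl2 := tens_map_linear Psi_lin Psi_lin.
Let Pl3 := tens_map_linear Psi_lin Pl2.

Lemma tens_ext_eq (V W X : lmodType R) (f g : V -> W -> X) t :
  (forall a b, f a b = g a b) -> tens_ext f t = tens_ext g t.
Proof. by move=> e; congr (tens_ext _ t); apply: funext => a; apply: funext => b. Qed.

Lemma transport_mul_bilinear : is_bilinear (hmul h').
Proof.
have hm := hopf_mul_bilinear h_hopf.
split=> u; move: u; apply: onto => u a v w /=;
  rewrite -[v]ThetaK -[w]ThetaK -Psi_lin -!Psi_mul -Psi_lin; congr (Psi _).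
- exact: (bilinr u hm).
- exact: (bilinl u hm).
Qed.

Lemma transport_comul_linear : linear (hcomul h').
Proof.
move=> a u v; rewrite -[u]ThetaK -[v]ThetaK -Psi_lin !Psi_comul.
by rewrite (hopf_comul_linear h_hopf) Pl2.
Qed.

Let map_assoc t b :
  tens_assoc (tens_map Psi Psi t) (Psi b) =
  tens_map Psi (tens_map Psi Psi) (tens_assoc t b).
Proof.
have al (G : lmodType R) (c : G) : linear (fun t : tensor G G => tens_assoc t c).
  exact: bilinl c (@bilin_tens_assoc _ G).
move: t; apply: (tens_lin_ext (lin_comp (al _ (Psi b)) Pl2)
                              (lin_comp Pl3 (al _ b))) => a1 a2.
rewrite (tens_mapE Psi_lin Psi_lin) !tens_assocE.
by rewrite (tens_mapE Psi_lin Pl2) (tens_mapE Psi_lin Psi_lin).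
Qed.

Lemma transport_coassoc u :
  tens_ext (fun a b => tens_assoc (hcomul h' a) b) (hcomul h' u) =
  tens_ext (fun a b => a \otimes hcomul h' b) (hcomul h' u).
Proof.
move: u; apply: onto => u; rewrite Psi_comul.
have Dl := hopf_comul_linear h_hopf; have D'l := transport_comul_linear.
have hL (G : lmodType R) (D : G -> tensor G G) (lD : linear D) :
    is_bilinear (fun a b => tens_assoc (D a) b).
  exact: (bilin_comp (@bilin_tens_assoc _ G) lD (@lin_id _ G)).
have hR (G : lmodType R) (D : G -> tensor G G) (lD : linear D) :
    is_bilinear (fun a b : G => a \otimes D b).
  exact: (bilin_comp (bilin_tens G (tensor G G)) (@lin_id _ G) lD).
rewrite (tens_ext_map Psi_lin Psi_lin _ (hL _ _ D'l)).
rewrite (tens_ext_map Psi_lin Psi_lin _ (hR _ _ D'l)).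
transitivity (tens_map Psi (tens_map Psi Psi)
    (tens_ext (fun a b => tens_assoc (hcomul h a) b) (hcomul h u))).
  rewrite (tens_ext_comp _ (hL _ _ Dl) Pl3); apply: tens_ext_eq => a b.
  by rewrite Psi_comul map_assoc.
rewrite [X in tens_map _ _ X](hopf_coassoc h_hopf u) (tens_ext_comp _ (hR _ _ Dl) Pl3).
by apply: tens_ext_eq => a b; rewrite Psi_comul (tens_mapE Psi_lin Pl2).
Qed.

Lemma transport_counit_linear : scalar (hcounit h').
Proof.
move=> a u v; rewrite -[u]ThetaK -[v]ThetaK -Psi_lin !Psi_counit.
exact: (hopf_counit_linear h_hopf).
Qed.

Let transport_conv (F : H -> H -> H) (F' : H' -> H' -> H') u x :
  is_bilinear F -> is_bilinear F' ->
  (forall a b, F' (Psi a) (Psi b) = Psi (F a b)) ->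
  tens_ext F (hcomul h u) = x -> tens_ext F' (hcomul h' (Psi u)) = Psi x.
Proof.
move=> hF hF' e <-; rewrite Psi_comul (tens_ext_map Psi_lin Psi_lin _ hF').
by rewrite (tens_ext_comp _ hF Psi_lin); apply: tens_ext_eq.
Qed.

Let scale_bilin (G : lmodType R) (e : G -> R) : scalar e ->
  is_bilinear (fun a b : G => e a *: b).
Proof.
move=> el; split=> [a|b]; first exact: lin_scale (@lin_id _ G).
exact: (lin_scalel (f := e : G -> R^o)).
Qed.

Lemma transport_antipode_linear : linear (hantipode h').
Proof.
move=> a u v; rewrite -[u]ThetaK -[v]ThetaK -Psi_lin -!Psi_antipode -Psi_lin.
by rewrite (hopf_antipode_linear h_hopf).
Qed.

Lemma transport_comulM :
  {morph hcomul h' : x y / hmul h' x y >-> tens_mul (hmul h') x y}.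
Proof.
apply: onto => u; apply: onto => v.
rewrite -Psi_mul !Psi_comul (hopf_comulM h_hopf).
have tm := bilin_tens_mul (hopf_mul_bilinear h_hopf).
have tm' := bilin_tens_mul transport_mul_bilinear.
move: (hcomul h v) => t; move: (hcomul h u).
apply: (tens_lin_ext (lin_comp Pl2 (bilinl t tm))
                     (lin_comp (bilinl (tens_map Psi Psi t) tm') Pl2)) => a b.
move: t; apply: (tens_lin_ext (lin_comp Pl2 (bilinr (a \otimes b) tm))
                     (lin_comp (bilinr (tens_map Psi Psi (a \otimes b)) tm') Pl2)) => c d.
rewrite (tens_mulE (hopf_mul_bilinear h_hopf)) !(tens_mapE Psi_lin Psi_lin).
by rewrite (tens_mulE transport_mul_bilinear) !Psi_mul.
Qed.

Lemma hopf_transport : is_hopf h'.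
Proof.
have hm := hopf_mul_bilinear h_hopf; have hm' := transport_mul_bilinear.
have Sl := hopf_antipode_linear h_hopf; have Sl' := transport_antipode_linear.
split.
- exact: hm'.
- apply: onto => u; apply: onto => v; apply: onto => w.
  by rewrite -!Psi_mul (hopf_mulA h_hopf).
- by apply: onto => u; rewrite -Psi_one -Psi_mul (hopf_1mul h_hopf).
- by apply: onto => u; rewrite -Psi_one -Psi_mul (hopf_mul1 h_hopf).
- exact: transport_comul_linear.
- exact: transport_coassoc.
- exact: transport_counit_linear.
- apply: onto => u.
  apply: (transport_conv (F := fun a b => hcounit h a *: b)).
  + exact/scale_bilin/(hopf_counit_linear h_hopf).
  + exact/scale_bilin/transport_counit_linear.
  + by move=> a b; rewrite Psi_counit (linZ _ Psi_lin).
  + exact: (hopf_counitl h_hopf).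
- apply: onto => u.
  apply: (transport_conv (F := fun a b => hcounit h b *: a)).
  + exact/(bilin_flip (f := fun b a => _ *: a))/scale_bilin/(hopf_counit_linear h_hopf).
  + exact/(bilin_flip (f := fun b a => _ *: a))/scale_bilin/transport_counit_linear.
  + by move=> a b; rewrite Psi_counit (linZ _ Psi_lin).
  + exact: (hopf_counitr h_hopf).
- exact: transport_comulM.
- by rewrite -Psi_one Psi_comul (hopf_comul1 h_hopf) (tens_mapE Psi_lin Psi_lin).
- apply: onto => u; apply: onto => v.
  by rewrite -Psi_mul !Psi_counit (hopf_counitM h_hopf).
- by rewrite -Psi_one Psi_counit (hopf_counit1 h_hopf).
- exact: Sl'.
- apply: onto => u; rewrite Psi_counit -Psi_one -(linZ _ Psi_lin).
  apply: (transport_conv (F := fun a b => hmul h (hantipode h a) b)).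
  + exact: (bilin_comp hm Sl (@lin_id _ H)).
  + exact: (bilin_comp hm' Sl' (@lin_id _ H')).
  + by move=> a b; rewrite -Psi_antipode -Psi_mul.
  + exact: (hopf_antipodel h_hopf).
- apply: onto => u; rewrite Psi_counit -Psi_one -(linZ _ Psi_lin).
  apply: (transport_conv (F := fun a b => hmul h a (hantipode h b))).
  + exact: (bilin_comp hm (@lin_id _ H) Sl).
  + exact: (bilin_comp hm' (@lin_id _ H') Sl').
  + by move=> a b; rewrite -Psi_antipode -Psi_mul.
  + exact: (hopf_antipoder h_hopf).
Qed.

Lemma hopf_transport_iso : is_hopf_iso h' h Theta.
Proof.
have Tl := can_linear; have Tl2 := tens_map_linear Tl Tl.
split.
- exact: Tl.
- by exists Psi.
- by move=> x y; apply: (can_inj PsiK); rewrite Psi_mul !ThetaK.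
- by rewrite -Psi_one PsiK.
- apply: onto => u; rewrite PsiK Psi_comul -[RHS]/(tens_map Theta Theta _).
  move: (hcomul h u); apply: (tens_lin_ext (@lin_id _ _) (lin_comp Tl2 Pl2)) => a b.
  by rewrite (tens_mapE Psi_lin Psi_lin) (tens_mapE Tl Tl) !PsiK.
- by move=> x; rewrite -Psi_counit ThetaK.
- by move=> x; apply: (can_inj PsiK); rewrite Psi_antipode !ThetaK.
Qed.
End HopfTransport.


(** * Uniqueness of the extension of a post-Lie product *)

Section PostLieExtension.
Variables (R : comNzRingType) (V : lmodType R) (br tri : V -> V -> V).
Variables (U : algType R) (i : V -> U) (Delta : U -> tensor U U) (eps : U -> R).
Variable S : U -> U.
Hypothesis E : envelope br i Delta eps S.

Lemma env_filt u : exists n, filt i n u.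
Proof.
move: u; apply: (env_ind E).
- by exists 1; rewrite -(jword_nil i); apply: filt_jword.
- move=> a u v [m hu] [n hv]; exists (maxn m n); apply: SubmodLin.
    by apply: filt_mono hu; apply: leq_maxl.
  by apply: filt_mono hv; apply: leq_maxr.
- by move=> x u [n hu]; exists n.+1; apply: filt_lmul.
Qed.

Lemma env_jword_ext (X : lmodType R) (f g : U -> X) :
  linear f -> linear g -> (forall w, f (jword i w) = g (jword i w)) -> f =1 g.
Proof.
move=> fl gl e u; have [n] := env_filt u.
elim=> [_ [w _ ->]||a x y _ hx _ hy]; first exact: e.
  by rewrite !lin0.
by rewrite fl gl hx hy.
Qed.

Definition proper_parts n : tensor U U -> Prop :=
  submod_gen (fun t => exists w1 w2, [/\ (0 < size w1 < n)%N, (0 < size w2 < n)%N &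
                                         t = jword i w1 \otimes jword i w2]).

(** The coproduct of U(V) is conilpotent, which is what the induction in
    [ext_one] runs on. *)
Lemma comul_jword w : (0 < size w)%N ->
  proper_parts (size w)
    (Delta (jword i w) - (jword i w \otimes 1 + 1 \otimes jword i w)).
Proof.
elim: w => [//|x w ih] _; have llin := leib_linear (lin_mulj (i x)).
case: w ih => [|y w] ih.
  rewrite jword_cons jword_nil (env_comulM E) (env_comul1 E).
  by rewrite (leibE _ _ (lin_mulj _)) mulr1 subrr; exact: Submod0.
set w' := y :: w in ih *; rewrite jword_cons (env_comulM E).
have [t [-> ht]] : exists t,
    Delta (jword i w') = t + (jword i w' \otimes 1 + 1 \otimes jword i w') /\
    proper_parts (size w') t.
  exists (Delta (jword i w') - (jword i w' \otimes 1 + 1 \otimes jword i w')).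
  by rewrite subrK; split; last exact: ih.
rewrite (linD llin t) (linD llin (_ \otimes _)) !(leibE _ _ (lin_mulj _)) mulr1.
have -> : leib ( *%R (i x)) t +
      (i x * jword i w' \otimes 1 + jword i w' \otimes i x +
       (i x \otimes jword i w' + 1 \otimes (i x * jword i w'))) -
      (i x * jword i w' \otimes 1 + 1 \otimes (i x * jword i w')) =
    leib ( *%R (i x)) t + (jword i w' \otimes i x + i x \otimes jword i w').
  move: (leib _ t) (jword i w' \otimes i x) (i x \otimes jword i w').
  move: (i x * jword i w' \otimes 1) (1 \otimes (i x * jword i w')) => *; abel.
have jx : i x = jword i [:: x] by rewrite jword_cons jword_nil mulr1.
apply: submod_genD; last first.
  apply: submod_genD; apply: SubmodGen.
    by exists w', [:: x]; rewrite -jx /= !ltnS leqnn.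
  by exists [:: x], w'; rewrite -jx /= !ltnS leqnn.
move: ht; apply: submod_gen_lin => //.
move=> _ [w1 [w2 [h1 h2 ->]]]; rewrite leibE; last exact: lin_mulj.
have [/andP [h1l h1r] /andP [h2l h2r]] := (h1, h2).
apply: submod_genD; apply: SubmodGen.
- exists (x :: w1), w2; split; rewrite ?jword_cons //=.
  by rewrite h2l (leq_trans h2r).
- exists w1, (x :: w2); split; rewrite ?jword_cons //=.
  by rewrite h1l (leq_trans h1r).
Qed.

Variable T : U -> U -> U.
Hypothesis T_bilin : is_bilinear T.
Hypothesis T_in : forall x y, T (i x) (i y) = i (tri x y).
Hypothesis T_in1 : forall x, T (i x) 1 = 0.
Hypothesis T_1 : forall A, T 1 A = A.
Hypothesis T_inM : forall x A y,
  T (i x * A) (i y) = T (i x) (T A (i y)) - T (T (i x) A) (i y).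
Hypothesis T_mulr : forall A B C,
  T A (B * C) = tens_ext (fun A1 A2 => T A1 B * T A2 C) (Delta A).

Local Notation delta x := (T (i x)).

Let Mb B C : is_bilinear (fun A1 A2 => T A1 B * T A2 C).
Proof. exact: bilin_comp (bilin_mul U) (bilinl B T_bilin) (bilinl C T_bilin). Qed.

Let M B C t := tens_ext (fun A1 A2 => T A1 B * T A2 C) t.

Let Ml B C : linear (M B C).
Proof. exact: tens_ext_linear (Mb B C). Qed.

Let ME B C a b : M B C (a \otimes b) = T a B * T b C.
Proof. exact: tens_extE (Mb B C). Qed.

Let T_M A B C : T A (B * C) = M B C (Delta A).
Proof. exact: T_mulr. Qed.

Lemma ext_delta_linear x : linear (delta x).
Proof. exact: bilinr T_bilin. Qed.

Lemma ext_deltaD x u v : delta x (u * v) = delta x u * v + u * delta x v.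
Proof.
rewrite T_M -[X in Delta X]mulr1 (env_comulM E) (env_comul1 E).
by rewrite (leibE _ _ (lin_mulj _)) (linD (Ml u v)) !ME !mulr1 !T_1.
Qed.

Lemma ext_deltaM x y u : delta x (i y * u) = i (tri x y) * u + i y * delta x u.
Proof. by rewrite ext_deltaD T_in. Qed.

(** As 1 = 1 1, the map f sending [A] to [T A 1] is idempotent for convolution.
    If f vanishes on the words shorter than w, this reads f w = f w + f w. *)
Lemma ext_one A : T A 1 = eps A *: 1.
Proof.
have el : linear (eps : U -> R^o) := env_counit_linear E.
move: A; apply: (env_jword_ext (bilinl 1 T_bilin) (lin_scalel (1 : U) el)) => w /=.
have [n hn] := ubnP (size w); elim: n w hn => [//|n ih] [|x w] hw.
  by rewrite jword_nil T_1 (env_counit1 E) scale1r.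
rewrite {2}jword_cons (env_counitM E) scale0r.
have pos v : (0 < size v < (size w).+1)%N -> T (jword i v) 1 = 0.
  case: v => [//|y v] /= hv; have := ih (y :: v) (leq_trans hv hw).
  by rewrite {2}jword_cons (env_counitM E) scale0r.
set W := jword i (x :: w).
have h0 : M 1 1 (Delta W - (W \otimes 1 + 1 \otimes W)) = 0.
  apply: submod_gen_ker (Ml 1 1) _ (@comul_jword (x :: w) isT).
  by move=> _ [w1 [w2 [h1 h2 ->]]]; rewrite ME !pos // mulr0.
move/eqP: h0; rewrite (linB (Ml 1 1)) (linD (Ml 1 1)) !ME !T_1 mulr1 mul1r.
by rewrite -T_M mul1r opprD addrA subrr sub0r oppr_eq0 => /eqP.
Qed.

(** The recursion that is postulated for [B] in L propagates to products,
    because both sides are compatible with the coproduct of [A]. *)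
Lemma ext_TM x A B : T (i x * A) B = delta x (T A B) - T (delta x A) B.
Proof.
have dl := ext_delta_linear.
have dcomul := @delta_comul _ _ _ _ _ _ _ _ _ E (fun x => T (i x)) dl T_in1 ext_deltaM.
have dcounit := @delta_counit _ _ _ _ _ _ _ _ _ E (fun x => T (i x)) dl T_in1 ext_deltaM.
move: B x A; apply: (env_ind E).
- move=> x A; rewrite !ext_one (env_counitM E) dcounit !scale0r subr0.
  by rewrite (linZ _ (dl x)) T_in1 scaler0.
- move=> a B C hB hC x A; have Tl D : linear (T D) := bilinr D T_bilin.
  rewrite (Tl (i x * A)) (Tl A) (Tl (delta x A)) (Tl (i x)) hB hC.
  by rewrite scalerBr opprD addrACA.
move=> y B ih x A; rewrite !T_M (env_comulM E) dcomul.
move: (Delta A) => t; apply/eqP; rewrite eq_sym subr_eq eq_sym; apply/eqP.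
move: t; have lm := leib_linear (lin_mulj (i x)); have ld := leib_linear (dl x).
apply: (tens_lin_ext (lin_add (lin_comp (Ml (i y) B) lm) (lin_comp (Ml (i y) B) ld))
                     (lin_comp (dl x) (Ml (i y) B))) => a b.
rewrite (leibE _ _ (lin_mulj _)) (leibE _ _ (dl x)) !(linD (Ml (i y) B)) !ME.
rewrite ext_deltaD ih T_inM mulrBl mulrBr.
move: (T (i x) (T a (i y)) * _) (T (T (i x) a) (i y) * _) (T a (i y) * _) (T a (i y) * _).
by move=> *; abel.
Qed.

End PostLieExtension.

(** * Derivations of polynomial algebras *)

Section Derivations.
Variables (R : comNzRingType) (A : comAlgType R).
Implicit Types (D : A -> A) (p q : A).

Definition is_derivation D : Prop :=
  linear D /\ forall p q, D (p * q) = D p * q + p * D q.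

Lemma der1 D : is_derivation D -> D 1 = 0.
Proof.
case=> _ DM; have := DM 1 1; rewrite !mulr1 mul1r => h.
by apply: (@addrI _ (D 1)); rewrite addr0 -h.
Qed.

Lemma der_comm D D' : is_derivation D -> is_derivation D' ->
  is_derivation (fun p => D (D' p) - D' (D p)).
Proof.
move=> [Dl DM] [Dl' DM']; split=> [|p q].
  by apply: lin_sub; [exact: lin_comp Dl Dl'|exact: lin_comp Dl' Dl].
rewrite DM DM' (linD Dl) (linD Dl') !DM !DM' mulrBl mulrBr.
move: (D (D' p) * q) (D' p * D q) (D p * D' q) (p * D (D' q)).
by move: (D' (D p) * q) (p * D' (D q)) => *; abel.
Qed.

Lemma der_scale D c p0 : is_derivation D -> is_derivation (fun p => c *: (p0 * D p)).
Proof.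
move=> [Dl DM]; split=> [|p q]; first exact: lin_scale (lin_mull _ Dl).
by rewrite DM mulrDr scalerDr -scalerAl -scalerAr mulrA mulrCA.
Qed.

Lemma der_scalar D c : is_derivation D -> is_derivation (fun p => c *: D p).
Proof.
move=> [Dl DM]; split=> [|p q]; first exact: lin_scale Dl.
by rewrite DM scalerDr -scalerAl -scalerAr.
Qed.

Lemma der0 : is_derivation (fun _ => 0).
Proof. by split=> [a p q|p q]; rewrite ?scaler0 ?mul0r ?mulr0 addr0. Qed.

Lemma locfin_der (I : choiceType) (F : I -> A -> A) :
  (forall a, is_derivation (F a)) ->
  (forall p, exists X : {fset I}, forall a, a \notin X -> F a p = 0) ->
  is_derivation (fun p => \sum_(a \in [set: I]) F a p).
Proof.
move=> F_der F_fin; split=> [c p q|p q]; have [X hX] := F_fin p; have [Y hY] := F_fin q.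
all: have hXY a : a \notin (X `|` Y)%fset -> F a p = 0 /\ F a q = 0.
all: try by rewrite in_fsetU negb_or => /andP [/hX ? /hY ?].
- rewrite !(fsbigTE (X `|` Y)%fset) => [|a|a|a]; try by case/hXY.
    rewrite scaler_sumr -big_split; apply: eq_bigr => a _; exact: (F_der a).1.
  by case/hXY => ep eq; rewrite (F_der a).1 ep eq scaler0 addr0.
- rewrite !(fsbigTE (X `|` Y)%fset) => [|a|a|a]; try by case/hXY.
    rewrite mulr_suml mulr_sumr -big_split; apply: eq_bigr => a _; exact: (F_der a).2.
  by case/hXY => ep eq; rewrite (F_der a).2 ep eq mul0r mulr0 addr0.
Qed.
End Derivations.

Section PolynomialDerivations.
Variables (R : comNzRingType) (K : choiceType).
Local Notation P := {malg R[{cmonom K}]}.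
Implicit Types (D : P -> P) (p q : P).

Lemma kmon_surj (m : {cmonom K}) : exists w, kmon w = m.
Proof.
have [n hn] := ubnP (mdeg m); elim: n m hn => [//|n ih] m hm.
have [->|m1] := eqVneq m mone; first by exists [::]; rewrite /kmon big_nil.
have [k hk] : exists k, m k != 0%N.
  apply: contrapT => h; case/eqP: m1; apply/eqP/cmP => k; rewrite cm1.
  by apply/eqP; apply: contrapT => /negP hk; apply: h; exists k.
have e : m = mmul (ucm k) (divcm m (ucm k)).
  apply/eqP/cmP => l; rewrite cmM divcmE cmU; have [<-|_] := eqVneq k l.
    by rewrite subnKC // lt0n.
  by rewrite subn0.
have [w hw] : exists w, kmon w = divcm m (ucm k).
  by apply: ih; move: hm; rewrite {1}e mdegM mdegU add1n ltnS.
by exists (k :: w); rewrite kmon_cons hw -e.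
Qed.

Lemma malg_monomM (m m' : {cmonom K}) : << m >> * << m' >> = << mmul m m' >> :> P.
Proof. by rewrite malgM_def fgmulUU mulr1. Qed.

Lemma polyn_ind (Q : P -> Prop) : Q 1 ->
  (forall a p q, Q p -> Q q -> Q (a *: p + q)) ->
  (forall k p, Q p -> Q (<< ucm k >> * p)) -> forall p, Q p.
Proof.
move=> Q1 Ql QM; have Qm m : Q << m >>.
  have [w <-] := kmon_surj m; elim: w => [|k w ih]; first by rewrite /kmon big_nil.
  by rewrite kmon_cons -malg_monomM; apply: QM.
apply: malg_ind => [|a k p hp]; last exact: (Ql a _ p (Qm k) hp).
by have := Ql (-1) 1 1 Q1 Q1; rewrite scaleN1r addNr.
Qed.

Lemma der_ext D D' : is_derivation D -> is_derivation D' ->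
  (forall k, D << ucm k >> = D' << ucm k >>) -> D =1 D'.
Proof.
move=> hD hD' e; apply: polyn_ind; first by rewrite !der1.
  by move=> a p q ep eq; rewrite hD.1 hD'.1 ep eq.
by move=> k p ep; rewrite hD.2 hD'.2 e ep.
Qed.

Lemma locfin (I : choiceType) (F : I -> P -> P) :
  (forall a, is_derivation (F a)) ->
  (forall k, exists A : {fset I}, forall a, a \notin A -> F a << ucm k >> = 0) ->
  forall p, exists A : {fset I}, forall a, a \notin A -> F a p = 0.
Proof.
move=> F_der F_fin; apply: polyn_ind.
- by exists fset0 => a _; rewrite der1.
- move=> c p q [A hA] [B hB]; exists (A `|` B)%fset => a.
  rewrite in_fsetU negb_or => /andP [/hA ep /hB eq].
  by rewrite (F_der a).1 ep eq scaler0 addr0.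
- move=> k p [B hB]; have [A hA] := F_fin k; exists (A `|` B)%fset => a.
  rewrite in_fsetU negb_or => /andP [/hA ek /hB ep].
  by rewrite (F_der a).2 ek ep mul0r mulr0 addr0.
Qed.

End PolynomialDerivations.

Lemma fsum_single (M : zmodType) (I : choiceType) (a0 : I) (F : I -> M) :
  (forall a, a != a0 -> F a = 0) -> \sum_(a \in [set: I]) F a = F a0.
Proof.
move=> h; rewrite (fsbigTE [fset a0]%fset) ?big_seq_fset1 // => a.
by rewrite in_fset1; apply: h.
Qed.

(** * The derivations D^(n) and partial_i *)

Section MultiIndexDerivations.
Variables (R : realType) (d : nat).
Local Notation P := {malg R[{cmonom zvar d}]}.
Local Notation X v := (<< ucm v >> : P).

Let monomZM c (g h : {cmonom zvar d}) :
  (c *: (<< g >> : P)) * << h >> = c *: << mmul g h >>.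
Proof.
transitivity (c *: ((<< g >> : P) * << h >>)); first exact: esym (scalerAl _ _ _).
by rewrite malg_monomM.
Qed.

Let monomMC g (p : P) : << g >> * p = p * << g >>.
Proof. exact: mulrC. Qed.

Lemma divcm_mul (g h : {cmonom zvar d}) v : g v != 0%N ->
  divcm (mmul g h) (ucm v) = mmul (divcm g (ucm v)) h.
Proof.
move=> gv; apply/eqP/cmP => w; rewrite cmM !divcmE cmM cmU.
by have [<-|_] := eqVneq v w; rewrite ?subn0 // addnBAC // lt0n.
Qed.

Lemma zpartial_monomM v (g h : {cmonom zvar d}) :
  zpartial v (<< g >> * << h >> : P) =
  zpartial v (<< g >> : P) * << h >> + << g >> * zpartial v (<< h >> : P) :> P.
Proof.
have zg (g' h' : {cmonom zvar d}) :
    ((g' v)%:R *: (<< divcm g' (ucm v) >> : P)) * << h' >> =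
    (g' v)%:R *: (<< divcm (mmul g' h') (ucm v) >> : P).
  apply: etrans (monomZM _ _ _) _; have [->|gv] := eqVneq (g' v) 0%N.
    exact: etrans (scale0r _) (esym (scale0r _)).
  by rewrite divcm_mul.
have zpE (g' : {cmonom zvar d}) :
    zpartial v (<< g' >> : P) = (g' v)%:R *: (<< divcm g' (ucm v) >> : P).
  exact: linextU.
have e1 : zpartial v (<< g >> : P) * << h >> =
    (g v)%:R *: (<< divcm (mmul g h) (ucm v) >> : P) by rewrite zpE; exact: zg.
have e2 : << g >> * zpartial v (<< h >> : P) =
    (h v)%:R *: (<< divcm (mmul g h) (ucm v) >> : P).
  by rewrite monomMC zpE -(mulmC h g); exact: zg.
rewrite e1 e2 -scalerDl -natrD -cmM -zpE; congr (zpartial v _).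
exact: malg_monomM.
Qed.

Lemma zpartial_der v : is_derivation (zpartial v : P -> P).
Proof.
have zl : linear (zpartial v : P -> P) by exact: linext_linear.
split=> // p q; move: p; apply: malg_lin_ext => [||g].
- exact: (lin_comp zl (bilinl q (bilin_mul P))).
- by apply: lin_add; [exact: lin_mulr zl|exact: lin_mulr (@lin_id _ _)].
move: q; apply: malg_lin_ext => [||h].
- exact: (lin_comp zl (bilinr (<< g >> : P) (bilin_mul P))).
- by apply: lin_add; [exact: lin_mull (@lin_id _ _)|exact: lin_mull zl].
exact: zpartial_monomM.
Qed.

Lemma zpartial_var v w : zpartial v (X w) = (v == w)%:R :> P.
Proof.
rewrite /zpartial linextU cmU eq_sym; have [->|_] := eqVneq v w; last exact: scale0r.
rewrite scale1r; have -> // : divcm (ucm w) (ucm w) = mone :> {cmonom zvar d}.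
by apply/eqP/cmP => u; rewrite divcmE subnn cm1.
Qed.

Let derD0_family k : is_derivation (fun p : P =>
  k.+1%:R *: (zvarP R (inl k.+1 : zvar d) * zpartial (inl k) p)).
Proof. exact: der_scale (zpartial_der _). Qed.

Let derD0_family_var k v :
  k.+1%:R *: (zvarP R (inl k.+1 : zvar d) * zpartial (inl k) (X v)) =
  if v == inl k then k.+1%:R *: X (inl k.+1) else 0 :> P.
Proof.
rewrite zpartial_var eq_sym; case: eqP => _; first by rewrite mulr1.
by rewrite mulr0 scaler0.
Qed.

Lemma derDE0 (p : P) : derD 0 p =
  \sum_(k \in [set: nat])
    k.+1%:R *: (zvarP R (inl k.+1 : zvar d) * zpartial (inl k) p) :> P.
Proof. by rewrite /derD insubF ?eqxx. Qed.

Lemma derDE (n : vec d) (hn : n != 0) (p : P) : derD n p = zpartial (inr (Sub n hn)) p.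
Proof. by rewrite /derD insubT. Qed.

Lemma derD_der (n : vec d) : is_derivation (derD n : P -> P).
Proof.
have [->|hn] := eqVneq n 0; last first.
  rewrite (_ : derD n = zpartial (inr (Sub n hn))); first exact: zpartial_der.
  by apply: funext => p; exact: derDE.
rewrite (_ : derD 0 = fun p : P => \sum_(k \in [set: nat])
    k.+1%:R *: (zvarP R (inl k.+1 : zvar d) * zpartial (inl k) p)); last first.
  by apply: funext => p; exact: derDE0.
apply: (locfin_der derD0_family); apply: (locfin derD0_family) => v.
exists (if v is inl k then [fset k]%fset else fset0) => k hk.
rewrite derD0_family_var; case: eqP hk => // ->; by rewrite in_fset1 eqxx.
Qed.

Lemma derD0_inl k : derD 0 (X (inl k)) = k.+1%:R *: X (inl k.+1) :> P.
Proof.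
rewrite derDE0 (fsum_single (a0 := k)) => [|l lk]; rewrite derD0_family_var ?eqxx //.
by rewrite (_ : (_ == _) = false) //; apply: contraNF lk => /eqP [->].
Qed.

Lemma derD0_inr m : derD 0 (X (inr m)) = 0 :> P.
Proof.
rewrite derDE0 (fsum_single (a0 := 0%N)) => [|l lk]; exact: derD0_family_var.
Qed.

Lemma derDn_inl n k : n != 0 -> derD n (X (inl k)) = 0 :> P.
Proof. by move=> hn; rewrite (derDE hn) zpartial_var. Qed.

Lemma derDn_inr (n : vec d) m : derD n (X (inr m)) = (n == val m)%:R :> P.
Proof.
have [->|hn] := eqVneq n 0.
  by rewrite derD0_inr eq_sym (negPf (valP m)).
rewrite (derDE hn) zpartial_var.
by rewrite -[n in RHS]/(val (Sub n hn : {n : vec d | n != 0})) val_eqE.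
Qed.

Definition vshift (n : vec d) (i : 'I_d.+1) : {n : vec d | n != 0} :=
  Sub (n + vunit i) (vaddunit_neq0 n i).

Let derpart_family (i : 'I_d.+1) (n : vec d) : is_derivation (fun p : P =>
  (n i).+1%:R *: (zvarP R (inr (vshift n i)) * derD n p)).
Proof. exact: der_scale (derD_der _). Qed.

Lemma derpart_inl i k : derpart i (X (inl k)) =
  k.+1%:R *: (X (inr (vshift 0 i)) * X (inl k.+1)) :> P.
Proof.
rewrite /derpart (fsum_single (a0 := 0)) => [|n hn].
  by rewrite derD0_inl ffunE scale1r scalerAr.
rewrite (derDn_inl k hn) mulr0; exact: scaler0.
Qed.

Lemma derpart_inr i m : derpart i (X (inr m)) =
  (val m i).+1%:R *: X (inr (vshift (val m) i)) :> P.
Proof.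
rewrite /derpart (fsum_single (a0 := val m)) => [|n hn]; rewrite derDn_inr.
  by rewrite eqxx mulr1.
rewrite (negPf hn) mulr0; exact: scaler0.
Qed.

Lemma derpart_der i : is_derivation (derpart i : P -> P).
Proof.
have hF := derpart_family i; apply: (locfin_der hF); apply: (locfin hF) => -[k|m].
  exists [fset 0]%fset => n; rewrite in_fset1 => hn.
  rewrite (derDn_inl k hn) mulr0; exact: scaler0.
exists [fset val m]%fset => n; rewrite in_fset1 => hn.
rewrite derDn_inr (negPf hn) mulr0; exact: scaler0.
Qed.
End MultiIndexDerivations.

Lemma der_nat (R : comNzRingType) (A : comAlgType R) (D : A -> A) n :
  is_derivation D -> D n%:R = 0.
Proof.
move=> hD; elim: n => [|n ih]; first exact: lin0 hD.1.
by rewrite -natr1 (linD hD.1) ih der1 // addr0.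
Qed.

(** The commutators only depend on the values of the derivations on the
    variables: [A] stands for the polynomial algebra and [X] for its variables. *)
Section Commutators.
Variables (R : comNzRingType) (d : nat) (A : comAlgType R) (X : zvar d -> A).
Hypothesis X_ext : forall D D' : A -> A, is_derivation D -> is_derivation D' ->
  (forall v, D (X v) = D' (X v)) -> D =1 D'.
Variables (derD : vec d -> A -> A) (derpart : 'I_d.+1 -> A -> A).
Hypothesis derD_der : forall n, is_derivation (derD n).
Hypothesis derpart_der : forall i, is_derivation (derpart i).
Hypothesis derD0_inl : forall k, derD 0 (X (inl k)) = k.+1%:R *: X (inl k.+1).
Hypothesis derDn_inl : forall (n : vec d) k, n != 0 -> derD n (X (inl k)) = 0.
Hypothesis derDn_inr : forall n m, derD n (X (inr m)) = (n == val m)%:R.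
Hypothesis derpart_inl : forall i k,
  derpart i (X (inl k)) = k.+1%:R *: (X (inr (vshift 0 i)) * X (inl k.+1)).
Hypothesis derpart_inr : forall i m,
  derpart i (X (inr m)) = (val m i).+1%:R *: X (inr (vshift (val m) i)).
Implicit Types (n m : vec d) (i j : 'I_d.+1) (p : A).

Let derlin n : linear (derD n) := (derD_der n).1.
Let derplin i : linear (derpart i) := (derpart_der i).1.

Lemma der0_inr a : derD 0 (X (inr a)) = 0.
Proof. by rewrite derDn_inr eq_sym (negPf (valP a)). Qed.

Lemma derD_comm m n p : derD m (derD n p) = derD n (derD m p).
Proof.
suff key a b : a != 0 -> forall q : A, derD a (derD b q) - derD b (derD a q) = 0.
  have [m0|/key h] := eqVneq m 0; last by apply/eqP; rewrite -subr_eq0 h.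
  have [n0|/key h] := eqVneq n 0; first by rewrite m0 n0.
  by apply/esym/eqP; rewrite -subr_eq0 h.
move=> ha; apply: (X_ext (der_comm (derD_der a) (derD_der b)) (der0 _)) => -[k|v].
  rewrite (derDn_inl k ha) (lin0 (derlin b)) subr0.
  have [->|hb] := eqVneq b 0; last by rewrite (derDn_inl k hb) (lin0 (derlin a)).
  rewrite derD0_inl (linZ _ (derlin a)) (derDn_inl _ ha); exact: scaler0.
by rewrite !derDn_inr !der_nat ?subr0 //; exact: derD_der.
Qed.

Lemma vsubK n i : (0 < n i)%N -> vsub n (vunit i) + vunit i = n.
Proof.
move=> hn; apply/ffunP => j; rewrite !ffunE; rewrite [LHS]/(GRing.add _ _) /=.
by have [->|_] := eqVneq j i; rewrite ?subnK // subn0 addn0.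
Qed.

Lemma vaddK n i : vsub (n + vunit i) (vunit i) = n.
Proof. by apply/ffunP => j; rewrite !ffunE; exact: addnK. Qed.

Lemma vadd_i n i : (n + vunit i) i = (n i).+1.
Proof. by rewrite !ffunE eqxx; exact: addn1. Qed.

Lemma vshiftE n i : val (vshift n i) = n + vunit i.
Proof. by []. Qed.

Let scale_mull c c' (x y : A) :
  c *: (x * (c' *: y)) = c *: (c' *: (x * y)).
Proof. by rewrite -(scalerAr c'). Qed.

Lemma derD_derpart n i p : derD n (derpart i p) - derpart i (derD n p) =
  (n i)%:R *: derD (vsub n (vunit i)) p.
Proof.
move: p; apply: (X_ext (der_comm (derD_der n) (derpart_der i))
                         (der_scalar _ (derD_der _))) => -[k|a].
  rewrite derpart_inl (linZ _ (derlin n)) (derD_der n).2.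
  have [n0|hn] := eqVneq n 0.
    rewrite n0 der0_inr mul0r add0r !derD0_inl (linZ _ (derplin i)) derpart_inl.
    have -> : ((0%R : vec d) i)%:R = 0 :> R by rewrite ffunE.
    rewrite [RHS]scale0r scale_mull; exact: subrr.
  rewrite (derDn_inl k hn) (lin0 (derplin i)) subr0 (derDn_inl _ hn) mulr0 addr0.
  rewrite derDn_inr vshiftE add0r; have [ne|nne] := eqVneq n (vunit i).
    have -> : vsub n (vunit i) = 0 by rewrite ne -{1}[vunit i]add0r vaddK.
    have -> : n i = 1%N by rewrite ne ffunE eqxx.
    by rewrite derD0_inl mul1r; exact: esym (scale1r _).
  rewrite mul0r [LHS]scaler0; have [->|ni] := posnP (n i); first exact: esym (scale0r _).
  rewrite (derDn_inl k); first exact: esym (scaler0 _ _).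
  by apply: contra nne => /eqP h; rewrite -(vsubK ni) h add0r.
rewrite !derDn_inr (der_nat _ (derpart_der i)) subr0 derpart_inr (linZ _ (derlin n)).
rewrite derDn_inr vshiftE; have [->|nne] := eqVneq n (val a + vunit i).
  by rewrite vaddK eqxx vadd_i.
rewrite [LHS]scaler0; have [->|ni] := posnP (n i); first exact: esym (scale0r _).
rewrite (_ : (_ == _) = false); first exact: esym (scaler0 _ _).
by apply: contraNF nne => /eqP <-; rewrite vsubK.
Qed.

Lemma vadd2_j n i j : (n + vunit i) j = (n j + (j == i))%N.
Proof. by rewrite !ffunE. Qed.

Lemma vshift2 n i j : vshift (val (vshift n i)) j = vshift (val (vshift n j)) i.
Proof. by apply: val_inj; rewrite !vshiftE addrAC. Qed.

Let mul_swap c c' (x y u w : A) :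
  c *: (c' *: u * y + x * w) = c *: (c' *: (u * y)) + c *: (x * w).
Proof. by rewrite scalerDr -(scalerAl c'). Qed.

Let mul_swap2 c c' (x y z : A) :
  c *: (x * (c' *: (y * z))) = c *: (y * (c' *: (x * z))).
Proof. by rewrite -!(scalerAr c') mulrCA. Qed.

Lemma derpart_comm i j p : derpart i (derpart j p) = derpart j (derpart i p).
Proof.
apply/eqP; rewrite -subr_eq0; apply/eqP.
move: p; apply: (X_ext (der_comm (derpart_der i) (derpart_der j)) (der0 _)) => -[k|a].
  rewrite !derpart_inl !(linZ _ (derplin _)) !(derpart_der _).2 !derpart_inr !derpart_inl.
  rewrite !mul_swap vshift2 (mul_swap2 _ _ (X (inr (vshift 0 j)))).
  rewrite !vshiftE !vadd2_j eq_sym.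
  have -> : (0%R : vec d) i = 0%N by rewrite ffunE.
  have -> : (0%R : vec d) j = 0%N by rewrite ffunE.
  exact: subrr.
rewrite !derpart_inr !(linZ _ (derplin _)) !derpart_inr vshift2 !vshiftE !vadd2_j.
rewrite !scalerA -!natrM eq_sym.
have -> : ((val a j).+1 * (val a i + (j == i)).+1 =
           (val a i).+1 * (val a j + (j == i)).+1)%N.
  by have [->|_] := eqVneq j i; rewrite ?addn0 ?addn1 // mulnC.
exact: subrr.
Qed.
End Commutators.

(** * The post-Lie identities of L *)

Section Trilinear.
Variables (R : comNzRingType) (V : lmodType R).

Definition trilinear (f : V -> V -> V -> V) : Prop :=
  [/\ forall y z, linear (fun x => f x y z), forall x z, linear (fun y => f x y z) &
      forall x y, linear (f x y)].

Lemma trilin_r (f g : V -> V -> V) : is_bilinear f -> is_bilinear g ->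
  trilinear (fun x y z => f x (g y z)).
Proof.
move=> hf hg; split=> [y z|x z|x y].
- exact: bilinl hf.
- exact: lin_comp (bilinr x hf) (bilinl z hg).
- exact: lin_comp (bilinr x hf) (bilinr y hg).
Qed.

Lemma trilin_l (f g : V -> V -> V) : is_bilinear f -> is_bilinear g ->
  trilinear (fun x y z => f (g x y) z).
Proof.
move=> hf hg; split=> [y z|x z|x y].
- exact: lin_comp (bilinl z hf) (bilinl y hg).
- exact: lin_comp (bilinl z hf) (bilinr x hg).
- exact: bilinr hf.
Qed.

Lemma trilin_swap f : trilinear f -> trilinear (fun x y z => f y x z).
Proof. by case=> h1 h2 h3; split. Qed.

Lemma trilin_add f g : trilinear f -> trilinear g ->
  trilinear (fun x y z => f x y z + g x y z).
Proof. by case=> h1 h2 h3 [k1 k2 k3]; split=> *; exact: lin_add. Qed.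

Lemma trilin_sub f g : trilinear f -> trilinear g ->
  trilinear (fun x y z => f x y z - g x y z).
Proof. by case=> h1 h2 h3 [k1 k2 k3]; split=> *; exact: lin_sub. Qed.
End Trilinear.

Section PostLieIdentities.
Variables (R : comNzRingType) (d : nat) (A : comAlgType R) (V : lmodType R).
Variables (derD : vec d -> A -> A) (derpart : 'I_d.+1 -> A -> A).
Hypothesis derD_der : forall n, is_derivation (derD n).
Hypothesis derpart_der : forall i, is_derivation (derpart i).
Hypothesis derD_comm : forall m n p, derD m (derD n p) = derD n (derD m p).
Hypothesis derD_derpart : forall n i p,
  derD n (derpart i p) - derpart i (derD n p) = (n i)%:R *: derD (vsub n (vunit i)) p.
Hypothesis derpart_comm : forall i j p, derpart i (derpart j p) = derpart j (derpart i p).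

(* [field n p] stands for p D^{(n)} and [good] for the polynomials p allowed in
   L. The brackets enter only through their values on such elements, where
   coefficients have disappeared and identities of L become identities between
   derivations. *)
Variables (good : A -> Prop) (field : vec d -> A -> V) (partial : 'I_d.+1 -> V).
Hypothesis good_derD : forall p q n, good p -> good q -> good (p * derD n q).
Hypothesis good_derpart : forall p i, good p -> good (derpart i p).
Hypothesis field_linear : forall n, linear (field n).

Variant generator : V -> Prop :=
| GenField n p of good p : generator (field n p)
| GenPartial i : generator (partial i).

Hypothesis V_ext : forall (W : lmodType R) (f g : V -> W), linear f -> linear g ->
  (forall x, generator x -> f x = g x) -> f =1 g.

Variables lie0 tri : V -> V -> V.
Hypothesis lie0_bilin : is_bilinear lie0.
Hypothesis tri_bilin : is_bilinear tri.
Hypothesis tri_field : forall n m p q, good p -> good q ->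
  tri (field n p) (field m q) = field m (p * derD n q).
Hypothesis tri_partial_field : forall i m q, good q ->
  tri (partial i) (field m q) = field m (derpart i q).
Hypothesis tri_partial : forall x i, tri x (partial i) = 0.
Hypothesis lie0_field : forall n m p q, good p -> good q ->
  lie0 (field n p) (field m q) = 0.
Hypothesis lie0_field_partial : forall n p i, good p ->
  lie0 (field n p) (partial i) = (n i)%:R *: field (vsub n (vunit i)) p.
Hypothesis lie0_partial_field : forall n p i, good p ->
  lie0 (partial i) (field n p) = - ((n i)%:R *: field (vsub n (vunit i)) p).
Hypothesis lie0_partial : forall i j, lie0 (partial i) (partial j) = 0.

Lemma trilin_ext (f g : V -> V -> V -> V) : trilinear f -> trilinear g ->
  (forall x y z, generator x -> generator y -> generator z -> f x y z = g x y z) ->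
  forall x y z, f x y z = g x y z.
Proof.
move=> [f1 f2 f3] [g1 g2 g3] e x y z; move: x.
apply: (V_ext (f1 y z) (g1 y z)) => x hx; move: y.
apply: (V_ext (f2 x z) (g2 x z)) => y hy; move: z.
by apply: (V_ext (f3 x y) (g3 x y)) => z hz; apply: e.
Qed.

Let tri_r0 x : tri x 0 = 0. Proof. exact: lin0 (bilinr x tri_bilin). Qed.
Let tri_l0 x : tri 0 x = 0. Proof. exact: lin0 (bilinl x tri_bilin). Qed.
Let lie_r0 x : lie0 x 0 = 0. Proof. exact: lin0 (bilinr x lie0_bilin). Qed.
Let lie_l0 x : lie0 0 x = 0. Proof. exact: lin0 (bilinl x lie0_bilin). Qed.
Let tri_rN x y : tri x (- y) = - tri x y. Proof. exact: linN (bilinr x tri_bilin) _. Qed.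
Let tri_rZ c x y : tri x (c *: y) = c *: tri x y.
Proof. exact: linZ (bilinr x tri_bilin) _. Qed.
Let tri_lN x y : tri (- x) y = - tri x y. Proof. exact: linN (bilinl y tri_bilin) _. Qed.
Let tri_lZ c x y : tri (c *: x) y = c *: tri x y.
Proof. exact: linZ (bilinl y tri_bilin) _. Qed.

(* [tri x] only touches the coefficient p of p D^{(n)}, whereas [lie0] only
   touches n: this is why [tri x] is a derivation of [lie0]. *)
Lemma tri_generator x : generator x ->
  exists2 op : A -> A, forall p, good p -> good (op p) &
    forall n p, good p -> tri x (field n p) = field n (op p).
Proof.
case=> [n p hp|i].
  by exists (fun q => p * derD n q) => [q|m q] hq; [exact: good_derD|exact: tri_field].
by exists (derpart i) => [q|m q] hq; [exact: good_derpart|exact: tri_partial_field].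
Qed.

Lemma tri_lie0 x y z : tri x (lie0 y z) = lie0 (tri x y) z + lie0 y (tri x z).
Proof.
move: x y z; apply: trilin_ext => [||x y z gx].
- exact: trilin_r.
- apply: trilin_add; first exact: trilin_l.
  exact: (trilin_swap (trilin_r lie0_bilin tri_bilin)).
have [op gop hop] := tri_generator gx.
case=> [n p hp|i] [m q hq|j].
- by rewrite lie0_field // !hop // !lie0_field ?tri_r0 ?addr0 //; exact: gop.
- rewrite lie0_field_partial // tri_rZ !hop // lie0_field_partial; last exact: gop.
  by rewrite tri_partial lie_r0 addr0.
- rewrite lie0_partial_field // tri_rN tri_rZ !hop // tri_partial lie_l0 add0r.
  by rewrite lie0_partial_field //; exact: gop.
- by rewrite lie0_partial !tri_partial lie_l0 lie_r0 tri_r0 addr0.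
Qed.

(** On generators this is the commutation of the D^{(n)} with one another, of
    the partial_i with one another, and [derD_derpart]. *)
Lemma lie0_tri x y z : tri (lie0 x y) z =
  tri x (tri y z) - tri (tri x y) z - (tri y (tri x z) - tri (tri y x) z).
Proof.
have hr := trilin_r tri_bilin tri_bilin; have hl := trilin_l tri_bilin tri_bilin.
move: x y z; apply: trilin_ext => [||x y z gx gy gz].
- exact: trilin_l.
- have h := trilin_sub hr hl; exact: trilin_sub h (trilin_swap h).
case: gz => [l q hq|k]; last by rewrite !tri_partial !tri_r0 !subr0.
have gD n p : good p -> good (p * derD n q) by move=> hp; exact: good_derD.
have key (n : vec d) p i : good p -> (n i)%:R *: field l (p * derD (vsub n (vunit i)) q) =
    field l (p * derD n (derpart i q)) -
    (field l (derpart i (p * derD n q)) - field l (derpart i p * derD n q)).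
  move=> hp; rewrite -!(linB (field_linear l)) -(linZ _ (field_linear l)).
  rewrite (derpart_der i).2.
  by rewrite scalerAr -derD_derpart mulrBr addrAC subrr add0r.
case: gx gy => [n p hp|i] [m r hr'|j].
- rewrite lie0_field // tri_l0 ?tri_field ?tri_partial_field //.
  all: try exact: gD; try exact: good_derD.
  rewrite !(derD_der _).2 (derD_comm m n) !mulrDr !(linD (field_linear l)).
  rewrite !mulrA (mulrC r p).
  abel.
- rewrite lie0_field_partial // tri_lZ tri_partial tri_l0 subr0.
  rewrite !tri_partial_field ?tri_field ?tri_partial_field //.
  all: try exact: gD; try exact: good_derpart.
  exact: key.
- rewrite lie0_partial_field // tri_lN tri_lZ tri_partial tri_l0 subr0.
  rewrite !tri_partial_field ?tri_field ?tri_partial_field //.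
  all: try exact: gD; try exact: good_derpart.
  by rewrite key // opprB.
- rewrite lie0_partial !tri_partial !tri_l0 !subr0.
  rewrite !tri_partial_field //; try exact: good_derpart.
  by rewrite derpart_comm subrr.
Qed.

(** [tri0] makes L with the zero bracket a post-Lie (that is, pre-Lie) algebra
    whose associated Lie bracket is [lie0]. *)
Variable tri0 : V -> V -> V.
Hypothesis tri0_bilin : is_bilinear tri0.
Hypothesis tri0_field : forall n p x, good p -> tri0 (field n p) x = 0.
Hypothesis tri0_partial : forall i j, tri0 (partial i) (partial j) = 0.
Hypothesis tri0_partial_field : forall i n p, good p ->
  tri0 (partial i) (field n p) = - ((n i)%:R *: field (vsub n (vunit i)) p).

Lemma lie0_preLie x y : lie0 x y = 0 + tri0 x y - tri0 y x.
Proof.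
rewrite add0r; move: x; apply: V_ext => [||x gx]; first exact: bilinl.
  by apply: lin_sub; [exact: bilinl tri0_bilin|exact: bilinr tri0_bilin].
move: y; apply: V_ext => [||y gy]; first exact: bilinr.
  by apply: lin_sub; [exact: bilinr tri0_bilin|exact: bilinl tri0_bilin].
case: gx gy => [n p hp|i] [m q hq|j].
- by rewrite lie0_field // !tri0_field // subrr.
- by rewrite lie0_field_partial // tri0_field // tri0_partial_field // opprK add0r.
- by rewrite lie0_partial_field // tri0_field // tri0_partial_field // subr0.
- by rewrite lie0_partial !tri0_partial subrr.
Qed.

Lemma vsub_comm (n : vec d) i j :
  vsub (vsub n (vunit i)) (vunit j) = vsub (vsub n (vunit j)) (vunit i).
Proof. by apply/ffunP => k; rewrite !ffunE subnAC. Qed.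

Lemma vsub_i (n : vec d) i j : i != j -> vsub n (vunit i) j = n j.
Proof. by move=> h; rewrite !ffunE eq_sym (negPf h) subn0. Qed.

Lemma tri0_assoc x y z : tri0 0 z =
  tri0 x (tri0 y z) - tri0 (tri0 x y) z - (tri0 y (tri0 x z) - tri0 (tri0 y x) z).
Proof.
have hr := trilin_r tri0_bilin tri0_bilin; have hl := trilin_l tri0_bilin tri0_bilin.
have t0 v : tri0 0 v = 0 := lin0 (bilinl v tri0_bilin).
have r0 v : tri0 v 0 = 0 := lin0 (bilinr v tri0_bilin).
have lz c u v : tri0 (c *: u) v = c *: tri0 u v := linZ _ (bilinl v tri0_bilin) _.
have ln u v : tri0 (- u) v = - tri0 u v := linN (bilinl v tri0_bilin) _.
have rz c u v : tri0 v (c *: u) = c *: tri0 v u := linZ _ (bilinr v tri0_bilin) _.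
have rn u v : tri0 v (- u) = - tri0 v u := linN (bilinr v tri0_bilin) _.
rewrite t0; apply/esym; move: x y z; apply: (trilin_ext (g := fun _ _ _ => 0)).
- have h := trilin_sub hr hl; exact: trilin_sub h (trilin_swap h).
- by split=> * a u v; rewrite scaler0 addr0.
move=> x y z [n p hp|i] [m q hq|j] gz.
- by rewrite !tri0_field // !t0 !subrr.
- rewrite !(tri0_field n) // t0 tri0_partial_field // ln lz tri0_field // r0.
  by rewrite scaler0 oppr0 !subr0 addr0.
- rewrite !(tri0_field m) // t0 tri0_partial_field // ln lz tri0_field // r0.
  by rewrite scaler0 oppr0 !subr0 addr0 subr0.
rewrite !tri0_partial !t0 !subr0; case: gz => [m q hq|k]; last first.
  by rewrite !tri0_partial !r0 subrr.
rewrite !tri0_partial_field // !rn !rz !tri0_partial_field // !scalerN !opprK.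
have [->|ij] := eqVneq i j; first by rewrite subrr.
by rewrite !vsub_i // 1?eq_sym // vsub_comm !scalerA mulrC subrr.
Qed.
End PostLieIdentities.

(** * Degrees, and the elements p D^(n) of L *)

Section Homogeneity.
Variables (R : realType) (d : nat).
Local Notation P := {malg R[{cmonom zvar d}]}.
Local Notation X v := (<< ucm v >> : P).

Definition vdeg (v : zvar d) : int := if v is inl k then k%:Z else - 1.

Lemma hdegEw (g : {cmonom zvar d}) (A : {fset zvar d}) : (finsupp g `<=` A)%fset ->
  hdeg g = \sum_(v <- A) vdeg v * (g v)%:Z.
Proof.
move=> gA; apply: (big_fset_incl _ gA) => v _; rewrite -cmE_eq0 => /eqP ->.
exact: mulr0.
Qed.

Lemma hdegM (g h : {cmonom zvar d}) : hdeg (mmul g h) = hdeg g + hdeg h.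
Proof.
rewrite (hdegEw (fsubset_refl _)) mdomD (hdegEw (fsubsetUl _ (finsupp h))).
rewrite (hdegEw (fsubsetUr (finsupp g) _)) -big_split; apply: eq_bigr => v _.
by rewrite cmM PoszD mulrDr.
Qed.

Lemma hdeg1 : hdeg (mone : {cmonom zvar d}) = 0.
Proof. by rewrite /hdeg mdom1 big_seq_fset0. Qed.

Lemma hdegU (v : zvar d) : hdeg (ucm v) = vdeg v.
Proof. by rewrite /hdeg mdomU big_seq_fset1 cmUU mulr1. Qed.

Definition homog (k : int) : P -> Prop :=
  submod_gen (fun p => exists2 g, hdeg g = k & p = << g >>).

Lemma homog_monom (g : {cmonom zvar d}) : homog (hdeg g) << g >>.
Proof. by apply: SubmodGen; exists g. Qed.

Lemma homog_var v : homog (vdeg v) (X v).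
Proof. rewrite -hdegU; exact: homog_monom. Qed.

Lemma homogM k l p q : homog k p -> homog l q -> homog (k + l) (p * q).
Proof.
move=> hp; apply: (submod_gen_lin (f := *%R p) (bilinr p (bilin_mul P))) => _ [h eh ->].
move: hp; apply: (submod_gen_lin (f := fun p => p * << h >>) (bilinl _ (bilin_mul P))).
move=> _ [g eg ->]; apply: SubmodGen; exists (mmul g h); last exact: malg_monomM.
by rewrite hdegM eg eh.
Qed.

Lemma der_homog (D : P -> P) c g : is_derivation D ->
  (forall v, homog (vdeg v + c) (D (X v))) -> homog (hdeg g + c) (D << g >>).
Proof.
move=> hD hv; have [w <-] := kmon_surj g; elim: w => [|k w ih].
  have -> : << kmon [::] >> = 1 :> P by rewrite /kmon big_nil.
  rewrite der1 //; exact: Submod0.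
rewrite kmon_cons -malg_monomM hD.2 hdegM hdegU; apply: submod_genD.
  by rewrite addrAC; apply: homogM (hv k) (homog_monom _).
by rewrite -addrA; apply: homogM (homog_var k) ih.
Qed.

(** The polynomials p for which p D^{(n)} lies in tilde L; D^{(n)} raises [hdeg]
    by 1 and partial_i preserves it, so both preserve this space. *)
Definition nonneg : P -> Prop :=
  submod_gen (fun p => exists2 g, 0 <= hdeg g & p = << g >>).

Lemma homog_nonneg k p : 0 <= k -> homog k p -> nonneg p.
Proof.
move=> hk; apply: submod_gen_mono => q [g eg ->]; exists g => //.
by rewrite eg.
Qed.

Lemma nonnegM p q : nonneg p -> nonneg q -> nonneg (p * q).
Proof.
move=> hp; apply: (submod_gen_lin (f := *%R p) (bilinr p (bilin_mul P))) => _ [h eh ->].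
move: hp; apply: (submod_gen_lin (f := fun p => p * << h >>) (bilinl _ (bilin_mul P))).
move=> _ [g eg ->]; apply: SubmodGen; exists (mmul g h); last exact: malg_monomM.
by rewrite hdegM addr_ge0.
Qed.

Lemma der_nonneg (D : P -> P) c p : is_derivation D -> 0 <= c ->
  (forall v, homog (vdeg v + c) (D (X v))) -> nonneg p -> nonneg (D p).
Proof.
move=> hD hc hv; apply: (submod_gen_lin hD.1) => _ [g hg ->].
exact: homog_nonneg (addr_ge0 hg hc) (der_homog _ hD hv).
Qed.

Lemma homog_nat b : homog 0 (b%:R : P).
Proof.
rewrite -hdeg1 -scaler_nat; exact: submod_genZ (homog_monom _).
Qed.

Lemma derD_nonneg (n : vec d) p : nonneg p -> nonneg (derD n p).
Proof.
apply: (der_nonneg (c := 1) (derD_der R n)) => // -[k|m].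
  have [->|hn] := eqVneq n 0; last by rewrite derDn_inl //; exact: Submod0.
  have -> : vdeg (inl k) + 1 = vdeg (inl k.+1) by rewrite /= -addn1 PoszD.
  rewrite derD0_inl; apply: submod_genZ; exact: homog_var.
rewrite derDn_inr; exact: homog_nat.
Qed.

Lemma derpart_nonneg i p : nonneg p -> nonneg (derpart i p).
Proof.
apply: (der_nonneg (c := 0) (derpart_der R i)) => // -[k|m]; rewrite addr0.
  rewrite derpart_inl; apply: submod_genZ.
  have -> : vdeg (inl k) = vdeg (inr (vshift 0 i)) + vdeg (inl k.+1).
    by rewrite /= -addn1 PoszD addrCA addNr addr0.
  exact: homogM (homog_var _) (homog_var _).
rewrite derpart_inr; apply: submod_genZ.
exact: (homog_var (inr (vshift (val m) i))).
Qed.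
End Homogeneity.

Section Field.
Variables (R : realType) (d : nat).
Local Notation P := {malg R[{cmonom zvar d}]}.
Local Notation V := (L R d).

(** This is p D^{(n)} for [p] in [nonneg]; the other monomials are dropped, so
    that the map is linear in [p] and gives [dsum] by definition. *)
Definition field (n : vec d) (p : P) : V :=
  \sum_(b \in [set: {g : mindex d | 0 <= hdeg g}]) p@_(val b) *: zD R b n.

Lemma field_fin (p : P) : exists A : {fset {g : mindex d | 0 <= hdeg g}},
  forall b, b \notin A -> p@_(val b) = 0.
Proof.
exists [fset b in (pmap insub (msupp p) : seq {g : mindex d | 0 <= hdeg g})]%fset => b.
rewrite in_fset /= mem_pmap_sub => hb; exact: mcoeff_outdom.
Qed.

Lemma field_linear n : linear (field n).
Proof.
move=> c p q; have [A hA] := field_fin p; have [B hB] := field_fin q.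
have hAB a : a \notin (A `|` B)%fset -> p@_(val a) = 0 /\ q@_(val a) = 0.
  by rewrite in_fsetU negb_or => /andP [/hA ? /hB ?].
have fE (r : P) : (forall a, a \notin (A `|` B)%fset -> r@_(val a) = 0) ->
    field n r = \sum_(a <- (A `|` B)%fset) r@_(val a) *: zD R a n.
  by move=> hr; apply: fsbigTE => a /hr ->; rewrite scale0r.
rewrite !fE => [|a /hAB []|a /hAB []|a /hAB [ep eq]] //.
  rewrite scaler_sumr -big_split; apply: eq_bigr => a _.
  by rewrite mcoeffD mcoeffZ scalerDl scalerA.
by rewrite mcoeffD mcoeffZ ep eq mulr0 addr0.
Qed.

Lemma field_monom n b : field n << val b >> = zD R b n.
Proof.
rewrite /field (fsum_single (a0 := b)) => [|a ab]; rewrite mcoeffU.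
  by rewrite eqxx scale1r.
by rewrite val_eqE eq_sym (negPf ab) scale0r.
Qed.

Local Notation partial i := (<< inr i >> : V).

Lemma nonneg_val (b : {g : mindex d | 0 <= hdeg g}) : nonneg (<< val b >> : P).
Proof. by apply: SubmodGen; exists (val b) => //; exact: (valP b). Qed.

Lemma nonneg_lin_ext (W : lmodType R) (f g : P -> W) p : linear f -> linear g ->
  (forall b : {g : mindex d | 0 <= hdeg g}, f << val b >> = g << val b >>) ->
  nonneg p -> f p = g p.
Proof.
move=> fl gl e hp; apply/eqP; rewrite -subr_eq0; apply/eqP.
apply: (submod_gen_ker (lin_sub fl gl) _ hp) => _ [h hh ->].
by rewrite (e (Sub h hh)) subrr.
Qed.

Lemma L_ext (W : lmodType R) (f g : V -> W) : linear f -> linear g ->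
  (forall x, generator (@nonneg R d) field (fun i => partial i) x -> f x = g x) -> f =1 g.
Proof.
move=> fl gl e; apply: malg_lin_ext => // -[[b n]|i]; last first.
  exact/e/(GenPartial _ _ (fun i => partial i) i).
have -> : << inl (b, n) >> = field n << val b >> :> V by rewrite field_monom.
exact/e/(GenField field (fun i => partial i) n (nonneg_val b)).
Qed.

Lemma lie0_bilinear : is_bilinear (@lie0 R d).
Proof. exact: bilinext_bilinear. Qed.

Lemma lie_bilinear : is_bilinear (@lie R d).
Proof. exact: bilinext_bilinear. Qed.

Lemma tri_bilinear : is_bilinear (@tri R d).
Proof. exact: bilinext_bilinear. Qed.

(** The pre-Lie product whose commutator is [lie0]: the partial_i act by minus
    the lowering of n, and tilde L acts by 0. *)
Definition tri0 : V -> V -> V := bilinext (fun a b =>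
  match a, b with inr i, inl x => - lower R x i | _, _ => 0 end).

Lemma tri0_bilinear : is_bilinear tri0.
Proof. exact: bilinext_bilinear. Qed.

Lemma field2_ext (n m : vec d) (W : lmodType R) (f : V -> V -> W) (g : P -> P -> W) p q :
  is_bilinear f -> is_bilinear g ->
  (forall b c, f (zD R b n) (zD R c m) = g << val b >> << val c >>) ->
  nonneg p -> nonneg q -> f (field n p) (field m q) = g p q.
Proof.
move=> fb gb e hp hq.
apply: (nonneg_lin_ext (lin_comp (bilinl _ fb) (field_linear n)) (bilinl q gb) _ hp) => b.
apply: (nonneg_lin_ext (lin_comp (bilinr _ fb) (field_linear m)) (bilinr _ gb) _ hq) => c.
by rewrite !field_monom.
Qed.

Lemma tri_field n m p q : nonneg p -> nonneg q ->
  tri (field n p) (field m q) = field m (p * derD n q).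
Proof.
apply: (field2_ext tri_bilinear (g := fun p q => field m (p * derD n q))).
  apply: bilin_lin (field_linear m).
  exact: bilin_comp (bilin_mul P) (@lin_id _ _) (derD_der R n).1.
by move=> b c; exact: bilinextU.
Qed.

Lemma tri_partial_field i m q : nonneg q ->
  tri (partial i) (field m q) = field m (derpart i q).
Proof.
apply: (nonneg_lin_ext (lin_comp (bilinr _ tri_bilinear) (field_linear m))
                       (lin_comp (field_linear m) (derpart_der R i).1)) => b.
by rewrite field_monom; exact: bilinextU.
Qed.

Lemma lin_zero (U W : lmodType R) : linear (fun _ : U => 0 : W).
Proof. by move=> a u v; rewrite scaler0 addr0. Qed.

Lemma tri_partial x i : tri x (partial i) = 0.
Proof.
move: x; apply: (malg_lin_ext (bilinl _ tri_bilinear) (@lin_zero _ _)) => a.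
by rewrite /tri bilinextU; case: a.
Qed.

Lemma bilin_zero (U W X : lmodType R) : is_bilinear (fun (_ : U) (_ : W) => 0 : X).
Proof. by split=> u; exact: lin_zero. Qed.

Lemma lie0_field n m p q : nonneg p -> nonneg q -> lie0 (field n p) (field m q) = 0.
Proof.
apply: (field2_ext lie0_bilinear (@bilin_zero _ _ _)).
by move=> b c; exact: bilinextU.
Qed.

Lemma lowerE (n : vec d) b i :
  lower R (b, n) i = (n i)%:R *: field (vsub n (vunit i)) << val b >>.
Proof. by rewrite field_monom. Qed.

Lemma lie0_field_partial (n : vec d) p i : nonneg p ->
  lie0 (field n p) (partial i) = (n i)%:R *: field (vsub n (vunit i)) p.
Proof.
apply: (nonneg_lin_ext (lin_comp (bilinl _ lie0_bilinear) (field_linear n))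
                       (lin_scale _ (field_linear _))) => b.
by rewrite field_monom -lowerE; exact: bilinextU.
Qed.

Lemma lie0_partial_field (n : vec d) p i : nonneg p ->
  lie0 (partial i) (field n p) = - ((n i)%:R *: field (vsub n (vunit i)) p).
Proof.
apply: (nonneg_lin_ext (lin_comp (bilinr _ lie0_bilinear) (field_linear n))
                       (lin_opp (lin_scale _ (field_linear _)))) => b.
by rewrite field_monom -lowerE; exact: bilinextU.
Qed.

Lemma lie0_partial i j : lie0 (partial i) (partial j) = 0.
Proof. exact: bilinextU. Qed.

Lemma tri0_field n p x : nonneg p -> tri0 (field n p) x = 0.
Proof.
move: x; suff h b x : tri0 (zD R b n) x = 0.
  move=> x; apply: (nonneg_lin_ext (lin_comp (bilinl _ tri0_bilinear) (field_linear n))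
                    (@lin_zero _ _)) => b.
  by rewrite field_monom.
move: x; apply: (malg_lin_ext (bilinr _ tri0_bilinear) (@lin_zero _ _)) => a.
exact: bilinextU.
Qed.

Lemma tri0_partial i j : tri0 (partial i) (partial j) = 0.
Proof. exact: bilinextU. Qed.

Lemma tri0_partial_field i (n : vec d) p : nonneg p ->
  tri0 (partial i) (field n p) = - ((n i)%:R *: field (vsub n (vunit i)) p).
Proof.
apply: (nonneg_lin_ext (lin_comp (bilinr _ tri0_bilinear) (field_linear n))
                       (lin_opp (lin_scale _ (field_linear _)))) => b.
by rewrite field_monom -lowerE; exact: bilinextU.
Qed.

Lemma lieE (x y : V) : lie x y = lie0 x y + tri x y - tri y x.
Proof.
move: x y; apply: malg_bilin_ext.
- exact: lie_bilinear.
- apply: bilin_add; first exact: bilin_add lie0_bilinear tri_bilinear.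
  exact: bilin_opp (bilin_flip tri_bilinear).
move=> a b; rewrite /lie /lie0 /tri !bilinextU.
case: a b => [x|i] [y|j] /=.
- by rewrite add0r.
- by rewrite addr0.
- by rewrite subr0 opprB addrC.
- by rewrite addr0 subrr.
Qed.
End Field.


(** * Extensions of the post-Lie product and the comparison map *)

Section Assembly.
Variable R : comNzRingType.

Lemma is_basis_can (V W : lmodType R) (K : choiceType)
    (f : K -> V) (g : V -> W) (h : W -> V) :
  linear g -> cancel g h -> cancel h g -> is_basis f -> is_basis (fun k => g (f k)).
Proof.
move=> gl gK hK fb.
have hl : linear h by move=> a x y; apply: (can_inj gK); rewrite gl !hK.
have e c : g (linext f c) = linext (fun k => g (f k)) c.
  move: c; apply: (malg_lin_ext (lin_comp gl (linext_linear f)) (linext_linear _)) => k.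
  by rewrite !linextU.
move=> w; have [c [hc uc]] := fb (h w); exists c; split; first by rewrite -e -hc hK.
by move=> c' hc'; apply: uc; rewrite hc' -e gK.
Qed.

Lemma prod_perm_comm (A : algType R) (T : eqType) (F : T -> A) w w' :
  (forall x y, F x * F y = F y * F x) -> perm_eq w w' ->
  \prod_(x <- w) F x = \prod_(x <- w') F x.
Proof.
move=> hF; elim: w w' => [|k w ih] w' pw.
  by move: (perm_size pw) => /= /esym/size0nil ->.
have kw' : k \in w' by rewrite -(perm_mem pw) mem_head.
case/splitPr: kw' pw => w1 w2 pw.
have pw' : perm_eq w (w1 ++ w2).
  by move: pw; rewrite -[k :: w2]cat1s perm_sym perm_catCA /= perm_cons perm_sym.
rewrite big_cat /= !big_cons (ih _ pw') big_cat /= !mulrA; congr (_ * _).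
elim: w1 {pw pw'} => [|l w1 ihl]; first by rewrite big_nil mulr1 mul1r.
by rewrite big_cons mulrA hF -!mulrA ihl.
Qed.

Section PostLie.
Variables (V : lmodType R) (br0 tri br : V -> V -> V).
Variables (U0 : algType R) (i0 : V -> U0) (Delta0 : U0 -> tensor U0 U0).
Variables (eps0 : U0 -> R) (S0 : U0 -> U0).
Variables (U : algType R) (i : V -> U) (Delta : U -> tensor U U) (eps : U -> R).
Variable (S : U -> U).
Hypothesis E0 : envelope br0 i0 Delta0 eps0 S0.
Hypothesis E : envelope br i Delta eps S.
Hypothesis tri_bilin : is_bilinear tri.
Hypothesis br_def : forall x y, br x y = br0 x y + tri x y - tri y x.
Hypothesis tri_br0 : forall x y z,
  tri x (br0 y z) = br0 (tri x y) z + br0 y (tri x z).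
Hypothesis br0_tri : forall x y z, tri (br0 x y) z =
  tri x (tri y z) - tri (tri x y) z - (tri y (tri x z) - tri (tri y x) z).

Lemma postlie_delta : exists delta : V -> U0 -> U0,
  [/\ forall x, linear (delta x), forall x, delta x 1 = 0 &
      forall x y u, delta x (i0 y * u) = i0 (tri x y) * u + i0 y * delta x u].
Proof.
have /choice [delta hd] : forall x, exists delta : U0 -> U0,
    [/\ linear delta, delta 1 = 0 &
        forall y u, delta (i0 y * u) = i0 (tri x y) * u + i0 y * delta u].
  by move=> x; apply: (env_derivation E0 (bilinr x tri_bilin)) => y z; apply: tri_br0.
by exists delta; split=> x; have [] := hd x.
Qed.

Lemma postlie_leading : exists Psi : U -> U0, linear Psi /\ leading i i0 Psi.
Proof.
have [delta [dl d1 dM]] := postlie_delta.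
have [act [ab a1 aM]] := env_act E (bilin_rho E0 tri_bilin dl d1 dM)
  (rho_rep E0 tri_bilin br_def br0_tri dl d1 dM).
exists (Psi act); split; first exact: Psi_linear.
exact: (Psi_leading dl d1 dM a1 aM).
Qed.

(** [extends_postlie] for an abstract enveloping algebra. *)
Record extension (T : U0 -> U0 -> U0) : Prop := Extension {
  extn_bilinear : is_bilinear T;
  extn_in : forall x y, T (i0 x) (i0 y) = i0 (tri x y);
  extn_in1 : forall x, T (i0 x) 1 = 0;
  extn_prod : forall x (n : nat) (y : 'I_n -> V), T (i0 x) (\prod_j i0 (y j)) =
    \sum_(j < n) \prod_(k < n) i0 (if k == j then tri x (y k) else y k);
  extn_1 : forall A, T 1 A = A;
  extn_inM : forall x A y,
    T (i0 x * A) (i0 y) = T (i0 x) (T A (i0 y)) - T (T (i0 x) A) (i0 y);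
  extn_mulr : forall A B C,
    T A (B * C) = tens_ext (fun A1 A2 => T A1 B * T A2 C) (Delta0 A)
}.

(* This holds when V is free: leading terms are then independent. *)
Hypothesis leading_inj0 : forall Psi : U -> U0, linear Psi -> leading i i0 Psi ->
  forall u, Psi u = 0 -> u = 0.

Lemma leading_bij (Psi : U -> U0) : linear Psi -> leading i i0 Psi ->
  (forall n u0, filt i0 n u0 -> exists u, Psi u = u0) ->
  exists Theta, cancel Psi Theta /\ cancel Theta Psi.
Proof.
move=> Pl Pi Ps; have [Theta hT] : exists Theta, cancel Theta Psi.
  have /choice [Theta hT] : forall u0, exists u, Psi u = u0.
    by move=> u0; have [n hn] := env_filt E0 u0; apply: Ps hn.
  by exists Theta.
exists Theta; split=> // u; apply/eqP; rewrite -subr_eq0; apply/eqP.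
by apply: (leading_inj0 Pl Pi); rewrite (linB Pl) hT subrr.
Qed.

Lemma extension_exists : exists T, extension T.
Proof.
have [delta [dl d1 dM]] := postlie_delta.
have rb := bilin_rho E0 tri_bilin dl d1 dM.
have [act [ab a1 aM]] := env_act E rb (rho_rep E0 tri_bilin br_def br0_tri dl d1 dM).
have [alpha [alb al1 alM]] := env_act E (bilin_delta E0 tri_bilin dl d1 dM)
  (delta_comm E0 tri_bilin br_def br0_tri dl d1 dM).
have Pl := Psi_linear ab; have Pd := Psi_leading dl d1 dM a1 aM.
have [Theta [PK TK]] := leading_bij Pl Pd (Psi_surj dl d1 dM ab a1 aM).
have Tin := guin_oudom_in d1 ab a1 aM alb al1 alM PK TK.
exists (guin_oudom alpha Theta); split.
- exact: (bilin_guin_oudom ab alb PK TK).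
- by move=> x y; rewrite Tin (delta_in d1 dM).
- by move=> x; rewrite Tin d1.
- exact: (guin_oudom_prod d1 dM ab a1 aM alb al1 alM PK TK).
- exact: (guin_oudom1 a1 al1 PK).
- move=> x A y; rewrite !Tin.
  exact: (guin_oudomM ab aM alb alM PK TK).
- exact: (guin_oudom_mulr E0 E tri_bilin dl d1 dM ab a1 aM alb al1 alM PK TK).
Qed.

Definition star_ops (T : U0 -> U0 -> U0) (S' : U0 -> U0) : hopf_ops U0 :=
  HopfOps (fun A B => tens_ext (fun A1 A2 => A1 * T A2 B) (Delta0 A)) 1 Delta0 eps0 S'.

Lemma extension_hopf T : extension T ->
  exists (S' : U0 -> U0) (Phi : U0 -> U) (Psi : U -> U0),
  [/\ is_hopf (star_ops T S'),
      is_hopf_iso (star_ops T S') (HopfOps *%R 1 Delta eps S) Phi,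
      linear Phi, cancel Phi Psi & cancel Psi Phi].
Proof.
case=> Tb Tin Tin1 _ T1 TinM Tmulr; pose delta x := T (i0 x).
have dl x : linear (delta x) := bilinr _ Tb.
have dM := ext_deltaM E0 Tb Tin T1 Tmulr.
have TM := ext_TM E0 Tb Tin Tin1 T1 TinM Tmulr.
have rb := bilin_rho E0 tri_bilin dl Tin1 dM.
have [act [ab a1 aM]] := env_act E rb (rho_rep E0 tri_bilin br_def br0_tri dl Tin1 dM).
have Pl := Psi_linear ab; have Pd := Psi_leading dl Tin1 dM a1 aM.
have [Theta [PK TK]] := leading_bij Pl Pd (Psi_surj dl Tin1 dM ab a1 aM).
pose S' A := Psi act (S (Theta A)); exists S', Theta, (Psi act).
pose h := HopfOps *%R 1 Delta eps S.
have Pmul : {morph Psi act : u v / hmul h u v >-> hmul (star_ops T S') u v}.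
  move=> u v; rewrite /= (star_Psi E0 E tri_bilin dl Tin1 dM ab a1 aM Tb T1 TM).
  exact: (act_mul E ab a1 aM).
have Pcom := Psi_comul E0 E tri_bilin dl Tin1 dM ab a1 aM.
have Pcou := Psi_counit E0 E dl Tin1 dM ab a1 aM.
have Pant : {morph Psi act : u / hantipode h u >-> hantipode (star_ops T S') u}.
  by move=> u; rewrite /= /S' PK.
have hh : is_hopf h := env_hopf E.
split; [| |exact: can_linear Pl PK TK|exact: TK|exact: PK].
- exact: (hopf_transport hh Pl TK Pmul (a1 1) Pcom Pcou Pant).
- exact: (hopf_transport_iso (h := h) Pl PK TK Pmul (a1 1) Pcom Pcou Pant).
Qed.
End PostLie.

Section FreeModule.
Variables (K : choiceType) (UZ : algType R) (iz : {malg R[K]} -> UZ).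
Variables (DeltaZ : UZ -> tensor UZ UZ) (epsZ : UZ -> R) (SZ : UZ -> UZ).
Hypothesis EZ : envelope (fun _ _ => 0) iz DeltaZ epsZ SZ.

(** The generators act on polynomials by multiplication, so that a word goes to
    exactly its monomial. *)
Lemma abelian_leading : exists f : UZ -> {malg R[{cmonom K}]},
  linear f /\ leading iz (@pol_in R K) f.
Proof.
pose P : comAlgType R := {malg R[{cmonom K}]}.
have rb : is_bilinear (fun x (p : P) => pol_in x * p).
  exact: (bilin_comp (bilin_mul P) (@pol_in_linear R K) (@lin_id _ _)).
have pol0 : pol_in 0 = 0 :> P := lin0 (@pol_in_linear R K).
have rr (x y : {malg R[K]}) (p : P) :
    pol_in x * (pol_in y * p) - pol_in y * (pol_in x * p) = pol_in 0 * p.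
  have comm (A : comAlgType R) (a b c : A) : a * (b * c) - b * (a * c) = 0 * c.
    by rewrite mulrCA subrr mul0r.
  by rewrite pol0; exact: comm.
have [act [ab a1 aM]] := env_act EZ rb rr.
exists (fun u => act u 1); split; first exact: bilinl.
move=> w; have -> : act (jword iz w) 1 = jword (@pol_in R K : _ -> P) w.
  elim: w => [|x w ih]; first by rewrite !jword_nil a1.
  by rewrite !jword_cons aM ih.
by rewrite subrr; exact: Submod0.
Qed.
End FreeModule.
End Assembly.

(** * The theorem for the Lie algebra L *)

Section PostLieL.
Variables (R : realType) (d : nat).
Local Notation P := {malg R[{cmonom zvar d}]}.
Local Notation partial := (fun i : 'I_d.+1 => << inr i >> : L R d).

Let X_ext := @der_ext R (zvar d).

Let derD_commP m n (p : P) : derD m (derD n p) = derD n (derD m p).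
Proof.
exact: (derD_comm X_ext (@derD_der R d) (@derD0_inl R d)
  (fun n k => @derDn_inl R d n k) (@derDn_inr R d)).
Qed.

Let derD_derpartP n i (p : P) :
  derD n (derpart i p) - derpart i (derD n p) = (n i)%:R *: derD (vsub n (vunit i)) p.
Proof.
exact: (derD_derpart X_ext (@derD_der R d) (@derpart_der R d) (@derD0_inl R d)
  (fun n k => @derDn_inl R d n k) (@derDn_inr R d) (@derpart_inl R d) (@derpart_inr R d)).
Qed.

Let derpart_commP i j (p : P) : derpart i (derpart j p) = derpart j (derpart i p).
Proof.
exact: (derpart_comm X_ext (@derpart_der R d) (@derpart_inl R d) (@derpart_inr R d)).
Qed.

Let nonneg_mul_derD (p q : P) n : nonneg p -> nonneg q -> nonneg (p * derD n q).
Proof. by move=> hp hq; exact: nonnegM hp (derD_nonneg n hq). Qed.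

Let nonneg_derpart (p : P) i : nonneg p -> nonneg (derpart i p).
Proof. exact: derpart_nonneg. Qed.

Lemma L_tri_lie0 (x y z : L R d) :
  tri x (lie0 y z) = lie0 (tri x y) z + lie0 y (tri x z).
Proof.
exact: (tri_lie0 nonneg_mul_derD nonneg_derpart (@L_ext R d)
  (@lie0_bilinear R d) (@tri_bilinear R d) (@tri_field R d) (@tri_partial_field R d)
  (@tri_partial R d) (@lie0_field R d) (@lie0_field_partial R d)
  (@lie0_partial_field R d) (@lie0_partial R d)).
Qed.

Lemma L_lie0_tri (x y z : L R d) : tri (lie0 x y) z =
  tri x (tri y z) - tri (tri x y) z - (tri y (tri x z) - tri (tri y x) z).
Proof.
exact: (lie0_tri (@derD_der R d) (@derpart_der R d) derD_commP derD_derpartP derpart_commP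
  nonneg_mul_derD nonneg_derpart (@field_linear R d) (@L_ext R d)
  (@lie0_bilinear R d) (@tri_bilinear R d) (@tri_field R d) (@tri_partial_field R d)
  (@tri_partial R d) (@lie0_field R d) (@lie0_field_partial R d)
  (@lie0_partial_field R d) (@lie0_partial R d)).
Qed.

Lemma L_lie0_preLie (x y : L R d) : lie0 x y = 0 + tri0 x y - tri0 y x.
Proof.
exact: (lie0_preLie (@L_ext R d) (@lie0_bilinear R d) (@lie0_field R d)
  (@lie0_field_partial R d) (@lie0_partial_field R d) (@lie0_partial R d)
  (@tri0_bilinear R d) (@tri0_field R d) (@tri0_partial R d) (@tri0_partial_field R d)).
Qed.

Lemma L_tri0_assoc (x y z : L R d) : tri0 0 z =
  tri0 x (tri0 y z) - tri0 (tri0 x y) z - (tri0 y (tri0 x z) - tri0 (tri0 y x) z).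
Proof.
exact: (tri0_assoc (@L_ext R d) (@tri0_bilinear R d) (@tri0_field R d)
  (@tri0_partial R d) (@tri0_partial_field R d)).
Qed.

Lemma tildeL_lie0 (x y : L R d) : in_tildeL x -> in_tildeL y -> lie0 x y = 0.
Proof.
move=> hx hy; apply: big1_seq => -[a|i] /andP [_ ha]; last first.
  by move: ha; rewrite -mcoeff_neq0 hx eqxx.
rewrite [linext _ y]big1_seq; first exact: scaler0.
move=> -[b|i] /andP [_ hb]; first exact: scaler0.
by move: hb; rewrite -mcoeff_neq0 hy eqxx.
Qed.
End PostLieL.

Section WordSections.
Variable K : choiceType.

Lemma kmon_eq (w w' : seq K) : perm_eq w w' -> kmon w = kmon w'.
Proof. by move=> h; rewrite /kmon (perm_big _ h). Qed.

Lemma word_section : exists s : {cmonom K} -> seq K,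
  (forall w, exists a, perm_eq w (s a)) /\ (forall a b, perm_eq (s a) (s b) -> a = b).
Proof.
have /choice [s hs] := @kmon_surj K.
exists s; split=> [w|a b /kmon_eq]; last by rewrite !hs.
by exists (kmon w); apply: kmon_perm; rewrite hs.
Qed.

Variable le : rel K.
Hypotheses (le_trans : transitive le) (le_anti : antisymmetric le) (le_total : total le).

Lemma sorted_section_surj (w : seq K) :
  exists a : {w : seq K | sorted le w}, perm_eq w (val a).
Proof.
by exists (Sub (sort le w) (sort_sorted le_total w)); rewrite /= perm_sym perm_sort.
Qed.

Lemma sorted_section_inj (a b : {w : seq K | sorted le w}) :
  perm_eq (val a) (val b) -> a = b.
Proof. by move=> h; apply/val_inj/(sorted_eq le_trans le_anti (valP a) (valP b) h). Qed.
End WordSections.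

Section LeadingPol.
Variables (R : comNzRingType) (K : choiceType).
Variable br : {malg R[K]} -> {malg R[K]} -> {malg R[K]}.
Variables (U : algType R) (i : {malg R[K]} -> U) (Delta : U -> tensor U U) (eps : U -> R).
Variable (S : U -> U).
Hypothesis E : envelope br i Delta eps S.
Variable f : U -> {malg R[{cmonom K}]}.
Hypothesis f_lin : linear f.
Hypothesis f_lead : leading i (@pol_in R K) f.

Lemma leading_pol_inj u : f u = 0 -> u = 0.
Proof.
have [s [s_surj s_inj]] := word_section K.
exact: (leading_inj (env_linear E) (env_br E) (env_filt E) f_lin f_lead s_surj s_inj).
Qed.

Lemma sorted_basis (le : rel K) : transitive le -> antisymmetric le -> total le ->
  is_basis (fun w : {w : seq K | sorted le w} => kword i (val w)).
Proof.
move=> tr an to.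
exact: (kword_basis (env_linear E) (env_br E) (env_filt E) f_lin f_lead
  (sorted_section_surj to) (sorted_section_inj tr an)).
Qed.
End LeadingPol.

Section Reordering.
Variables (R : comNzRingType) (d : nat) (le : rel (lbasis d)).
Hypothesis le_order : total_order le.
Hypothesis le_block : tildeL_block le.
Variables (A : algType R) (F : lbasis d -> A).
Hypothesis F_comm : forall x y : tbasis d, F (inl x) * F (inl y) = F (inl y) * F (inl x).

Let part (b : lbasis d) : option 'I_d.+1 := if b is inr i then Some i else None.

Let tilde_words (w : seq (lbasis d)) : all (fun b => part b == None) w ->
  exists t : seq (tbasis d), w = [seq inl x | x <- t].
Proof.
elim: w => [|[x|i] w ih] //= h; first by exists [::].
by have [t ->] := ih h; exists (x :: t).
Qed.

(* A factor partial_j in between would be above [inl x] and below [inl y],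
   which a block order excludes. *)
Let tilde_block x v y : sorted le (inl x :: rcons v (inl y)) ->
  all (fun b => part b == None) (inl x :: rcons v (inl y)).
Proof.
have [_ an tr _] := le_order; move=> hs.
rewrite /= all_rcons /=; apply/allP => -[//|j] jv.
have h1 : le (inl x) (inr j).
  have := order_path_min tr hs; rewrite all_rcons => /andP [_ /allP h].
  exact: h.
have h2 : le (inr j) (inl y).
  have sub : subseq [:: inr j; inl y] (rcons v (inl y)).
    by rewrite -cats1 -[[:: inr j; _]]cat1s cat_subseq ?sub1seq ?mem_head.
  by case/andP: (subseq_sorted tr sub (path_sorted hs)).
have /an : le (inr j) (inl y) && le (inl y) (inr j) by rewrite h2 (le_block j y x).
by [].
Qed.

(** Factors partial_i at either end of the word are stripped off; what remains
    starts and ends in tilde L, so it has no other factors. *)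
Lemma prod_reordering w w' : sorted le w -> tildeL_reordering w w' ->
  \prod_(b <- w') F b = \prod_(b <- w) F b.
Proof.
have [n hn] := ubnP (size w); elim: n w w' hn => [//|n ih] w w' hn hs [pw mw].
have {mw} mw : map part w = map part w' := mw.
case: w hn hs pw mw => [|[x|i] w] hn hs pw mw.
- by move: (perm_size pw) => /= /esym/size0nil ->.
- case/lastP: w => [|w [y|j]] in hn hs pw mw *.
  + by have -> : w' = [:: inl x] by apply/perm_small_eq; rewrite // perm_sym.
  + have hall := tilde_block hs.
    have hall' : all (fun b => part b == None) w'.
      by rewrite -(all_map part (fun o => o == None)) -mw all_map.
    have [t ht] := tilde_words hall; have [t' ht'] := tilde_words hall'.
    have inl_inj : injective (@inl (tbasis d) 'I_d.+1) by move=> a b [].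
    move: pw; rewrite ht ht' !big_map => /(perm_map_inj inl_inj) pt.
    exact/esym/(prod_perm_comm F_comm pt).
  + case/lastP: w' pw mw => [|w' b] pw mw; first by have := perm_size pw.
    move: mw pw; rewrite -rcons_cons !map_rcons => /eqP; rewrite eqseq_rcons.
    case/andP => /eqP mw; case: b => [//|k] /eqP [<-].
    rewrite perm_rcons perm_sym perm_rcons perm_cons perm_sym => pw.
    rewrite -!cats1 !big_cat /=; congr (_ * _); apply: ih => //.
    * by move: hn; rewrite /= size_rcons.
    * by move: hs; rewrite -rcons_cons -cats1 => /cat_sorted2 [].
- case: w' pw mw => [|b w'] pw mw; first by have := perm_size pw.
  case: mw => hb mw; case: b hb pw => [//|k] [<-]; rewrite perm_cons => pw.
  rewrite !big_cons; congr (_ * _); apply: ih => //.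
  exact: path_sorted hs.
Qed.
End Reordering.

Section Final.
Variables (R : realType) (d : nat).
Local Notation V := (L R d).
Variables (U0 : algType R) (i0 : V -> U0) (Delta0 : U0 -> tensor U0 U0).
Variables (eps0 : U0 -> R) (S0 : U0 -> U0).
Variables (U : algType R) (i : V -> U) (Delta : U -> tensor U U) (eps : U -> R).
Variable (S : U -> U).
Hypothesis E0 : envelope (@lie0 R d) i0 Delta0 eps0 S0.
Hypothesis E : envelope (@lie R d) i Delta eps S.

(** The same comparison map, applied to the post-Lie algebra with zero bracket
    and product [tri0], leads from U(L_0) to the symmetric algebra. *)
Lemma L0_leading_pol : exists f : U0 -> {malg R[{cmonom lbasis d}]},
  linear f /\ leading i0 (@pol_in R (lbasis d)) f.
Proof.
have EZ := uenv_envelope (fun _ _ : V => 0).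
have [g [gl gd]] := abelian_leading EZ.
have z (x y z : V) : tri0 x 0 = (0 : V) + 0.
  by rewrite addr0; exact: lin0 (bilinr x (@tri0_bilinear R d)).
have [Psi [Pl Pd]] := postlie_leading EZ E0 (@tri0_bilinear R d) (@L_lie0_preLie R d)
  z (@L_tri0_assoc R d).
exists (fun u => g (Psi u)); split; first exact: lin_comp gl Pl.
exact: leading_comp gl Pd gd.
Qed.

Lemma L_leading_inj (Psi : U -> U0) : linear Psi -> leading i i0 Psi ->
  forall u, Psi u = 0 -> u = 0.
Proof.
move=> Pl Pd u Pu; have [f [fl fd]] := L0_leading_pol.
apply: (leading_pol_inj E (lin_comp fl Pl) (leading_comp fl Pd fd)).
by rewrite Pu (lin0 fl).
Qed.

Lemma L_extension_exists : exists T, extension (@tri R d) i0 Delta0 T.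
Proof.
exact: (extension_exists E0 E (@tri_bilinear R d) (@lieE R d) (@L_tri_lie0 R d)
  (@L_lie0_tri R d) L_leading_inj).
Qed.

Lemma L_comparison T : extension (@tri R d) i0 Delta0 T ->
  exists (S' : U0 -> U0) (Phi : U0 -> U),
    [/\ is_hopf (star_ops Delta0 eps0 T S'),
        is_hopf_iso (star_ops Delta0 eps0 T S') (HopfOps *%R 1 Delta eps S) Phi,
        (forall x y, in_tildeL x -> in_tildeL y -> i0 x * i0 y = i0 y * i0 x) &
        forall le : rel (lbasis d), total_order le ->
          [/\ tildeL_block le ->
                forall w w' : seq (lbasis d), sorted le w -> tildeL_reordering w w' ->
                  kword i0 w' = kword i0 w,
              is_basis (fun w : {w : seq (lbasis d) | sorted le w} => kword i0 (val w)) &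
              is_basis (fun w : {w : seq (lbasis d) | sorted le w} =>
                          Phi (kword i0 (val w)))]].
Proof.
move=> hT.
have [S' [Phi [Psi [h1 h2 Pl PK PK']]]] := extension_hopf E0 E (@tri_bilinear R d)
  (@lieE R d) (@L_lie0_tri R d) L_leading_inj hT.
have comm x y : in_tildeL x -> in_tildeL y -> i0 x * i0 y = i0 y * i0 x.
  move=> hx hy; apply/eqP; rewrite -subr_eq0 (env_br E0) (tildeL_lie0 hx hy).
  by rewrite (lin0 (env_linear E0)).
exists S', Phi; split; [exact: h1|exact: h2|exact: comm|] => le hle.
have [_ an tr to] := hle; have [f [fl fd]] := L0_leading_pol.
have hb := sorted_basis E0 fl fd tr an to.
split; [|exact: hb|exact: is_basis_can Pl PK PK' hb].
move=> hblock w w'; apply: (prod_reordering hle hblock) => x y.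
by apply: comm => j; rewrite mcoeffU.
Qed.
End Final.

Theorem theorem5p7 (R : realType) (d : nat) :
  let U := uenv (@lie R d) in
  let U0 := uenv (@lie0 R d) in
  (exists T : U0 -> U0 -> U0, extends_postlie (@tri R d) T) /\
  forall T : U0 -> U0 -> U0, extends_postlie (@tri R d) T ->
  exists (S : U0 -> U0) (Phi : U0 -> U),
    [/\ is_hopf (uenv_hopf (@lie R d)),
        is_hopf (star_hopf T S),
        is_hopf_iso (star_hopf T S) (uenv_hopf (@lie R d)) Phi,
        (forall x y : L R d, in_tildeL x -> in_tildeL y ->
           uenv_in (@lie0 R d) x * uenv_in (@lie0 R d) y =
           uenv_in (@lie0 R d) y * uenv_in (@lie0 R d) x) &
        forall le : rel (lbasis d), total_order le ->
          [/\ tildeL_block le ->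
                forall w w' : seq (lbasis d), sorted le w ->
                  tildeL_reordering w w' -> pbw R w' = pbw R w,
              is_basis (fun w : {w : seq (lbasis d) | sorted le w} =>
                          pbw R (val w)) &
              is_basis (fun w : {w : seq (lbasis d) | sorted le w} =>
                          Phi (pbw R (val w)))]].
Proof.
have E0 := uenv_envelope (@lie0 R d); have E := uenv_envelope (@lie R d).
move=> U U0; split.
  have [T [h1 h2 h3 h4 h5 h6 h7]] := L_extension_exists E0 E.
  exists T; split.
  - exact: h1.
  - exact: h2.
  - exact: h3.
  - exact: h4.
  - exact: h5.
  - exact: h6.
  - exact: h7.
move=> T [h1 h2 h3 h4 h5 h6 h7].
have hT : extension (@tri R d) (uenv_in (@lie0 R d)) (uenv_comul (br := @lie0 R d)) T.
  split.
  - exact: h1.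
  - exact: h2.
  - exact: h3.
  - exact: h4.
  - exact: h5.
  - exact: h6.
  - exact: h7.
have [S [Phi [k1 k2 k3 k4]]] := L_comparison E0 E hT.
exists S, Phi; split.
- exact: uenv_is_hopf.
- exact: k1.
- exact: k2.
- exact: k3.
- exact: k4.
Qed.
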